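(* Stationary data: let $h\in C(\Omega)$ satisfy $0<\frac{\alpha}{d(x)^{2s}}\le h(x)\le\frac{\beta}{d(x)^{2s}}$ for some $0<\alpha\le\beta$, let $f\in C(\Omega)$, and let $x\mapsto\Omega(x)\subset\Omega$ and the open set $\Sigma\subset\mathbb{R}^N$ satisfy (i) for all $x\in\Omega$, $\lim_{y\to x}|\Omega(y)\triangle\Omega(x)|=0$; (ii) there is $\zeta\in(0,1/2)$ such that for all $x\in\Omega$ and $r\le\zeta d(x)$, $\tilde\Omega(x)\cap B_r(0)=\Sigma\cap B_r(0)$; (iii) $\Sigma=-\Sigma$ and there is $q\in(0,1)$ such that $|\Sigma\cap(B_{2r}(0)\setminus B_r(0))|\ge q|B_{2r}(0)\setminus B_r(0)|$ for every $r>0$. Time-dependent data: let $h(\cdot,\cdot)\in C((0,\infty)\times\Omega)$ satisfy $\frac{\alpha}{d(x)^{2s}}\le h(t,x)\le\frac{\beta}{d(x)^{2s}}$, let $(t,x)\mapsto\Omega(t,x)\subset\Omega$ satisfy (iv) for all $(t,x)\in(0,\infty)\times\Omega$, $\lim_{(\tau,y)\to(t,x)}|\Omega(\tau,y)\triangle\Omega(t,x)|=0$; (v) there is $\zeta\in(0,1/2)$ such that for all $(t,x)\in(0,\infty)\times\Omega$ and $r\le\zeta d(x)$, $\tilde\Omega(t,x)\cap B_r(0)=\Sigma\cap B_r(0)$; and let $f(\cdot,\cdot)\in C((0,\infty)\times\Omega)$, $u_0\in C(\Omega)$ be such that for some $\eta_1\in(0,2s)$ and $C_0>0$, $|f(t,x)|d(x)^{2s-\eta_1}\le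 C_0$ and $|u_0(x)|d(x)^{-\eta_1}\le C_0$ for all $(t,x)\in(0,\infty)\times\Omega$. Convergence of the data: assume that for some $\eta_2\in(0,2s)$, some $\lambda<\overline\lambda$ (with $\overline\lambda$ the first eigenvalue of the stationary operator, defined in the context) and some constants $C_1,C_2$, $$\big(|f(t,x)-f(x)|+|h(t,x)-h(x)|\big)d(x)^{2s-\eta_2}e^{\lambda t}\le C_1,\qquad |\Omega(t,x)\triangle\Omega(x)|\,d(x)^{-N-\eta_2}e^{\lambda t}\le C_2$$ for all $(t,x)\in(0,\infty)\times\Omega$. Let $u$ be the unique viscosity solution of $$\begin{cases}\partial_tu(t,x)+h(t,x)u(t,x)+\mathcal{L}_s(\Omega(t,x),u(t,x))=f(t,x)&\text{in }(0,\infty)\times\Omega,\\ u=0&\text{on }(0,\infty)\times\partial\Omega,\\ u(0,x)=u_0(x)&\text{on }\Omega,\end{cases}$$ in $C([0,\infty)\times\overline\Omega)\cap L^\infty([0,\infty)\times\Omega)$, and let $v$ be the unique viscosity solution of $h(x)v(x)+\mathcal{L}_s(\Omega(x),v(x))=f(x)$ in $\Omega$, $v=0$ on $\partial\Omega$. Then there exist $C=C(\lambda)>0$ and $\eta>0$ such that $$|u(t,x)-v(x)|\le C d(x)^{\eta}e^{-\lambda t}\quad\text{for all }(t,x)\in(0,\infty)\times\Omega.$$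
   Context: $\Omega\subset\mathbb{R}^N$ is a bounded domain (nonempty, open, connected), $s\in(0,1)$, $d(x)=\mathrm{dist}(x,\partial\Omega)$, $|\cdot|$ is Lebesgue measure on sets, $\triangle$ is symmetric difference, $B_r(x)$ is the open ball. All sets $\Omega(x),\Omega(t,x)\subset\Omega$ are measurable; $\tilde\Omega(x)=\{z\in\mathbb{R}^N: x-z\in\Omega(x)\}$ and $\tilde\Omega(t,x)=\{z\in\mathbb{R}^N: x-z\in\Omega(t,x)\}$. The operator is $$\mathcal{L}_s(A,\varphi(x))=\mathrm{p.v.}\int_{A}\frac{\varphi(x)-\varphi(y)}{|x-y|^{N+2s}}\,dy=\lim_{\rho\to0}\int_{A\setminus B_\rho(x)}\frac{\varphi(x)-\varphi(y)}{|x-y|^{N+2s}}\,dy,$$ with $A=\Omega(x)$, or $A=\Omega(t,x)$ and $\varphi=\varphi(t,\cdot)$. $\mathrm{USC}_b(D)$, $\mathrm{LSC}_b(D)$ denote the bounded upper, respectively lower, semicontinuous functions on $D$. Elliptic viscosity solutions of $hu+\mathcal{L}_s(\Omega(x),u)=\lambda u+f$ ($\lambda\in\mathbb{R}$): $u\in\mathrm{USC}_b(\Omega)$ is a subsolution if, whenever $x\in\Omega$ and $\varphi\in C^2(\Omega)$ satisfy $u(x)=\varphi(x)$ and $u\le\varphi$ in $\Omega$, one has $h(x)\varphi(x)+\mathcal{L}_s(\Omega(x),\varphi(x))\le\lambda\varphi(x)+f(x)$; $u\in\mathrm{LSC}_b(\Omega)$ is a supersolution if, whenever $u(x)=\varphi(x)$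 and $u\ge\varphi$ in $\Omega$, the inequality $\ge$ holds. A solution of the Dirichlet problem is $u\in C(\overline\Omega)$ that is both and vanishes on $\partial\Omega$. Parabolic viscosity solutions in $(0,T)\times\Omega$, $T\in(0,\infty]$: $u\in\mathrm{USC}_b((0,T)\times\Omega)$ is a subsolution if, whenever $\varphi\in C^2((0,T)\times\Omega)$ satisfies $u(t,x)=\varphi(t,x)$ and $u\le\varphi$ in $(0,T)\times\Omega$, one has $\partial_t\varphi(t,x)+h(t,x)\varphi(t,x)+\mathcal{L}_s(\Omega(t,x),\varphi(t,x))\le f(t,x)$; supersolutions ($\mathrm{LSC}_b$) are defined with $u\ge\varphi$ and $\ge$. A solution of the initial-boundary value problem is $u\in C([0,T)\times\overline\Omega)$ that is both and satisfies the boundary and initial conditions pointwise. First eigenvalue: $\overline\lambda>0$ is the unique number for which $h(x)w+\mathcal{L}_s(\Omega(x),w)=\overline\lambda w$ in $\Omega$, $w=0$ on $\partial\Omega$, admits a viscosity solution $w\in C(\overline\Omega)$ with $w>0$ in $\Omega$. *)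

(* Defs.v *)
From HB Require Import structures.
From mathcomp Require Import all_boot all_order all_algebra.
From mathcomp Require Import all_classical all_reals all_analysis.
Set Implicit Arguments.
Unset Strict Implicit.
Unset Printing Implicit Defensive.
Import Order.TTheory GRing.Theory Num.Theory.
Import numFieldNormedType.Exports.
Local Open Scope classical_set_scope.
Local Open Scope ring_scope.

(* Points of R^N are row vectors in 'rV[R]_n.+1, with N = n.+1 >= 1. The
   library norm and [ball] of this type are those of the sup norm: they give
   the topology, while distances and balls are Euclidean and defined here. *)

Section euclidean.
Context {R : realType} {n : nat}.
Implicit Types (x v : 'rV[R]_n.+1) (D : set 'rV[R]_n.+1).

Definition enorm v : R := Num.sqrt (\sum_i v 0 i ^+ 2).

Definition eball x (r : R) : set 'rV[R]_n.+1 := [set y | enorm (y - x) < r].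

Definition frontier D : set 'rV[R]_n.+1 := closure D `\` interior D.

Definition bdist D x : R := inf [set enorm (x - z) | z in frontier D].

End euclidean.

Section lebesgue.
Context {R : realType} {n : nat}.
Implicit Types (I : ('rV[R]_n.+1 * 'rV[R]_n.+1)).
Local Open Scope ereal_scope.

Definition box I : set 'rV[R]_n.+1 :=
  [set v | forall i, (I.1 ord0 i < v ord0 i <= I.2 ord0 i)%R].

Definition box_volume I : \bar R :=
  (\prod_i Num.max (I.2 ord0 i - I.1 ord0 i) 0)%R%:E.

Definition lebesgue_outer (A : set 'rV[R]_n.+1) : \bar R :=
  ereal_inf [set \sum_(k <oo) box_volume (I k) |
             I in [set I | A `<=` \bigcup_k box (I k)]].

Lemma box_volume_ge0 I : 0 <= box_volume I.
Proof. by rewrite lee_fin prodr_ge0// => i _; rewrite le_max lexx orbT. Qed.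
Hint Resolve box_volume_ge0 : core.

Lemma lebesgue_outer_ge0 A : 0 <= lebesgue_outer A.
Proof. by apply: le_ereal_inf_tmp => _ [I _ <-]; exact: nneseries_ge0. Qed.

Lemma lebesgue_outer0 : lebesgue_outer set0 = 0.
Proof.
apply/eqP; rewrite eq_le lebesgue_outer_ge0 andbT.
apply: ereal_inf_lbound; exists (fun=> (0%R, 0%R)) => //.
apply: eseries0 => k _ _.
by rewrite /box_volume big_ord_recl/= mxE subrr maxxx mul0r.
Qed.

Lemma le_lebesgue_outer : {homo lebesgue_outer : A B / A `<=` B >-> A <= B}.
Proof.
move=> A B AB; apply/ereal_inf_le_tmp => _ [I BI <-].
by exists I => //; exact: subset_trans BI.
Qed.

Lemma lebesgue_outer_sigma_subadditive : sigma_subadditive lebesgue_outer.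
Proof.
move=> A; have [[i ioo]|] := pselect (exists i, lebesgue_outer (A i) = +oo).
  rewrite (eseries_pinfty _ _ ioo) ?leey// => k _.
  by rewrite -ltNye (lt_le_trans _ (lebesgue_outer_ge0 _)).
rewrite -forallNE => Aoo.
suff add2e (e : {posnum R}) : lebesgue_outer (\bigcup_k A k) <=
    \sum_(i <oo) lebesgue_outer (A i) + e%:num%:E.
  by apply/lee_addgt0Pr => _/posnumP[].
rewrite (le_trans _ (epsilon_trick _ _ _))//; last first.
  by move=> k; exact: lebesgue_outer_ge0.
pose P k (B : ('rV[R]_n.+1 * 'rV[R]_n.+1)^nat) :=
  A k `<=` \bigcup_j box (B j) /\
  \sum_(j <oo) box_volume (B j) <=
    lebesgue_outer (A k) + (e%:num / (2 ^ k.+1)%:R)%:E.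
have [G PG] : {G & forall k, P k (G k)}.
  apply: (@choice _ _ P) => k; rewrite /P /lebesgue_outer.
  set S := (X in ereal_inf X); move infS : (ereal_inf S) => iS.
  case: iS infS => [r Sr|Soo|Soo].
  - have en1 : (0 < e%:num / (2 ^ k.+1)%:R)%R by [].
    have /(lb_ereal_inf_adherent en1) : ereal_inf S \is a fin_num by rewrite Sr.
    move=> [x [B AB muBx] xS].
    by exists B; split => //; rewrite muBx -Sr; exact/ltW.
  - by have := Aoo k; rewrite /lebesgue_outer Soo.
  - by have := lebesgue_outer_ge0 (A k); rewrite /lebesgue_outer Soo.
have muG_ge0 x : 0 <= (box_volume \o uncurry G) x by exact: box_volume_ge0.
apply: (@le_trans _ _ (\esum_(i in setT) (box_volume \o uncurry G) i)).
  rewrite /lebesgue_outer; apply: ereal_inf_lbound => /=.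
  have /card_esym/ppcard_eqP[f] := card_nat2.
  exists (uncurry G \o f).
    move=> t [i _] /(PG i).1 [j _ Bijt]; exists (f^-1%FUN (i, j)) => //=.
    by rewrite invK ?inE.
  rewrite -(esum_pred_image (box_volume \o uncurry G) _ xpredT) ?[fun=> _]set_true//.
  by rewrite image_eq.
rewrite (_ : esum _ _ = \sum_(i <oo) \sum_(j <oo ) box_volume (G i j)); last first.
  pose J : nat -> set (nat * nat) := fun i => [set (i, j) | j in setT].
  rewrite (_ : setT = \bigcup_k J k); last first.
    by rewrite predeqE => -[a b]; split => // _; exists a => //; exists b.
  rewrite esum_bigcupT /=; last 2 first.
    - apply/trivIsetP => i j _ _ ij.
      rewrite predeqE => -[k m] /=; split => //= -[] [_] _ [<-{k} _].
      by move=> [m' _] [] /esym/eqP; rewrite (negbTE ij).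
    - by move=> /= [k m]; exact: box_volume_ge0.
  rewrite -(image_id [set: nat]) -fun_true esum_pred_image//; last first.
    by move=> k _; exact: esum_ge0.
  apply: eq_eseriesr => /= j _.
  rewrite -(esum_pred_image (box_volume \o uncurry G) (pair j) predT)//=; last first.
    by move=> ? ? _ _; exact: (@can_inj _ _ _ snd).
  by congr esum; rewrite predeqE => -[a b]; split; move=> [i _ <-]; exists i.
apply: lee_lim.
- apply: is_cvg_nneseries => k *.
  by apply: nneseries_ge0 => m *; exact: (muG_ge0 (k, m)).
- by apply: is_cvg_nneseries => k *; apply: adde_ge0 => //; exact: lebesgue_outer_ge0.
- by near=> k; apply: lee_sum => i _; exact: (PG i).2.
Unshelve. all: by end_near. Qed.

HB.instance Definition _ := isOuterMeasure.Build R _ lebesgue_outer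
  lebesgue_outer0 lebesgue_outer_ge0 le_lebesgue_outer
  lebesgue_outer_sigma_subadditive.

(* N-dimensional Lebesgue measure: [caratheodory_type lebesgue_outer] is
   'rV[R]_n.+1 equipped with the sigma-algebra of Lebesgue measurable sets. *)
Definition lebesgue : set (caratheodory_type lebesgue_outer) -> \bar R :=
  lebesgue_outer.

HB.instance Definition _ := isMeasure.Build _ _ _ lebesgue
  (@caratheodory_measure0 _ _ lebesgue_outer)
  (@caratheodory_measure_ge0 _ _ lebesgue_outer)
  (@caratheodory_measure_sigma_additive _ _ lebesgue_outer).

Definition lebesgue_measurable (A : set 'rV[R]_n.+1) : Prop :=
  lebesgue_outer.-cara.-measurable A.

End lebesgue.

Section functions.
Context {R : realType}.

Definition bounded_on {T : Type} (D : set T) (u : T -> R) : Prop :=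
  exists M : R, forall x, D x -> `|u x| <= M.

Definition usc_b {T : topologicalType} (D : set T) (u : T -> R) : Prop :=
  bounded_on D u /\
  forall x, D x -> forall a, u x < a -> \forall y \near within D (nbhs x), u y < a.

Definition lsc_b {T : topologicalType} (D : set T) (u : T -> R) : Prop :=
  bounded_on D u /\
  forall x, D x -> forall a, a < u x -> \forall y \near within D (nbhs x), a < u y.

(* C^2 functions on an open subset D of a finite-dimensional space; in such a
   space it is the same to ask for all directional derivatives or only for
   the partial ones. *)
Definition C2_on {V : normedModType R} (D : set V) (f : V -> R) : Prop :=
  (forall x, D x -> {for x, continuous f}) /\
  (forall v x, D x -> derivable f x v /\ {for x, continuous ('D_v f)}) /\
  (forall v w x, D x ->
     derivable ('D_v f) x w /\ {for x, continuous ('D_w ('D_v f))}).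

End functions.

Section operator.
Context {R : realType} {n : nat}.
Implicit Types (A : set 'rV[R]_n.+1) (phi : 'rV[R]_n.+1 -> R) (x : 'rV[R]_n.+1).
Local Open Scope ereal_scope.

(* The value is in \bar R: a C^2 test function lying above (resp. below) a
   bounded function may be non-integrable near the boundary of the domain, and
   the integrals are then -oo (resp. +oo). When A agrees near x with x - Sigma
   for a symmetric Sigma, the principal value of such a function exists, so
   [lim] below is a genuine limit. *)
Definition truncated_Ls (s : R) A phi x (rho : R) : \bar R :=
  \int[lebesgue]_(y in A `\` eball x rho)
    ((phi x - phi y) / enorm (x - y) `^ (n.+1%:R + 2 * s))%R%:E.

Definition Ls (s : R) A phi x : \bar R :=
  lim (truncated_Ls s A phi x rho @[rho --> 0%R^'+]).

End operator.

Section elliptic.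
Context {R : realType} {n : nat}.
Local Notation V := 'rV[R]_n.+1.
Implicit Types (Om : set V) (A : V -> set V) (h f u phi : V -> R).
Local Open Scope ereal_scope.

(* The equation h u + L_s(A(x), u) = lam u + f in Om. *)

Definition elliptic_subsolution (s : R) Om A h (lam : R) f u : Prop :=
  usc_b Om u /\
  forall x phi, Om x -> C2_on Om phi -> u x = phi x ->
    (forall y, Om y -> (u y <= phi y)%R) ->
    (h x * phi x)%:E + Ls s (A x) phi x <= (lam * phi x + f x)%:E.

Definition elliptic_supersolution (s : R) Om A h (lam : R) f u : Prop :=
  lsc_b Om u /\
  forall x phi, Om x -> C2_on Om phi -> u x = phi x ->
    (forall y, Om y -> (phi y <= u y)%R) ->
    (lam * phi x + f x)%:E <= (h x * phi x)%:E + Ls s (A x) phi x.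

Definition dirichlet_solution (s : R) Om A h (lam : R) f u : Prop :=
  [/\ {within closure Om, continuous u},
      elliptic_subsolution s Om A h lam f u,
      elliptic_supersolution s Om A h lam f u
    & forall x, frontier Om x -> u x = 0%R].

(* At most one [lam] satisfies this; that uniqueness is a theorem, and it is
   deliberately not made part of the definition. *)
Definition first_eigenvalue (s : R) Om A h (lam : R) : Prop :=
  (0 < lam)%R /\
  exists w : V -> R, dirichlet_solution s Om A h lam (cst 0%R) w /\
    forall x, Om x -> (0 < w x)%R.

End elliptic.

Section parabolic.
Context {R : realType} {n : nat}.
Local Notation V := 'rV[R]_n.+1.
Implicit Types (Om : set V) (A : R * V -> set V) (h f u phi : R * V -> R).
Local Open Scope ereal_scope.

Definition cylinder Om : set (R * V) := `]0%R, +oo[ `*` Om.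

(* The equation d/dt u + h u + L_s(A(t, x), u) = f in (0, +oo) x Om. *)

Definition parabolic_subsolution (s : R) Om A h f u : Prop :=
  usc_b (cylinder Om) u /\
  forall t x phi, cylinder Om (t, x) -> C2_on (cylinder Om) phi ->
    u (t, x) = phi (t, x) ->
    (forall q, cylinder Om q -> (u q <= phi q)%R) ->
    (derive1 (fun tau : R => phi (tau, x)) t + h (t, x) * phi (t, x))%:E
      + Ls s (A (t, x)) (fun y => phi (t, y)) x <= (f (t, x))%:E.

Definition parabolic_supersolution (s : R) Om A h f u : Prop :=
  lsc_b (cylinder Om) u /\
  forall t x phi, cylinder Om (t, x) -> C2_on (cylinder Om) phi ->
    u (t, x) = phi (t, x) ->
    (forall q, cylinder Om q -> (phi q <= u q)%R) ->
    (f (t, x))%:E <=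
    (derive1 (fun tau : R => phi (tau, x)) t + h (t, x) * phi (t, x))%:E
      + Ls s (A (t, x)) (fun y => phi (t, y)) x.

Definition initial_boundary_solution (s : R) Om A h f (u0 : V -> R) u : Prop :=
  [/\ {within `[0%R, +oo[ `*` closure Om, continuous u},
      parabolic_subsolution s Om A h f u,
      parabolic_supersolution s Om A h f u,
      (forall t x, (0 < t)%R -> frontier Om x -> u (t, x) = 0%R)
    & forall x, Om x -> u (0%R, x) = u0 x].

End parabolic.

Section geometry.
Context {R : realType} {n : nat}.
Local Notation V := 'rV[R]_n.+1.

(* The set written Omega~(x) when A = Omega(x). *)
Definition reflected (x : V) (A : set V) : set V := [set z | A (x - z)].

Definition annulus (r : R) : set V := eball 0 (2 * r) `\` eball 0 r.

End geometry.

(* Main.v *)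
Require Import Defs.
From mathcomp Require Import all_boot all_order all_algebra.
From mathcomp Require Import all_classical all_reals all_analysis.
From mathcomp Require Import measurable_realfun ring lra.

(** The difference [u - v] is compared with [E (K w + C d ^ eta)], where
    [E = exp (- lam t)], [d] is the distance to the boundary, [w] is the positive
    first eigenfunction and [eta] is small. The function [E K w] is a strict
    supersolution of the homogeneous equation, because [lam < lambar]: this pays in
    the interior, for [K] large. Near the boundary [d ^ eta] pays: its image under
    the operator is at least [- (alpha / 2) d ^ (eta - 2 s)], whereas the zero order
    term [h d ^ eta] is at least [alpha d ^ (eta - 2 s)]. All the errors due to the
    convergence of [f], [h] and of the sets are of size [d ^ (eta - 2 s) E], so
    that a large [C] absorbs them. The same barrier gives [|v| <= C' d ^ eta] and
    [w <= C' d ^ eta] ([elliptic_barrier_bound]), which settles the initial time and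
    turns the comparison into the claim. The argument runs for [(u, v)] and for
    [(- u, - v)].

    Since [u], [v] and [w] are viscosity solutions only, the comparison
    ([parabolic_comparison]) doubles the variables: the function
    [u (t, x) - v y - E (K w z + C d x ^ eta) - kap t - k (|x - y|^2 + |x - z|^2)]
    is maximized, and [k] tends to infinity ([penalized_max_cluster]). Two points
    need care.

    A bounded function touched from above by a paraboloid is not a test function. A
    partition of unity glues the paraboloid to locally constant upper bounds of the
    function; the resulting test functions give, in the limit, the inequality with
    the function itself in truncated integrals ([elliptic_sub_jet],
    [parabolic_sub_jet] and their counterparts). The principal values exist because
    [Sigma] is symmetric, so that linear terms cancel, and because the kernel times
    [|z|^2] is integrable.

    At a maximum point the three inequalities live at three points and on three sets
    of integration. Near their centres these sets are all equal to [Sigma] up to a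
    reflection, but only in small balls. The kernel is therefore split into a bounded
    continuous kernel and a nonnegative remainder that lives on such a ball. For the
    remainder, a common shift of the three points leaves the penalty unchanged and
    the maximality applies ([max_point_inequality]). The bounded part passes to the
    limit, by the continuity of the sets in measure ([far_cvg],
    [limit_inequality]), and at the limit point maximality applies to it as well
    ([limit_point_contradiction]). *)

Set Implicit Arguments.
Unset Strict Implicit.
Unset Printing Implicit Defensive.
Import Order.TTheory GRing.Theory Num.Theory.
Import numFieldNormedType.Exports.
Local Open Scope classical_set_scope.
Local Open Scope ring_scope.

(** * Euclidean norm and distance to the boundary *)

Section euclidean_norm.
Context {R : realType} {n : nat}.
Local Notation V := 'rV[R]_n.+1.
Implicit Types (a b v x y z : V).

Definition dotv a b : R := \sum_i a 0 i * b 0 i.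

Lemma dotvC a b : dotv a b = dotv b a.
Proof. by apply: eq_bigr => i _; rewrite mulrC. Qed.

Lemma dotvDl a b v : dotv (a + b) v = dotv a v + dotv b v.
Proof. by rewrite -big_split; apply: eq_bigr => i _; rewrite !mxE mulrDl. Qed.

Lemma dotvDr a b v : dotv v (a + b) = dotv v a + dotv v b.
Proof. by rewrite dotvC dotvDl !(dotvC v). Qed.

Lemma dotvNl a b : dotv (- a) b = - dotv a b.
Proof. by rewrite -sumrN; apply: eq_bigr => i _; rewrite !mxE mulNr. Qed.

Lemma dotvNr a b : dotv a (- b) = - dotv a b.
Proof. by rewrite dotvC dotvNl dotvC. Qed.

Lemma dotvZl (k : R) a b : dotv (k *: a) b = k * dotv a b.
Proof. by rewrite [RHS]big_distrr; apply: eq_bigr => i _; rewrite mxE -mulrA. Qed.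

Lemma dotvv_ge0 v : 0 <= dotv v v.
Proof. by apply: sumr_ge0 => i _; rewrite -expr2 sqr_ge0. Qed.

Lemma enorm_ge0 v : 0 <= enorm v. Proof. exact: sqrtr_ge0. Qed.

Lemma enorm_sqr v : enorm v ^+ 2 = dotv v v.
Proof.
rewrite sqr_sqrtr; last by apply: sumr_ge0 => i _; rewrite sqr_ge0.
by apply: eq_bigr => i _; rewrite expr2.
Qed.

Lemma enorm0 : enorm (0 : V) = 0.
Proof. by rewrite /enorm big1 ?sqrtr0// => i _; rewrite mxE expr0n. Qed.

Lemma enormN v : enorm (- v) = enorm v.
Proof. by congr Num.sqrt; apply: eq_bigr => i _; rewrite mxE sqrrN. Qed.

Lemma enorm_sub x y : enorm (x - y) = enorm (y - x).
Proof. by rewrite -enormN opprB. Qed.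

Lemma normr_coord_le v i : `|v 0 i| <= enorm v.
Proof.
rewrite -sqrtr_sqr ler_sqrt; last by apply: sumr_ge0 => j _; rewrite sqr_ge0.
by rewrite (bigD1 i)//= lerDl; apply: sumr_ge0 => j _; rewrite sqr_ge0.
Qed.

Lemma normr_le_enorm v : `|v| <= enorm v.
Proof.
have -> : `|v| = mx_norm v by [].
rewrite mx_normrE; apply/bigmax_leP; split => [|[i j] _] /=.
  exact: enorm_ge0.
by rewrite (ord1 i) normr_coord_le.
Qed.

Lemma enorm_eq0 v : enorm v = 0 -> v = 0.
Proof.
by move=> v0; apply/normr0_eq0/le_anti; rewrite normr_ge0 -v0 normr_le_enorm.
Qed.

Lemma enorm_gt0 v : v != 0 -> 0 < enorm v.
Proof.
by move=> v0; rewrite lt_neqAle enorm_ge0 andbT eq_sym; apply: contra_neq v0 => /enorm_eq0.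
Qed.

(** Cauchy-Schwarz, from the nonnegativity of the square of the vector
    |b| a - |a| b. *)
Lemma dotv_le a b : dotv a b <= enorm a * enorm b.
Proof.
have [a0|a0] := eqVneq a 0.
  by rewrite a0 enorm0 mul0r /dotv big1// => i _; rewrite mxE mul0r.
have [b0|b0] := eqVneq b 0.
  by rewrite b0 enorm0 mulr0 /dotv big1// => i _; rewrite mxE mulr0.
have := dotvv_ge0 (enorm b *: a - enorm a *: b).
rewrite !(dotvDl, dotvDr, dotvNl, dotvNr, dotvZl) !(dotvC _ (_ *: _)) !dotvZl.
rewrite -!enorm_sqr (dotvC b a).
have := mulr_gt0 (enorm_gt0 a0) (enorm_gt0 b0).
set p := enorm a; set q := enorm b => pq0.
rewrite (_ : _ + _ = (2 * (p * q)) * (p * q - dotv a b)); last by ring.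
by rewrite pmulr_rge0 ?subr_ge0// mulr_gt0.
Qed.

Lemma enorm_sqrD a b : enorm (a + b) ^+ 2 = enorm a ^+ 2 + 2 * dotv a b + enorm b ^+ 2.
Proof. by rewrite !enorm_sqr !dotvDl !dotvDr (dotvC b a); ring. Qed.

Lemma ler_enormD a b : enorm (a + b) <= enorm a + enorm b.
Proof.
rewrite -(@ler_pXn2r _ 2)// ?nnegrE ?addr_ge0 ?enorm_ge0//.
rewrite enorm_sqrD sqrrD lerD2r lerD2l mulr2n.
by have := dotv_le a b; lra.
Qed.

Lemma ler_enorm_dist x y z : enorm (x - z) <= enorm (x - y) + enorm (y - z).
Proof. by have := ler_enormD (x - y) (y - z); rewrite addrA subrK. Qed.

Lemma enorm_le_normr v : enorm v <= n.+1%:R * `|v|.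
Proof.
rewrite -(@ler_pXn2r _ 2)// ?nnegrE ?mulr_ge0 ?enorm_ge0//.
have cv i : `|v 0 i| <= `|v|.
  have -> : `|v| = mx_norm v by [].
  rewrite mx_normrE.
  by apply: (@le_bigmax _ _ _ _ (fun ij => `|v ij.1 ij.2|) (0, i)).
have sv : enorm v ^+ 2 <= n.+1%:R * `|v| ^+ 2.
  rewrite enorm_sqr; apply: (@le_trans _ _ (\sum_(i < n.+1) `|v| ^+ 2)).
    apply: ler_sum => i _; rewrite -expr2 -real_normK ?num_real//.
    by rewrite ler_pXn2r ?nnegrE.
  by rewrite sumr_const card_ord mulr_natl.
apply: (le_trans sv); rewrite exprMn ler_wpM2r ?sqr_ge0// expr2.
by rewrite ler_peMl// ler1n.
Qed.

Lemma enorm_continuous : continuous (@enorm R n).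
Proof.
move=> x; have Fx : Filter (nbhs x) by exact: nbhs_filter.
apply/cvgrPdist_lt => e e0; near=> y.
have xy : `|enorm x - enorm y| <= enorm (x - y).
  rewrite ler_norml; have := ler_enormD (x - y) y; have := ler_enormD (y - x) x.
  by rewrite !subrK enorm_sub => h1 h2; apply/andP; split; lra.
apply: (le_lt_trans xy); apply: (le_lt_trans (enorm_le_normr _)).
rewrite -ltr_pdivlMl//; near: y; apply: cvgr_dist_lt => //.
by rewrite mulr_gt0// invr_gt0.
Unshelve. all: by end_near. Qed.

Lemma enorm_dist_continuous x : continuous (fun y => enorm (y - x)).
Proof.
move=> y; apply: (@continuous_comp _ _ _ (fun y => y - x) (@enorm R n)).
  by have := @continuousB _ _ _ id (cst x) y; apply => //; exact: cst_continuous.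
exact: enorm_continuous.
Qed.

Lemma open_eball x r : open (eball x r).
Proof.
rewrite (_ : eball x r = (fun y => enorm (y - x)) @^-1` [set t | t < r])//.
by apply: open_comp => [y _|]; [exact: enorm_dist_continuous|exact: open_lt].
Qed.

Lemma nbhs_eball x r : 0 < r -> nbhs x (eball x r).
Proof.
by move=> r0; apply: open_nbhs_nbhs; split; [exact: open_eball|rewrite /eball/= subrr enorm0].
Qed.

Lemma nbhs_eballP x (A : set V) : nbhs x A -> exists2 r, 0 < r & eball x r `<=` A.
Proof.
move=> /nbhs_ballP[r /= r0 xA]; exists r => // y xy; apply: xA.
rewrite -ball_normE /=; apply: le_lt_trans (normr_le_enorm _) _.
by rewrite enorm_sub.
Qed.

End euclidean_norm.

Section distance_to_frontier.
Context {R : realType} {n : nat}.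
Local Notation V := 'rV[R]_n.+1.
Variables (Om : set V).
Hypotheses (Om0 : Om !=set0) (oOm : open Om) (bOm : bounded_set Om).
Implicit Types (x y : V).

Lemma compact_closure : compact (closure Om).
Proof.
apply: bounded_closed_compact; last exact: closed_closure.
have [M [Mr MOm]] := bOm; exists M; split => // M' MM' x xOm.
have cM : closed [set y : V | `|y| <= M'].
  apply: (@closed_comp _ _ (fun y : V => `|y|) [set t | t <= M']) => //.
  by move=> ? _; exact: norm_continuous.
rewrite -/([set y : V | `|y| <= M'] x).
have := @closure_subset _ _ [set y : V | `|y| <= M'] (MOm M' MM') _ xOm.
by rewrite -((closure_id _).1 cM).
Qed.

Lemma frontierE : frontier Om = closure Om `\` Om.
Proof. by rewrite /frontier ((interior_id Om).1 oOm). Qed.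

Lemma closure_cases x : closure Om x -> Om x \/ frontier Om x.
Proof. by move=> cx; have [?|?] := pselect (Om x); [left|right; rewrite frontierE]. Qed.

Lemma sub_closure x : Om x -> closure Om x. Proof. exact: subset_closure. Qed.

Lemma compact_frontier : compact (frontier Om).
Proof.
rewrite frontierE setDE; apply: compact_closedI; first exact: compact_closure.
by rewrite closedC.
Qed.

(** Otherwise [Om] is open and closed, and contains a whole line. *)
Lemma frontier_nonempty : frontier Om !=set0.
Proof.
have [x Omx] := Om0; have [//|fr0] := pselect (frontier Om !=set0).
have clE : closure Om = Om.
  rewrite eqEsubset; split => [y /closure_cases[//|yf]|]; last exact: subset_closure.
  by exfalso; apply: fr0; exists y.
pose g (t : R) : V := x + t *: const_mx 1.
have gc : continuous g.
  move=> t; apply: cvgD; first exact: cvg_cst.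
  by apply: cvgZr_tmp; exact: cvg_id.
have og : open (g @^-1` Om) by apply: open_comp => // t _; exact: gc.
have cg : closed (g @^-1` Om).
  by apply: closed_comp => [t _|]; [exact: gc|rewrite -clE; exact: closed_closure].
have gT : g @^-1` Om = setT.
  apply: ((connected_intervalP setT).2 _) => //.
  - by exists 0; rewrite /g/= scale0r addr0.
  - by exists (g @^-1` Om) => //; rewrite setTI.
  - by exists (g @^-1` Om) => //; rewrite setTI.
have [M [Mr MOm]] := bOm.
(* a time at which the line has left the ball that contains [Om] *)
pose t : R := `|M| + 2 + `|x|.
have : Om (g t) by have : [set: R] t by []; rewrite -gT.
move=> /(MOm (`|M| + 1)) /=; rewrite ltr_pwDr// ?ler_norm// => /(_ isT).
have tn : `|t *: (const_mx 1 : V)| = t.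
  rewrite normrZ (_ : `|const_mx 1| = 1 :> R) ?mulr1 ?ger0_norm ?addr_ge0//.
  have -> : `|(const_mx 1 : V)| = mx_norm (const_mx 1 : V) by [].
  rewrite mx_normrE; apply/le_anti/andP; split.
    by apply/bigmax_leP; split => // i _; rewrite mxE normr1.
  apply: (le_trans _ (@le_bigmax _ _ _ _ (fun ij => `|(const_mx 1 : V) ij.1 ij.2|) (0, 0))).
  by rewrite mxE normr1.
move=> le1; have := ler_normD (g t) (- x); rewrite normrN {1}/g addrC addKr tn.
by rewrite leNgt => /negP[]; rewrite (le_lt_trans (lerD le1 (lexx _)))// ltrD2r ltrD2l ltr1n.
Qed.

Lemma bdist_lb x z : frontier Om z -> bdist Om x <= enorm (x - z).
Proof.
move=> fz; apply: ge_inf; last by exists z.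
by exists 0 => _ [y _ <-]; exact: enorm_ge0.
Qed.

Lemma bdist_attained x : exists2 z, frontier Om z & enorm (x - z) = bdist Om x.
Proof.
have [z] := compact_EVT_min frontier_nonempty compact_frontier
  (continuous_subspaceT (@enorm_dist_continuous _ _ x)).
rewrite inE => fz zmin; exists z => //; apply/le_anti/andP; split; last exact: bdist_lb.
apply: lb_le_inf; first by exists (enorm (x - z)), z.
by move=> _ [y fy <-]; rewrite enorm_sub (enorm_sub x y) zmin ?inE.
Qed.

Lemma bdist_ge0 x : 0 <= bdist Om x.
Proof. by have [z _ <-] := bdist_attained x; exact: enorm_ge0. Qed.

Lemma bdist_frontier x : frontier Om x -> bdist Om x = 0.
Proof.
by move=> /(bdist_lb x); rewrite subrr enorm0 => x0; apply/le_anti; rewrite x0 bdist_ge0.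
Qed.

Lemma bdist_gt0 x : Om x -> 0 < bdist Om x.
Proof.
move=> Omx; rewrite lt_neqAle bdist_ge0 andbT; apply/eqP => x0.
have [z] := bdist_attained x; rewrite frontierE => -[_ Nz].
by rewrite -x0 => /enorm_eq0/eqP; rewrite subr_eq0 => /eqP xz; apply: Nz; rewrite -xz.
Qed.

Lemma bdist_lipschitz x y : bdist Om x <= bdist Om y + enorm (x - y).
Proof.
have [z fz <-] := bdist_attained y.
by apply: (le_trans (bdist_lb x fz)); rewrite [leRHS]addrC; exact: ler_enorm_dist.
Qed.

Lemma bdist_continuous : continuous (bdist Om).
Proof.
move=> x; have Fx : Filter (nbhs x) by exact: nbhs_filter.
apply/cvgrPdist_lt => e e0; apply: filterS (nbhs_eball x e0) => y.
rewrite /eball/= => xy; rewrite (le_lt_trans _ xy)// ler_norml.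
have := bdist_lipschitz x y; have := bdist_lipschitz y x; rewrite (enorm_sub x) => h1 h2.
by apply/andP; split; lra.
Qed.

Lemma bdist_bounded : exists2 D : R, 0 < D & forall x, Om x -> bdist Om x <= D.
Proof.
have [x0 Omx0] := Om0.
have cl0 : closure Om !=set0 by exists x0; exact: sub_closure.
have [c _ cmax] := compact_EVT_max cl0 compact_closure
  (continuous_subspaceT bdist_continuous).
exists (bdist Om c) => [|x Omx]; last by apply: cmax; rewrite inE; exact: sub_closure.
by rewrite (lt_le_trans (bdist_gt0 Omx0))// cmax// inE; exact: sub_closure.
Qed.

End distance_to_frontier.

(** * Functions of class C^2 and partitions of unity *)

Section C2_calculus.
Context {R : realType} {E : normedModType R}.
Implicit Types (D : set E) (f g : E -> R).

(** [C2_on] is [C1_on] for the function and for its directional derivatives, so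
    that stability under the operations is proved once, at order one. *)
Definition C1_on D f : Prop := (forall x, D x -> {for x, continuous f}) /\
  (forall v x, D x -> derivable f x v /\ {for x, continuous ('D_v f)}).

Lemma C2_onP D f : C2_on D f <-> C1_on D f /\ forall v, C1_on D ('D_v f).
Proof.
split=> [[f0 [f1 f2]]|[[f0 f1] f2]].
  by split=> [//|v]; split=> [x Dx|w x Dx]; [case: (f1 v x Dx)|exact: f2].
by do 2!split => //; move=> v w x Dx; apply: (f2 v).2.
Qed.

Lemma eq_on_continuous D f g x : open D -> {in D, f =1 g} -> D x ->
  {for x, continuous f} -> {for x, continuous g}.
Proof.
move=> oD fg Dx fx; rewrite /prop_for /continuous_at -fg ?inE//.
apply: cvg_trans fx; apply: near_eq_cvg.
by apply: filterS (open_nbhs_nbhs (conj oD Dx)) => y Dy; rewrite fg ?inE.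
Qed.

Lemma eq_on_derive D f g v : open D -> {in D, f =1 g} -> {in D, 'D_v f =1 'D_v g}.
Proof.
move=> oD fg x; rewrite inE => Dx; apply: near_eq_derive.
by apply: filterS (open_nbhs_nbhs (conj oD Dx)) => y Dy; rewrite fg ?inE.
Qed.

Lemma eq_C1_on D f g : open D -> {in D, f =1 g} -> C1_on D f -> C1_on D g.
Proof.
move=> oD fg [f0 f1]; split=> [x Dx|v x Dx].
  exact: (eq_on_continuous oD fg Dx (f0 x Dx)).
have [dfx cfx] := f1 v x Dx; split.
  apply: near_eq_derivable dfx.
  by apply: filterS (open_nbhs_nbhs (conj oD Dx)) => y Dy; rewrite fg ?inE.
exact: eq_on_continuous (eq_on_derive v oD fg) Dx cfx.
Qed.

Lemma eq_C2_on D f g : open D -> {in D, f =1 g} -> C2_on D f -> C2_on D g.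
Proof.
move=> oD fg /C2_onP[f1 f2]; apply/C2_onP; split; first exact: eq_C1_on f1.
by move=> v; apply: eq_C1_on (f2 v) => //; exact: eq_on_derive.
Qed.

Lemma C1_cst D (k : R) : C1_on D (cst k).
Proof.
split=> [x _|v x _]; first exact: cst_continuous.
split; first exact: derivable_cst.
have -> : 'D_v (cst k) = cst 0 by apply/funext => y; rewrite derive_cst.
exact: cst_continuous.
Qed.

Lemma C2_cst D (k : R) : C2_on D (cst k).
Proof.
apply/C2_onP; split; first exact: C1_cst.
move=> v; have -> : 'D_v (cst k) = cst 0 by apply/funext => y; rewrite derive_cst.
exact: C1_cst.
Qed.

Lemma is_derive_add f g x v : derivable f x v -> derivable g x v ->
  is_derive x v (fun y => f y + g y) ('D_v f x + 'D_v g x).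
Proof.
by move=> fx gx; apply: (DeriveDef (derivableD fx gx)); exact: deriveD.
Qed.

Lemma is_derive_mul f g x v : derivable f x v -> derivable g x v ->
  is_derive x v (fun y => f y * g y) (f x * 'D_v g x + g x * 'D_v f x).
Proof.
by move=> fx gx; apply: (DeriveDef (derivableM fx gx)); exact: deriveM.
Qed.

Lemma C1_add D f g : open D -> C1_on D f -> C1_on D g -> C1_on D (fun y => f y + g y).
Proof.
move=> oD [f0 f1] [g0 g1]; split=> [x Dx|v x Dx].
  exact: (cvgD (f0 x Dx) (g0 x Dx)).
have D1 y (Dy : D y) := is_derive_add (f1 v y Dy).1 (g1 v y Dy).1.
split; first by case: (D1 x Dx).
apply: (@eq_on_continuous D (fun y => 'D_v f y + 'D_v g y)) => //; last first.
  exact: (cvgD (f1 v x Dx).2 (g1 v x Dx).2).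
by move=> y; rewrite inE => Dy; case: (D1 y Dy).
Qed.

Lemma C2_add D f g : open D -> C2_on D f -> C2_on D g -> C2_on D (fun y => f y + g y).
Proof.
move=> oD /C2_onP[f1 f2] /C2_onP[g1 g2]; apply/C2_onP; split; first exact (C1_add oD f1 g1).
move=> v; apply: (@eq_C1_on D (fun y => 'D_v f y + 'D_v g y) _ oD _ (C1_add oD (f2 v) (g2 v))).
by move=> y; rewrite inE => Dy; case: (is_derive_add (f1.2 v y Dy).1 (g1.2 v y Dy).1).
Qed.

Lemma C1_mul D f g : open D -> C1_on D f -> C1_on D g -> C1_on D (fun y => f y * g y).
Proof.
move=> oD [f0 f1] [g0 g1]; split=> [x Dx|v x Dx].
  exact: (cvgM (f0 x Dx) (g0 x Dx)).
have D1 y (Dy : D y) := is_derive_mul (f1 v y Dy).1 (g1 v y Dy).1.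
split; first by case: (D1 x Dx).
apply: (@eq_on_continuous D (fun y => f y * 'D_v g y + g y * 'D_v f y)) => //; last first.
  exact: (cvgD (cvgM (f0 x Dx) (g1 v x Dx).2) (cvgM (g0 x Dx) (f1 v x Dx).2)).
by move=> y; rewrite inE => Dy; case: (D1 y Dy).
Qed.

Lemma C2_mul D f g : open D -> C2_on D f -> C2_on D g -> C2_on D (fun y => f y * g y).
Proof.
move=> oD /C2_onP[f1 f2] /C2_onP[g1 g2]; apply/C2_onP; split; first exact (C1_mul oD f1 g1).
move=> v; have cv := C1_add oD (C1_mul oD f1 (g2 v)) (C1_mul oD g1 (f2 v)).
apply: (eq_C1_on oD _ cv).
by move=> y; rewrite inE => Dy; case: (is_derive_mul (f1.2 v y Dy).1 (g1.2 v y Dy).1).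
Qed.

Lemma C2_sum D (I : Type) (r : seq I) (F : I -> E -> R) : open D ->
  (forall i, C2_on D (F i)) -> C2_on D (fun x => \sum_(i <- r) F i x).
Proof.
move=> oD F2; elim: r => [|i r IH].
  by under eq_fun do rewrite big_nil; exact: C2_cst.
by under eq_fun do rewrite big_cons; exact (C2_add oD (F2 i) IH).
Qed.

Lemma is_derive_comp1 (F : R -> R) f x v (a : R) : derivable f x v ->
  is_derive (f x) 1 F a -> is_derive x v (F \o f) (a * 'D_v f x).
Proof.
move=> dfx dF; pose k (h : R) := f (h *: v + x).
have k0 : k 0 = f x by rewrite /k scale0r add0r.
have dk : derivable k 0 1 by exact: (derivable1P f x v).1 dfx.
have kE G : (fun h : R => h^-1 *: (((G \o k) \o shift 0) (h *: 1) - (G \o k) 0)) =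
    (fun h => h^-1 *: (((G \o f) \o shift x) (h *: v) - (G \o f) x)).
  by apply/funext => h /=; rewrite addr0 k0 /k [_%:A]mulr1.
have kv : 'D_1 k 0 = 'D_v f x.
  exact: (congr1 (fun g : R -> R^o => lim (g @ 0^')) (kE R^o id)).
have kd : is_derive (0 : R) 1 k ('D_v f x) := DeriveDef dk kv.
have Fd : is_derive (k 0) 1 F a by rewrite k0.
have [dFk vFk] := is_derive1_comp Fd kd.
have dF' : derivable (F \o f) x v by exact: (derivable1P (F \o f) x v).2 dFk.
apply: (DeriveDef dF'); rewrite -vFk.
exact: (esym (congr1 (fun g : R -> R^o => lim (g @ 0^')) (kE R^o F))).
Qed.

Lemma C1_comp D (S : set R) (F F1 : R -> R) f : open D -> (forall x, D x -> S (f x)) ->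
  (forall y, S y -> is_derive y 1 F (F1 y)) -> (forall y, S y -> {for y, continuous F1}) ->
  C1_on D f -> C1_on D (F \o f).
Proof.
move=> oD fS FF1 F1c [f0 f1]; split=> [x Dx|v x Dx].
  apply: continuous_comp; first exact: f0.
  by apply/differentiable_continuous/derivable1_diffP; case: (FF1 _ (fS x Dx)).
have [dfx cfx] := f1 v x Dx; split.
  by case: (is_derive_comp1 dfx (FF1 _ (fS x Dx))).
apply: (@eq_on_continuous D (fun y => F1 (f y) * 'D_v f y)) => //; last first.
  apply: (cvgM _ cfx).
  exact: (continuous_comp (f0 x Dx) (F1c _ (fS x Dx))).
move=> y; rewrite inE => Dy.
by case: (is_derive_comp1 (f1 v y Dy).1 (FF1 _ (fS y Dy))).
Qed.

Lemma C2_comp D (S : set R) (F F1 F2 : R -> R) f : open D ->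
  (forall x, D x -> S (f x)) -> (forall y, S y -> is_derive y 1 F (F1 y)) ->
  (forall y, S y -> is_derive y 1 F1 (F2 y)) -> (forall y, S y -> {for y, continuous F2}) ->
  C2_on D f -> C2_on D (F \o f).
Proof.
move=> oD fS FF1 FF2 F2c /C2_onP[f1 f2].
have F1c y : S y -> {for y, continuous F1}.
  by move=> Sy; apply/differentiable_continuous/derivable1_diffP; case: (FF2 _ Sy).
apply/C2_onP; split; first exact: (C1_comp oD fS FF1).
move=> v; have cv := C1_mul oD (C1_comp oD fS FF2 F2c f1) (f2 v).
apply: (eq_C1_on oD _ cv).
move=> y; rewrite inE => Dy.
by case: (is_derive_comp1 (f1.2 v y Dy).1 (FF1 _ (fS y Dy))).
Qed.

Lemma C2_linear D (p : E -> R) : continuous p ->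
  (forall (h : R) v x, p (h *: v + x) = h * p v + p x) -> C2_on D p.
Proof.
move=> cp lp; have dp x v : is_derive x v p (p v).
  have cv : (fun h : R => h^-1 *: ((p \o shift x) (h *: v) - p x)) @ 0^' --> p v.
    apply: cvg_near_cst; near=> h => /=.
    by rewrite lp addrK /GRing.scale/= mulrA mulVf ?mul1r//; near: h; exact: nbhs_dnbhs_neq.
  by apply: DeriveDef; [apply/cvg_ex; exists (p v)|exact: cvg_lim].
have Dp v : 'D_v p = cst (p v) by apply/funext => x; case: (dp x v).
apply/C2_onP; split; last by move=> v; rewrite Dp; exact: C1_cst.
split=> [x _|v x _]; first exact: cp.
by split; [case: (dp x v)|rewrite Dp; exact: cst_continuous].
Unshelve. all: by end_near. Qed.

End C2_calculus.

Section C2_examples.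
Context {R : realType}.

Lemma C2_opp (E : normedModType R) (D : set E) (f : E -> R) : open D -> C2_on D f -> C2_on D (- f).
Proof.
move=> oD f2; have := C2_mul oD (C2_cst D (-1)) f2.
by apply: eq_C2_on => // x _; rewrite /= mulN1r.
Qed.

Lemma C2_inv (E : normedModType R) (D : set E) (f : E -> R) : open D -> (forall x, D x -> 0 < f x) ->
  C2_on D f -> C2_on D (fun x => (f x)^-1).
Proof.
move=> oD f0 f2.
pose F1 (y : R) := - (y^-1 * y^-1); pose F2 (y : R) := 2 * (y^-1 * (y^-1 * y^-1)).
have dinv (y : R) : 0 < y -> is_derive y 1 (fun z : R => z^-1) (F1 y).
  move=> y0; have yn0 : y != 0 by rewrite gt_eqF.
  apply: (DeriveDef (derivableV (f := id) yn0 (@derivable_id _ _ y 1))).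
  rewrite (deriveV (f := id) yn0 (@derivable_id _ _ y 1)) derive_id /F1 /GRing.scale/= mulr1.
  by rewrite -invfM expr2.
apply: (@C2_comp _ _ D [set y | 0 < y] (fun y => y^-1) F1 F2) => // y /= y0.
- have [dy vy] := dinv y y0.
  have [d2 v2] := is_derive_mul dy dy.
  have [d3 v3] := is_derive_mul (derivable_cst (-1 : R) y 1) d2.
  have F1E : F1 = (fun z => cst (-1) z * (z^-1 * z^-1)) by apply/funext => z; rewrite /F1 mulN1r.
  rewrite F1E; apply: (DeriveDef d3); rewrite v3 v2 vy derive_cst /F1 /F2 /=; ring.
- have cV : {for y, continuous (fun z : R => z^-1)} by apply: inv_continuous; rewrite gt_eqF.
  by apply: cvgM; [exact: cvg_cst|apply: cvgM => //; exact: cvgM].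
Qed.

(** The cube is the first power for which this is of class C^2. *)
Definition cubepos (y : R) : R := Num.max 0 y ^+ 3.

Lemma cubepos_ge0 y : 0 <= cubepos y.
Proof. by rewrite exprn_ge0// le_max lexx. Qed.

Lemma cubepos_gt0 y : 0 < y -> 0 < cubepos y.
Proof. by move=> y0; rewrite exprn_gt0// lt_max y0 orbT. Qed.

Lemma cubepos_eq0 y : y <= 0 -> cubepos y = 0.
Proof. by move=> y0; rewrite /cubepos (max_idPl y0) expr0n. Qed.

(** For functions given by cases: a quadratic error bound gives the derivative on
    both sides of the junction at once. *)
Lemma is_derive_quad (F : R -> R) y a C :
  (forall h, `|h| <= 1 -> `|F (h + y) - F y - a * h| <= C * h ^+ 2) ->
  is_derive y 1 F a.
Proof.
move=> FC; have cv : (fun h : R => h^-1 *: ((F \o shift y) (h *: 1) - F y)) @ 0^' --> a.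
  apply/cvgrPdist_lt => e e0; near=> h.
  have h0 : h != 0 by near: h; exact: nbhs_dnbhs_neq.
  have h1 : `|h| <= 1 by near: h; apply: dnbhs0_le.
  have hC : (`|C| + 1) * `|h| < e.
    rewrite -ltr_pdivlMl ?ltr_pwDr//; near: h; apply: dnbhs0_lt.
    by rewrite mulr_gt0// invr_gt0 ltr_pwDr.
  apply: le_lt_trans hC; rewrite /= [_%:A]mulr1 /GRing.scale/=.
  rewrite (_ : a - _ = - (h^-1 * (F (h + y) - F y - a * h))); last by field.
  rewrite normrN normrM normfV ler_pdivrMl ?normr_gt0//.
  apply: (le_trans (FC h h1)); rewrite -(real_normK (num_real h)).
  rewrite [leRHS]mulrCA -expr2 ler_wpM2r ?sqr_ge0//.
  by rewrite (le_trans (ler_norm C))// lerDl.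
by apply: DeriveDef; [apply/cvg_ex; exists a|exact: cvg_lim].
Unshelve. all: by end_near. Qed.

Lemma is_derive_sqpos (y : R) :
  is_derive y 1 (fun z => Num.max 0 z ^+ 2) (2 * Num.max 0 y).
Proof.
apply: (@is_derive_quad _ _ _ 1) => h _; rewrite ler_norml !expr2.
by case: (leP 0 y) => y0; case: (leP 0 (h + y)) => hy; nra.
Qed.

Lemma is_derive_cubepos (y : R) : is_derive y 1 cubepos (3 * Num.max 0 y ^+ 2).
Proof.
apply: (@is_derive_quad _ _ _ (4 * `|y| + 1)) => h.
rewrite ler_norml => /andP[h1 h2]; rewrite /cubepos ler_norml !exprS !expr0 !mulr1.
have yy := ler_norm y; have Hy : (4 * y) * (h * h) <= (4 * `|y|) * (h * h) by rewrite ler_wpM2r//; nra.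
have HN : (4 * - y) * (h * h) <= (4 * `|y|) * (h * h).
  by rewrite ler_wpM2r//; [nra|have := ler_norm (- y); rewrite normrN; lra].
case: (leP 0 y) => y0; case: (leP 0 (h + y)) => hy.
- have H1 : 0 <= y * (h * h) by nra.
  have H2 : - (h * h) <= h * (h * h) <= h * h by apply/andP; nra.
  by move: H2 => /andP[H2 H3]; apply/andP; split; lra.
- have H1 : 0 <= y * y by nra.
  have H2 : y * (y * y) <= y * (h * h) by rewrite ler_wpM2l//; nra.
  have H3 : 0 <= y * y * - h by nra.
  have H4 : y * y * - h <= y * (h * h) by rewrite -mulrA ler_wpM2l//; nra.
  by apply/andP; split; nra.
- have H1 : 0 <= (h + y) * ((h + y) * (h + y)) by rewrite !mulr_ge0.
  have H2 : (h + y) * ((h + y) * (h + y)) <= h * (h * h).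
    by rewrite ler_pM ?mulr_ge0//; [lra|rewrite ler_pM//; lra].
  have H3 : h * (h * h) <= h * h by nra.
  by apply/andP; split; nra.
- by apply/andP; split; nra.
Qed.

Lemma C2_cubepos (E : normedModType R) (D : set E) (f : E -> R) : open D ->
  C2_on D f -> C2_on D (fun x => cubepos (f x)).
Proof.
move=> oD f2; apply: (@C2_comp _ _ D setT cubepos (fun y => 3 * Num.max 0 y ^+ 2)
  (fun y => 3 * (2 * Num.max 0 y)) f oD) => //.
- by move=> y _; exact: is_derive_cubepos.
- move=> y _; have d3 := is_deriveZ 3 (is_derive_sqpos y).
  exact: (is_derive_eq d3).
- move=> y _; apply: cvgM; first exact: cvg_cst.
  apply: cvgM; first exact: cvg_cst.
  have -> : Num.max 0 = (fun z : R => 2^-1 * (z + `|z|)).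
    by apply/funext => z; case: (leP 0 z) => z0; [rewrite ger0_norm//|rewrite ltr0_norm//]; lra.
  apply: cvgM; first exact: cvg_cst.
  by apply: cvgD; [exact: cvg_id|exact: norm_continuous].
Qed.

End C2_examples.

Section C2_row.
Context {R : realType} {n : nat}.
Local Notation V := 'rV[R]_n.+1.

Lemma C2_coord (D : set V) i : C2_on D (fun y => y 0 i).
Proof.
apply: C2_linear; first exact: coord_continuous.
by move=> h v x; rewrite !mxE.
Qed.

Lemma C2_dotv (D : set V) (a : V) : open D -> C2_on D (dotv a).
Proof.
move=> oD; apply: (C2_sum _ oD) => i.
exact: (C2_mul oD (C2_cst D (a 0 i)) (C2_coord D i)).
Qed.

Lemma C2_dist2 (D : set V) (p : V) : open D -> C2_on D (fun y => enorm (y - p) ^+ 2).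
Proof.
move=> oD; under eq_fun do rewrite enorm_sqr.
apply: (C2_sum _ oD) => i.
have c1 : C2_on D (fun y => (y - p) 0 i).
  under eq_fun do rewrite !mxE.
  exact: (C2_add oD (C2_coord D i) (C2_cst D (- p 0 i))).
exact: (C2_mul oD c1 c1).
Qed.

(** Positive bumps, one around [xb] and finitely many small ones centred in the
    compact set [closure Om] minus the ball of radius [delta], divided by their sum.
    A small bump reaches at most [r <= delta / 2] from its centre, hence does not
    meet the ball of radius [delta / 2], where the central weight is therefore 1. *)
Lemma smooth_partition (Om : set V) (xb : V) (delta r : R) :
  open Om -> compact (closure Om) -> 0 < delta -> 0 < r -> r <= delta / 2 ->
  exists (s : seq V) (W0 : V -> R) (W : V -> V -> R),
    [/\ C2_on Om W0, forall p, C2_on Om (W p), {in s, forall p, closure Om p} &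
     forall y, Om y -> [/\ 0 <= W0 y, forall p, 0 <= W p y,
        W0 y + \sum_(p <- s) W p y = 1, W0 y != 0 -> enorm (y - xb) < delta &
        (forall p, W p y != 0 -> enorm (y - p) < r) /\
        (enorm (y - xb) < delta / 2 -> {in s, forall p, W p y = 0})]].
Proof.
move=> oOm cOm d0 r0 rd.
have cK : compact (closure Om `\` eball xb delta).
  rewrite setDE; apply: compact_closedI => //.
  by rewrite closedC; exact: open_eball.
have := cK; rewrite compact_cover => /(_ V (closure Om `\` eball xb delta)
  (fun p => eball p r)) [].
- by move=> p _; exact: open_eball.
- by move=> p pK; exists p => //; rewrite /eball/= subrr enorm0.
move=> s0 s0K s0cov; pose s : seq V := finmap.enum_fset s0.
have sK p : p \in s -> closure Om p /\ delta <= enorm (p - xb).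
  by move=> ps; have /set_mem[? /negP] := s0K p ps; rewrite -leNgt.
pose Q0 (y : V) := cubepos (delta ^+ 2 - enorm (y - xb) ^+ 2).
pose Q (p y : V) := cubepos (r ^+ 2 - enorm (y - p) ^+ 2).
pose S (y : V) := Q0 y + \sum_(p <- s) Q p y.
have Q20 (a : R) (y p : V) : 0 < a -> cubepos (a ^+ 2 - enorm (y - p) ^+ 2) != 0 -> enorm (y - p) < a.
  move=> a0; apply: contraR; rewrite -leNgt => ay; apply/eqP/cubepos_eq0.
  by rewrite subr_le0 ler_pXn2r ?nnegrE ?enorm_ge0// ltW.
have Q2p (a : R) (y p : V) : 0 < a -> enorm (y - p) < a -> 0 < cubepos (a ^+ 2 - enorm (y - p) ^+ 2).
  by move=> a0 ay; rewrite cubepos_gt0// subr_gt0 ltr_pXn2r ?nnegrE ?enorm_ge0// ltW.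
have S0 y : Om y -> 0 < S y.
  move=> Omy; have sge : 0 <= \sum_(p <- s) Q p y by apply: sumr_ge0 => p _; exact: cubepos_ge0.
  have [yd|dy] := ltP (enorm (y - xb)) delta.
    by rewrite ltr_pwDl// Q2p.
  have [p ps yp] : exists2 p, p \in s & enorm (y - p) < r.
    have [|p ps yp] := s0cov y; last by exists p.
    by split; [exact: subset_closure|rewrite /eball/= ltNge dy].
  rewrite ltr_wpDl ?cubepos_ge0// (bigD1_seq p)//=; last exact: finmap.fset_uniq.
  by rewrite ltr_pwDl ?Q2p// sumr_ge0// => q _; exact: cubepos_ge0.
have Q0C : C2_on Om Q0.
  apply: (C2_cubepos oOm); apply: (C2_add oOm (C2_cst Om (delta ^+ 2))).
  exact: (C2_opp oOm (C2_dist2 xb oOm)).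
have QC p : C2_on Om (Q p).
  apply: (C2_cubepos oOm); apply: (C2_add oOm (C2_cst Om (r ^+ 2))).
  exact: (C2_opp oOm (C2_dist2 p oOm)).
have SV : C2_on Om (fun y => (S y)^-1).
  exact: (C2_inv oOm S0 (C2_add oOm Q0C (C2_sum s oOm QC))).
exists s, (fun y => Q0 y * (S y)^-1), (fun p y => Q p y * (S y)^-1); split.
- exact: (C2_mul oOm Q0C SV).
- by move=> p; exact: (C2_mul oOm (QC p) SV).
- by move=> p /sK[].
- move=> y Omy; have Sy := S0 y Omy; have Sy0 := gt_eqF Sy; split.
  + by rewrite divr_ge0 ?cubepos_ge0 ?ltW.
  + by move=> p; rewrite divr_ge0 ?cubepos_ge0 ?ltW.
  + by rewrite -mulr_suml -mulrDl divff// Sy0.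
  + by rewrite mulf_eq0 invr_eq0 Sy0 orbF; exact: Q20.
  + split=> [p|yd p ps]; first by rewrite mulf_eq0 invr_eq0 Sy0 orbF; exact: Q20.
    apply/eqP; rewrite mulf_eq0 invr_eq0 Sy0 orbF; apply/negPn/negP => /(Q20 _ _ _ r0) yp.
    have [_] := sK p ps; rewrite leNgt => /negP; apply.
    rewrite (le_lt_trans (ler_enorm_dist p y xb))// (enorm_sub p); lra.
Qed.

Lemma C2_snd (D : set V) (f : V -> R) : C2_on D f -> C2_on (cylinder D) (fun q => f q.2).
Proof.
have Ds (g : V -> R) (v : R * V) : 'D_v (fun q : R * V => g q.2) = (fun q => 'D_(v.2) g q.2) by [].
have sc (g : V -> R) (q : R * V) : {for q.2, continuous g} -> {for q, continuous (fun q : R * V => g q.2)}.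
  case: q => a b cg; exact: (cvg_comp _ _ (@cvg_snd _ _ (nbhs a) (nbhs b) _) cg).
move=> [f0 [f1 f2]]; split=> [q [_ Dq]|]; first by apply: sc; exact: f0.
split=> [v q [_ Dq]|v w q [_ Dq]].
  by split; [exact: (f1 v.2 q.2 Dq).1|rewrite Ds; apply: (sc ('D_(v.2) f) q); exact: (f1 v.2 q.2 Dq).2].
rewrite !Ds; split; first exact: (f2 v.2 w.2 q.2 Dq).1.
by apply: (sc ('D_(w.2) ('D_(v.2) f))); exact: (f2 v.2 w.2 q.2 Dq).2.
Qed.

Lemma C2_fst (D : set (R * V)) : C2_on D fst.
Proof. by apply: C2_linear => // -[a b]; exact: (@cvg_fst _ _ (nbhs a) (nbhs b)). Qed.

Lemma C2_exp (E : normedModType R) (D : set E) (f : E -> R) : open D ->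
  C2_on D f -> C2_on D (fun x => expR (f x)).
Proof.
move=> oD f2; apply: (@C2_comp _ _ D setT (@expR R) (@expR R) (@expR R) f oD) => //.
by move=> y _; exact: continuous_expR.
Qed.

End C2_row.

(** * Lebesgue measure: open sets, reflections, kernels *)

Section lebesgue_measure_rV.
Context {R : realType} {n : nat}.
Local Notation V := 'rV[R]_n.+1.
Local Notation mu := (@lebesgue R n).
Local Notation mV := (caratheodory_type (@lebesgue_outer R n)).
Implicit Types (A B X : set V) (I : V * V) (x : V).
Local Open Scope ereal_scope.

Lemma lebesgue_outer_box A I : A `<=` box I -> lebesgue_outer A <= box_volume I.
Proof.
move=> AI; pose J k : V * V := if k is 0 then I else (0%R, 0%R).
have J0 k : 0 <= box_volume (J k) by exact: box_volume_ge0.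
apply: (@le_trans _ _ (\sum_(k <oo) box_volume (J k))).
  by apply: ereal_inf_lbound; exists J => //= y /AI Iy; exists 0%N.
rewrite nneseries_recl//= eseries0 ?adde0// => -[//|k] _ _ /=.
by rewrite /box_volume big_ord_recl/= mxE subrr maxxx mul0r.
Qed.

Definition set_coord x (i : 'I_n.+1) (c : R) : V :=
  (\row_j if j == i then c else x ord0 j)%R.

Lemma box_volume_split I i (c : R) :
  box_volume (I.1, set_coord I.2 i (Num.min (I.2 ord0 i) c)) +
  box_volume (set_coord I.1 i (Num.max (I.1 ord0 i) c), I.2) = box_volume I.
Proof.
rewrite /box_volume -EFinD; congr EFin.
rewrite !(bigD1 (P := xpredT) i)//= !mxE eqxx.
rewrite [X in (_ * X + _)%R](eq_bigr (fun j => Num.max (I.2 ord0 j - I.1 ord0 j) 0)%R); last first.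
  by move=> j /negbTE ji; rewrite mxE ji.
rewrite [X in (_ + _ * X)%R](eq_bigr (fun j => Num.max (I.2 ord0 j - I.1 ord0 j) 0)%R); last first.
  by move=> j /negbTE ji; rewrite mxE ji.
rewrite -mulrDl; congr (_ * _)%R.
set a := I.1 ord0 i; set b := I.2 ord0 i.
case: (leP b c) => bc; case: (leP a c) => ac.
- rewrite [X in (_ + X)%R](_ : _ = 0%R) ?addr0//.
  by apply/max_idPr; lra.
- rewrite [X in (_ + X)%R](_ : _ = 0%R) ?addr0//.
  by apply/max_idPr; lra.
- have -> : (Num.max (c - a) 0 = c - a)%R by apply/max_idPl; lra.
  have -> : (Num.max (b - c) 0 = b - c)%R by apply/max_idPl; lra.
  have -> : (Num.max (b - a) 0 = b - a)%R by apply/max_idPl; lra.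
  lra.
- rewrite [X in (X + _)%R](_ : _ = 0%R) ?add0r//.
  by apply/max_idPr; lra.
Qed.

(** Cutting each box of a cover along the hyperplane preserves the total volume. *)
Lemma measurable_halfspace i (c : R) : lebesgue_measurable [set y : V | (y ord0 i <= c)%R].
Proof.
apply: le_caratheodory_measurable => X /=; rewrite [leRHS]/lebesgue_outer.
apply: le_ereal_inf_tmp => _ [I XI <-].
pose I1 k := ((I k).1, set_coord (I k).2 i (Num.min ((I k).2 ord0 i) c)).
pose I2 k := (set_coord (I k).1 i (Num.max ((I k).1 ord0 i) c), (I k).2).
have -> : \sum_(k <oo) box_volume (I k) =
    \sum_(k <oo) box_volume (I1 k) + \sum_(k <oo) box_volume (I2 k).
  rewrite -nneseriesD; [|by move=> *; exact: box_volume_ge0..].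
  by apply: eq_eseriesr => k _; rewrite /I1 /I2 box_volume_split.
apply: leeD; apply: ereal_inf_lbound.
- exists I1 => // y [/XI[k _ Iky] yc]; exists k => // j /=.
  rewrite mxE; case: eqP => [->|_]; last exact: Iky.
  by have /andP[-> yb] := Iky i; rewrite le_min yb.
- exists I2 => // y [/XI[k _ Iky] /negP]; rewrite -ltNge => yc; exists k => // j /=.
  rewrite mxE; case: eqP => [->|_]; last exact: Iky.
  by have /andP[ya ->] := Iky i; rewrite gt_max ya yc.
Qed.

Lemma measurable_box I : lebesgue_measurable (box I).
Proof.
have -> : box I = \bigcap_(i in [set: 'I_n.+1])
    ([set y : V | (y ord0 i <= I.2 ord0 i)%R] `\` [set y : V | (y ord0 i <= I.1 ord0 i)%R]).
  rewrite eqEsubset; split=> y.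
    move=> Iy i _ /=; have /andP[ya yb] := Iy i.
    by split => //; apply/negP; rewrite -ltNge.
  by move=> h i; have [/= yb /negP] := h i Logic.I; rewrite -ltNge => ya; apply/andP.
apply: (@fin_bigcap_measurable _ (caratheodory_type lebesgue_outer)) => // i _.
by apply: measurableD; exact: measurable_halfspace.
Qed.

(** An open set is a countable union of boxes with rational corners. *)
Lemma open_lebesgue_measurable A : open A -> lebesgue_measurable A.
Proof.
move=> oA; pose Q := ('rV[rat]_n.+1 * 'rV[rat]_n.+1)%type.
pose toR (q : 'rV[rat]_n.+1) : V := (\row_i ratr (q ord0 i))%R.
pose F (q : Q) : set V := if `[< box (toR q.1, toR q.2) `<=` A >]
  then box (toR q.1, toR q.2) else set0.
have -> : A = \bigcup_q F q.
  rewrite eqEsubset; split=> [y Ay|y [q _]]; last first.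
    by rewrite /F; case: asboolP => // qA /qA.
  have : nbhs y A by apply: open_nbhs_nbhs.
  move=> /nbhs_ballP[e /= e0 yA].
  have lo i : {q : rat | (y ord0 i - e < ratr q < y ord0 i)%R}.
    have lt : (y ord0 i - e < y ord0 i)%R by rewrite ltrBlDr ltrDl.
    apply: cid; have [q] := rat_in_itvoo lt.
    by rewrite in_itv/= => h; exists q.
  have hi i : {q : rat | (y ord0 i < ratr q < y ord0 i + e)%R}.
    have lt : (y ord0 i < y ord0 i + e)%R by rewrite ltrDl.
    apply: cid; have [q] := rat_in_itvoo lt.
    by rewrite in_itv/= => h; exists q.
  pose q : Q := (\row_i sval (lo i), \row_i sval (hi i))%R.
  have qA : box (toR q.1, toR q.2) `<=` A.
    move=> z zq; apply: yA; split=> // j i; rewrite (ord1 j).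
    have := zq i; rewrite /= !mxE => /andP[z1 z2].
    have /andP[l1 l2] := svalP (lo i); have /andP[h1 h2] := svalP (hi i).
    by rewrite /ball/= ltr_distlC; apply/andP; split; lra.
  exists q => //; rewrite /F; case: asboolP => // _ i /=; rewrite !mxE.
  have /andP[l1 l2] := svalP (lo i); have /andP[h1 h2] := svalP (hi i).
  by rewrite l2 ltW.
apply: (@countable_bigcupT_measurable _ (caratheodory_type lebesgue_outer)).
  exact: countableP.
move=> q; rewrite /F; case: asboolP => _; first exact: measurable_box.
exact: measurable0.
Qed.

Lemma continuous_lebesgue_measurable (f : V -> R) : continuous f ->
  measurable_fun (setT : set mV) (f : mV -> R).
Proof.
move=> cf; apply: (measurability _ (RGenOpens.measurableE R)).
move=> _ [_ [a [b ->] <-]]; rewrite setTI; apply: open_lebesgue_measurable.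
by apply: open_comp => [y _|]; [exact: cf|exact: interval_open].
Qed.

Lemma box_volume_enlarge I (e : R) : (0 < e)%R -> exists2 d : R, (0 < d)%R &
  (\prod_i Num.max (I.2 ord0 i - I.1 ord0 i + d) 0)%:E <= box_volume I + e%:E.
Proof.
move=> e0; pose g (s : seq 'I_n.+1) (d : R) : R :=
  (\prod_(i <- s) Num.max (I.2 ord0 i - I.1 ord0 i + d) 0)%R.
have gc s : continuous (g s).
  elim: s => [|i s IH] d.
    rewrite /g.
    by under eq_fun do rewrite big_nil; exact: cvg_cst.
  have -> : g (i :: s) = (fun d => Num.max (I.2 ord0 i - I.1 ord0 i + d) 0 * g s d)%R.
    by apply/funext => c; rewrite /g big_cons.
  apply: cvgM; last exact: IH.
  apply: continuous_max; last exact: cvg_cst.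
  by apply: cvgD; [exact: cvg_cst|exact: cvg_id].
have g0 := gc (index_enum 'I_n.+1) 0%R.
move/cvgrPdist_lt: g0 => /(_ _ e0) /nbhs_ballP[d /= d0 hd].
exists (d / 2)%R; first by rewrite divr_gt0.
have /hd : ball (0 : R)%R d (d / 2)%R.
  by rewrite /ball/= sub0r normrN ger0_norm ?divr_ge0 ?ltW//; lra.
rewrite ltr_distlC => /andP[_ h].
rewrite /box_volume -EFinD lee_fin; apply: le_trans (ltW h) _.
by rewrite lerD2r /g; apply: ler_prod => i _; rewrite le_max lexx orbT/= addr0.
Qed.

(** The image of a half-open box is open at the other end, so it is covered by a
    slightly larger box, for an arbitrarily small total increase of the volume. *)
Lemma le_lebesgue_outer_reflect x A :
  lebesgue_outer [set z | A (x - z)%R] <= lebesgue_outer A.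
Proof.
rewrite [leRHS]/lebesgue_outer; apply: le_ereal_inf_tmp => _ [I AI <-].
apply/lee_addgt0Pr => e e0.
have e20 k : (0 < e / (2 ^ k.+1)%:R)%R by rewrite divr_gt0.
have [d hd] := @choice _ _ (fun k d => (0 < d)%R /\
    (\prod_i Num.max ((I k).2 ord0 i - (I k).1 ord0 i + d) 0)%:E
      <= box_volume (I k) + (e / (2 ^ k.+1)%:R)%:E)
  (fun k => let: ex_intro2 d d0 H := box_volume_enlarge (I k) (e20 k) in
     ex_intro _ d (conj d0 H)).
pose J k : V * V := (x - (I k).2 - const_mx (d k), x - (I k).1)%R.
apply: le_trans (epsilon_trick _ _ (ltW e0)); last by move=> k; exact: box_volume_ge0.
apply: (@le_trans _ _ (\sum_(k <oo) box_volume (J k))).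
  apply: ereal_inf_lbound; exists J => // z /AI[k _ Iz]; exists k => // i.
  have := Iz i; rewrite !mxE => /andP[z1 z2]; have [d0 _] := hd k.
  by apply/andP; split; lra.
apply: lee_nneseries => [k _ _|k _]; first exact: box_volume_ge0.
apply: le_trans (hd k).2; rewrite /box_volume lee_fin le_eqVlt; apply/orP; left.
apply/eqP; apply: eq_bigr => i _; congr Num.max; rewrite !mxE; ring.
Qed.

Lemma lebesgue_outer_reflect x A : lebesgue_outer [set z | A (x - z)%R] = lebesgue_outer A.
Proof.
apply/le_anti/andP; split; first exact: le_lebesgue_outer_reflect.
have := le_lebesgue_outer_reflect x [set z | A (x - z)%R].
by congr (_ <= _); congr lebesgue_outer; apply/funext => z/=; rewrite subKr.
Qed.

Lemma lebesgue_measurable_reflect x A : lebesgue_measurable A ->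
  lebesgue_measurable [set z | A (x - z)%R].
Proof.
move=> mA; suff : lebesgue_outer.-caratheodory [set z | A (x - z)%R] by [].
have {}mA : lebesgue_outer.-caratheodory A by [].
move=> X; have := mA [set z | X (x - z)%R]; rewrite lebesgue_outer_reflect => ->.
rewrite -(lebesgue_outer_reflect x (X `&` _)) -(lebesgue_outer_reflect x (X `&` ~` _)).
by congr (_ + _); congr lebesgue_outer; apply/funext => z/=; rewrite /setI/setC/= ?subKr.
Qed.

Lemma lebesgue_eball x (r : R) : (0 <= r)%R -> mu (eball x r) <= ((2 * r) ^+ n.+1)%:E.
Proof.
move=> r0; apply: (@le_trans _ _ (box_volume (x - const_mx r, x + const_mx r)%R)).
  apply: lebesgue_outer_box => y; rewrite /eball/= => xy i; rewrite !mxE.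
  have := le_lt_trans (normr_coord_le (y - x)%R i) xy.
  by rewrite !mxE ltr_norml => /andP[h1 h2]; apply/andP; split; lra.
rewrite lee_fin le_eqVlt; apply/orP; left; apply/eqP.
rewrite -[in RHS](card_ord n.+1) -prodr_const; apply: eq_bigr => i _.
by rewrite !mxE; rewrite (_ : _ - _ = 2 * r)%R; [apply/max_idPl; lra|ring].
Qed.

Lemma Rintegral_reflect x (D : set V) (f : V -> R) : lebesgue_measurable D ->
  measurable_fun (setT : set mV) (f : mV -> R) ->
  mu.-integrable [set z | D (x - z)%R] (fun z => (f (x - z)%R)%:E) ->
  (\int[mu]_(y in D) f y = \int[mu]_(z in [set z | D (x - z)]) f (x - z))%R.
Proof.
move=> mD mf If; pose T (z : mV) : mV := (x - (z : V))%R.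
have mT : measurable_fun setT T.
  by move=> _ B mB; rewrite setTI; exact: lebesgue_measurable_reflect.
have mfE := (measurable_EFinP _ _).2 mf.
rewrite /Rintegral -(integral_pushforward (phi := T) mT mfE If mD).
congr fine; apply: eq_measure_integral => B mB _.
by rewrite /pushforward; apply/esym; exact: lebesgue_outer_reflect.
Qed.

Lemma pow2_gt (a : R) : exists k : nat, (a < 2 ^+ k)%R.
Proof.
exists (Num.bound a); have [a0|a0] := leP 0%R a; last by rewrite (lt_trans a0)// exprn_gt0.
rewrite (lt_le_trans (archi_boundP a0))// -natrX ler_nat.
by elim: (Num.bound a) => // m IH; rewrite expnS mul2n -addnn -addn1 leq_add// expn_gt0.
Qed.

(** Countable subadditivity in the form used for kernels: a nonnegative
    function bounded by [c j] on the piece [B j] of a cover, which lies in the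
    ball of radius [rho j], with [c j] times the volume decaying geometrically. *)
Lemma integral_le_geometric (D : set V) (f : V -> R) (B : nat -> set V)
    (c rho : nat -> R) (C th : R) :
  lebesgue_measurable D -> (forall j, lebesgue_measurable (B j)) ->
  measurable_fun (D : set mV) (f : mV -> R) -> (forall y, D y -> 0 <= f y)%R ->
  D `<=` \bigcup_j B j -> (forall j y, D y -> B j y -> f y <= c j)%R ->
  (forall j, 0 <= c j)%R -> (forall j, 0 <= rho j)%R ->
  (forall j, B j `<=` eball 0 (rho j)) ->
  (forall j, c j * (2 * rho j) ^+ n.+1 <= C * th ^+ j)%R -> (0 <= th < 1)%R ->
  \int[mu]_(y in D) (f y)%:E <= (C / (1 - th))%:E.
Proof.
move=> mD mB mf f0 DB fc c0 rho0 Brho cC /andP[th0 th1].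
pose g j (y : mV) : \bar R := ((c j)%:E * (\1_(B j) y)%:E).
have mind (j : nat) : measurable_fun (D : set mV) (fun y : mV => (\1_(B j) y)%:E : \bar R).
  by apply/measurable_EFinP; exact: (@measurable_indic _ mV R D (B j) (mB j)).
have mg j : measurable_fun (D : set mV) (g j) by apply: emeasurable_funM => //; exact: measurable_cst.
have ind0 j (y : mV) : 0 <= (\1_(B j) y)%:E :> \bar R by rewrite lee_fin.
have g0 j (y : mV) : D y -> 0 <= g j y by move=> _; rewrite mule_ge0 ?lee_fin.
apply: (@le_trans _ _ (\int[mu]_(y in D) (\sum_(j <oo) g j y))).
  apply: (@ge0_le_integral _ mV R mu D mD).
  - by move=> y Dy; rewrite lee_fin f0.
  - exact: (measurable_EFinP _ _).2 mf.
  - by apply: ge0_emeasurable_sum => // j y Dy _; exact: g0.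
  - move=> y Dy; have [j _ Bjy] := DB y Dy.
    rewrite (nneseries_split 0 j.+1); last by move=> k _; exact: g0.
    rewrite add0n big_nat_recr//=; apply: (@le_trans _ _ (g j y)).
      by rewrite /g indicE mem_set// mule1 lee_fin fc.
    rewrite -[leLHS]add0e -[leLHS]adde0; apply: leeD.
      by rewrite leeD2r// sume_ge0// => k _; exact: g0.
    by apply: nneseries_ge0 => k _ _; exact: g0.
rewrite (integral_nneseries mu mD mg g0).
have th1' : (`|th| < 1)%R by rewrite ger0_norm.
have cv : (fun k => (\sum_(0 <= j < k) (C * th ^+ j)%:E)%E) @ \oo --> (C / (1 - th))%:E.
  under eq_fun do rewrite sumEFin.
  apply: cvg_EFin; first exact: nearW.
  have cs := @cvg_geometric_series R C th th1'.
  apply: cvg_trans cs; apply: near_eq_cvg; apply: nearW => k /=.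
  by rewrite /series /= /geometric /=.
rewrite -(cvg_lim _ cv)//; apply: lee_lim.
- by apply: is_cvg_nneseries => j _ _; apply: integral_ge0 => y Dy; exact: g0.
- exact: (cvgP _ cv).
- apply: nearW => k; apply: lee_sum => j _.
  rewrite ge0_integralZl//= ?lee_fin// integral_indic//.
  apply: (@le_trans _ _ ((c j)%:E * ((2 * rho j) ^+ n.+1)%:E)).
    rewrite lee_wpmul2l ?lee_fin//; apply: le_trans (lebesgue_eball 0%R (rho0 j)).
    by apply: le_lebesgue_outer => y [/Brho].
  by rewrite -EFinM lee_fin cC.
exact: mB.
Qed.

End lebesgue_measure_rV.

Section kernel_bounds.
Context {R : realType} {n : nat}.
Local Notation V := 'rV[R]_n.+1.
Local Notation mu := (@lebesgue R n).
Local Notation mV := (caratheodory_type (@lebesgue_outer R n)).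

Lemma enorm_powR_measurable (D : set V) (a : R) :
  measurable_fun (D : set mV) (fun y : mV => enorm (y : V) `^ a).
Proof.
have me : measurable_fun (setT : set mV) (fun y : mV => enorm (y : V)).
  by apply: continuous_lebesgue_measurable; exact: enorm_continuous.
apply: (@measurable_funTS _ _ mV); exact: (measurableT_comp (measurable_powR a) me).
Qed.

Lemma powR_half_lt1 (b : R) : 0 < b -> 0 <= (2 : R) `^ (- b) < 1.
Proof.
move=> b0; rewrite powR_ge0/= powRN invf_lt1 ?powR_gt0//.
have := @gt0_ltr_powR R b b0 1 2; rewrite !nnegrE powR1 => -> //.
by rewrite ltr1n.
Qed.

Lemma powR_dyadic (a r : R) j : 0 < r -> (2 ^+ j * r) `^ a = r `^ a * (2 `^ a) ^+ j.
Proof.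
move=> r0; elim: j => [|j IH]; first by rewrite expr0 mul1r mulr1.
by rewrite exprS -mulrA powRM ?IH ?mulr_ge0 ?exprn_ge0 ?(ltW r0)// exprS mulrCA.
Qed.

(** Dyadic annuli: on each, the kernel times the volume is [2 ^ (- a)] times the
    value on the preceding one. *)
Lemma kernel_tail (a : R) : 0 < a -> exists2 c : R, 0 < c &
  forall (r : R) (D : set V), 0 < r -> lebesgue_measurable D ->
  (forall y, D y -> r <= enorm y) ->
  (\int[mu]_(y in D) (enorm (y : V) `^ (- (n.+1%:R + a)))%:E <= (c * r `^ (- a))%:E)%E.
Proof.
move=> a0; pose th : R := 2 `^ (- a).
have /andP[th0 th1] : 0 <= th < 1 by exact: powR_half_lt1.
exists (4 ^+ n.+1 / (1 - th)); first by rewrite divr_gt0 ?exprn_gt0 ?subr_gt0.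
move=> r D r0 mD Dr; rewrite mulrAC.
pose B j : set V := eball 0 (2 ^+ j.+1 * r) `\` eball 0 (2 ^+ j * r).
pose c j : R := (2 ^+ j * r) `^ (- (n.+1%:R + a)).
have p2 j : 0 < 2 ^+ j * r by rewrite mulr_gt0 ?exprn_gt0.
apply: (@integral_le_geometric _ _ D _ B c (fun j => 2 ^+ j.+1 * r) _ _ mD).
- by move=> j; apply: measurableD; apply: open_lebesgue_measurable; exact: open_eball.
- exact: enorm_powR_measurable.
- by move=> y _; rewrite powR_ge0.
- move=> y Dy; have [k0 hk0] := pow2_gt (enorm y / r).
  have ex : exists k, enorm y < 2 ^+ k * r by exists k0; rewrite -ltr_pdivrMr.
  case: (ex_minnP ex) => -[|k] hk kmin.
    by have := Dr y Dy; rewrite leNgt => /negP; rewrite expr0 mul1r in hk.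
  exists k => //; split; rewrite /eball/= subr0//.
  by move=> yk; have := kmin _ yk; rewrite ltnn.
- move=> j y Dy [_]; rewrite /eball/= subr0 => /negP; rewrite -leNgt => yj.
  rewrite /c !powRN lef_pV2 ?posrE ?powR_gt0//; last exact: lt_le_trans yj.
  by apply: ge0_ler_powR => //; rewrite ?nnegrE ?enorm_ge0 ?addr_ge0 ?ltW.
- by move=> j; rewrite powR_ge0.
- by move=> j; exact: ltW.
- by move=> j y [].
- move=> j; rewrite /c opprD powRD; last by rewrite (gt_eqF (p2 j)) implybT.
  rewrite (powR_invn n.+1 (ltW (p2 j))) powR_dyadic// -/th.
  have -> : 2 * (2 ^+ j.+1 * r) = 4 * (2 ^+ j * r) by rewrite exprS; ring.
  have Pn0 : (2 ^+ j * r) ^+ n.+1 != 0 by rewrite gt_eqF// exprn_gt0.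
  by rewrite [X in _ * X]exprMn le_eqVlt; apply/orP; left; apply/eqP; field.
- by rewrite th0.
Qed.

(** The same dyadic summation towards the origin. *)
Lemma kernel_head (b : R) : 0 < b -> exists2 c : R, 0 < c &
  forall (r : R) (D : set V), 0 < r -> lebesgue_measurable D ->
  (forall y, D y -> 0 < enorm y < r) ->
  (\int[mu]_(y in D) (enorm (y : V) `^ (b - n.+1%:R))%:E <= (c * r `^ b)%:E)%E.
Proof.
move=> b0; pose th : R := 2 `^ (- b).
have /andP[th0 th1] : 0 <= th < 1 by exact: powR_half_lt1.
exists (4 ^+ n.+1 / (1 - th)); first by rewrite divr_gt0 ?exprn_gt0 ?subr_gt0.
move=> r D r0 mD Dr; rewrite mulrAC.
pose X j : R := r / 2 ^+ j.
have p2 j : 0 < X j by rewrite divr_gt0 ?exprn_gt0.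
have XS j : X j = 2 * X j.+1 by rewrite /X exprS invfM mulrCA mulVKf.
pose B j : set V := eball 0 (X j) `\` eball 0 (X j.+1).
pose c j : R := X j `^ b / X j.+1 ^+ n.+1.
have Xb j : X j `^ b = r `^ b * th ^+ j.
  have Xr : 2 ^+ j * X j = r by rewrite /X mulrCA divff ?mulr1// expf_neq0.
  rewrite -[in RHS]Xr powR_dyadic// -mulrA -exprMn /th.
  by rewrite -powRD ?subrr ?powRr0 ?expr1n ?mulr1 ?implybT// pnatr_eq0 implybT.
apply: (@integral_le_geometric _ _ D _ B c X _ _ mD).
- by move=> j; apply: measurableD; apply: open_lebesgue_measurable; exact: open_eball.
- exact: enorm_powR_measurable.
- by move=> y _; rewrite powR_ge0.
- move=> y /Dr/andP[y0 yr]; have [k0 hk0] := pow2_gt (r / enorm y).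
  have ex : exists k, r <= 2 ^+ k * enorm y by exists k0; rewrite -ler_pdivrMr// ltW.
  case: (ex_minnP ex) => -[|k] hk kmin.
    by move: hk; rewrite expr0 mul1r leNgt yr.
  exists k => //; split; rewrite /eball/= subr0.
    rewrite /X ltr_pdivlMr ?exprn_gt0// mulrC ltNge; apply/negP => yk.
    by have := kmin _ yk; rewrite ltnn.
  by apply/negP; rewrite -leNgt /X ler_pdivrMr ?exprn_gt0// mulrC.
- move=> j y /Dr/andP[y0 _] [/=]; rewrite /eball/= subr0 => yj /negP; rewrite -leNgt => jy.
  rewrite powRB ?(gt_eqF y0) ?implybT// (powR_mulrn _ (ltW y0)) /c.
  apply: ler_pM; rewrite ?powR_ge0 ?invr_ge0 ?exprn_ge0 ?enorm_ge0//.
    by apply: ge0_ler_powR; rewrite ?nnegrE ?enorm_ge0// ltW.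
  by rewrite lef_pV2 ?posrE ?exprn_gt0// ler_pXn2r ?nnegrE ?enorm_ge0// ltW.
- by move=> j; rewrite divr_ge0 ?powR_ge0 ?exprn_ge0// ltW.
- by move=> j; exact: ltW.
- by move=> j y [].
- move=> j; rewrite /c Xb [in leLHS](XS j) (_ : 2 * (2 * X j.+1) = 4 * X j.+1); last by ring.
  have Pn0 : X j.+1 ^+ n.+1 != 0 by rewrite gt_eqF// exprn_gt0.
  by rewrite [X in _ * X]exprMn le_eqVlt; apply/orP; left; apply/eqP; field.
- by rewrite th0.
Qed.

End kernel_bounds.

(** * Integrals of bounded functions and the kernel *)

Section bounded_integrands.
Context {R : realType} {n : nat}.
Local Notation V := 'rV[R]_n.+1.
Local Notation mu := (@lebesgue R n).
Local Notation mV := (caratheodory_type (@lebesgue_outer R n)).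
Implicit Types (D : set V) (f g : V -> R) (x : V).

Definition summable_on D f : Prop := mu.-integrable (D : set mV) (EFin \o f).

Lemma bounded_summable D f (M : R) : lebesgue_measurable D -> (mu D < +oo)%E ->
  measurable_fun (D : set mV) (f : mV -> R) -> (forall y, D y -> `|f y| <= M) ->
  summable_on D f.
Proof.
move=> mD fD mf fM; apply: (@measurable_bounded_integrable _ mV R mu f D mD fD mf).
exists M; split; first exact: num_real.
by move=> M' MM' y Dy; exact: (le_trans (fM y Dy) (ltW MM')).
Qed.

Lemma bounded_set_finite (Om : set V) D : bounded_set Om -> D `<=` Om -> (mu D < +oo)%E.
Proof.
move=> [M [_ bOm]] DOm; pose r : R := n.+1%:R * (`|M| + 1) + 1.
have Ms : M < `|M| + 1 by rewrite ltr_pwDr// ler_norm.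
have r0 : 0 <= r by rewrite addr_ge0// mulr_ge0// addr_ge0.
apply: (@le_lt_trans _ _ (mu (eball 0 r))); last first.
  by apply: le_lt_trans (lebesgue_eball 0 r0) _; exact: ltry.
apply: le_lebesgue_outer => y /DOm Omy; rewrite /eball/= subr0.
rewrite (le_lt_trans (enorm_le_normr y))// /r ltr_pwDr// ler_wpM2l//.
exact: (bOm _ Ms).
Qed.

Lemma summable_fin D f : lebesgue_measurable D -> summable_on D f ->
  (\int[mu]_(y in D) (f y)%:E)%E = (\int[mu]_(y in D) f y)%R%:E.
Proof. by move=> mD sf; rewrite /Rintegral fineK//; exact: (integrable_fin_num mD sf). Qed.

Lemma le_Rint D f g : lebesgue_measurable D -> summable_on D f -> summable_on D g ->
  (forall y, D y -> f y <= g y) -> \int[mu]_(y in D) f y <= \int[mu]_(y in D) g y.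
Proof. exact: (@le_Rintegral _ mV R mu D f g). Qed.

Lemma RintD D f g : lebesgue_measurable D -> summable_on D f -> summable_on D g ->
  \int[mu]_(y in D) (f y + g y) = \int[mu]_(y in D) f y + \int[mu]_(y in D) g y.
Proof. exact: (@RintegralD _ mV R mu D f g). Qed.

Lemma RintB D f g : lebesgue_measurable D -> summable_on D f -> summable_on D g ->
  \int[mu]_(y in D) (f y - g y) = \int[mu]_(y in D) f y - \int[mu]_(y in D) g y.
Proof. exact: (@RintegralB _ mV R mu D f g). Qed.

Lemma RintZ D f (k : R) : lebesgue_measurable D -> summable_on D f ->
  \int[mu]_(y in D) (k * f y) = k * \int[mu]_(y in D) f y.
Proof. exact: (@RintegralZl _ mV R mu D f k). Qed.

Lemma RintN D f : lebesgue_measurable D -> summable_on D f ->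
  \int[mu]_(y in D) (- f y) = - \int[mu]_(y in D) f y.
Proof.
move=> mD sf; rewrite -mulN1r -RintZ//; apply: eq_Rintegral => y _.
by rewrite mulN1r.
Qed.

Lemma RintU D1 D2 f : lebesgue_measurable D1 -> lebesgue_measurable D2 ->
  summable_on (D1 `|` D2) f -> (forall y, D1 y -> D2 y -> False) ->
  \int[mu]_(y in D1 `|` D2) f y = \int[mu]_(y in D1) f y + \int[mu]_(y in D2) f y.
Proof.
move=> m1 m2 sf dis; apply: (@Rintegral_setU _ mV R mu D1 D2 f m1 m2 sf).
by apply/disj_set2P; rewrite -subset0 => y [/dis].
Qed.

Lemma Rint_ge0 D f : (forall y, D y -> 0 <= f y) -> 0 <= \int[mu]_(y in D) f y.
Proof. by move=> f0; exact: (@Rintegral_ge0 _ mV R mu D f). Qed.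

Lemma Rint_cst D (k : R) : lebesgue_measurable D ->
  \int[mu]_(y in D) k = k * fine (mu D).
Proof. by move=> mD; exact: (@Rintegral_cst _ mV R mu D mD k). Qed.

Lemma Rint_le_ub D f (c : R) : 0 <= c -> (\int[mu]_(y in D) (f y)%:E <= c%:E)%E ->
  (forall y, D y -> 0 <= f y) -> \int[mu]_(y in D) f y <= c.
Proof.
move=> c0 fc f0; rewrite /Rintegral -[leRHS]/(fine c%:E) fine_le//.
rewrite ge0_fin_numE; first exact: le_lt_trans fc (ltry _).
by apply: integral_ge0 => y Dy; rewrite lee_fin f0.
Qed.

Lemma summableS D1 D2 f : lebesgue_measurable D1 -> lebesgue_measurable D2 ->
  D2 `<=` D1 -> summable_on D1 f -> summable_on D2 f.
Proof. by move=> m1 m2 s21; exact: (@integrableS _ mV R mu D1 D2 _ m1 m2 s21). Qed.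

Lemma summableD D f g : lebesgue_measurable D -> summable_on D f -> summable_on D g ->
  summable_on D (fun y => f y + g y).
Proof.
move=> mD sf sg; have := @integrableD _ mV R mu D mD _ _ sf sg.
by apply: eq_integrable.
Qed.

Lemma summableZ D f (k : R) : lebesgue_measurable D -> summable_on D f ->
  summable_on D (fun y => k * f y).
Proof.
move=> mD sf; have := @integrableZl _ mV R mu D mD k _ sf.
by apply: eq_integrable.
Qed.

Lemma summableN D f : lebesgue_measurable D -> summable_on D f ->
  summable_on D (fun y => - f y).
Proof.
move=> mD sf; have := summableZ (-1) mD sf.
by apply: eq_integrable => // y _ /=; rewrite mulN1r.
Qed.

Lemma summableB D f g : lebesgue_measurable D -> summable_on D f -> summable_on D g ->
  summable_on D (fun y => f y - g y).
Proof. by move=> mD sf sg; exact: (summableD mD sf (summableN mD sg)). Qed.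

Lemma continuous_on_measurable (Om : set V) D f : open Om -> D `<=` Om ->
  (forall y, Om y -> {for y, continuous f}) -> measurable_fun (D : set mV) (f : mV -> R).
Proof.
move=> oOm DOm cf.
have mOm : lebesgue_measurable Om by exact: open_lebesgue_measurable.
apply: (@measurable_funS _ _ mV _ Om D f mOm DOm).
apply: (measurability _ (RGenOpens.measurableE R)).
move=> _ [_ [a [b ->] <-]]; apply: open_lebesgue_measurable.
rewrite openE => y [Omy fab]; rewrite /interior; apply: filterI.
  exact: open_nbhs_nbhs.
apply: (cf y Omy); apply: open_nbhs_nbhs; split => //; exact: interval_open.
Qed.

End bounded_integrands.

Section kernel.
Context {R : realType} {n : nat}.
Local Notation V := 'rV[R]_n.+1.
Local Notation mu := (@lebesgue R n).
Local Notation mV := (caratheodory_type (@lebesgue_outer R n)).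
Variable s : R.
Hypothesis s01 : 0 < s < 1.
Implicit Types (D A : set V) (f g : V -> R) (x : V).

Definition fker (v : V) : R := (enorm v `^ (n.+1%:R + 2 * s))^-1.

Let p0 : 0 < n.+1%:R + 2 * s.
Proof. by case/andP: s01 => s0 _; rewrite ltr_wpDl// mulr_gt0. Qed.

Lemma fker_ge0 v : 0 <= fker v.
Proof. by rewrite invr_ge0 powR_ge0. Qed.

Lemma fkerN v : fker (- v) = fker v.
Proof. by rewrite /fker enormN. Qed.

Lemma fker_le v (r : R) : 0 < r -> r <= enorm v -> fker v <= (r `^ (n.+1%:R + 2 * s))^-1.
Proof.
move=> r0 rv; have v0 := lt_le_trans r0 rv.
rewrite lef_pV2 ?posrE ?powR_gt0//.
by apply: ge0_ler_powR => //; rewrite ?nnegrE ltW.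
Qed.

Lemma fker_measurable x D : measurable_fun (D : set mV) (fun y : mV => fker (x - (y : V))).
Proof.
have me : measurable_fun (setT : set mV) (fun y : mV => enorm (x - (y : V))).
  apply: continuous_lebesgue_measurable => y.
  have := @enorm_dist_continuous _ _ x y; rewrite /continuous_at => h.
  by under eq_fun do rewrite enorm_sub; rewrite enorm_sub.
have mk := measurableT_comp (measurable_powR (- (n.+1%:R + 2 * s))) me.
apply: (@measurable_funTS _ _ mV); apply: (eq_measurable_fun _ _ mk) => y _ /=.
by rewrite powRN.
Qed.

Lemma fker0_measurable D : measurable_fun (D : set mV) (fun y : mV => fker (y : V)).
Proof.
have := @fker_measurable 0 D; apply: eq_measurable_fun => y _ /=.
by rewrite sub0r fkerN.
Qed.

Lemma fker_growth_tail : exists2 c : R, 0 < c &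
  forall (r : R) (D : set V), 0 < r -> lebesgue_measurable D ->
  (forall y, D y -> r <= enorm y) ->
  \int[mu]_(y in D) (enorm y `^ s * fker y) <= c * r `^ (- s).
Proof.
have s0 : 0 < s by case/andP: s01.
have [c c0 hc] := @kernel_tail R n _ s0; exists c => // r D r0 mD Dr.
have fE y : D y -> enorm y `^ s * fker y = enorm y `^ (- (n.+1%:R + s)).
  move=> Dy; have y0 := lt_le_trans r0 (Dr y Dy).
  rewrite /fker -powRN -powRD ?(gt_eqF y0) ?implybT//; congr (_ `^ _); ring.
apply: Rint_le_ub; first by rewrite mulr_ge0 ?powR_ge0 ?ltW.
- apply: le_trans (hc r D r0 mD Dr); rewrite le_eqVlt; apply/orP; left; apply/eqP.
  by apply: eq_integral => y; rewrite inE => Dy; rewrite fE.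
- by move=> y _; rewrite mulr_ge0 ?powR_ge0 ?fker_ge0.
Qed.

Lemma fker_head : exists2 c : R, 0 < c &
  forall (r : R) (D : set V), 0 < r -> lebesgue_measurable D ->
  (forall y, D y -> 0 < enorm y < r) ->
  \int[mu]_(y in D) (enorm y ^+ 2 * fker y) <= c * r `^ (2 - 2 * s).
Proof.
have b0 : 0 < 2 - 2 * s by case/andP: s01 => s0 s1; lra.
have [c c0 hc] := @kernel_head R n _ b0; exists c => // r D r0 mD Dr.
have fE y : D y -> enorm y ^+ 2 * fker y = enorm y `^ (2 - 2 * s - n.+1%:R).
  move=> Dy; have /andP[y0 _] := Dr y Dy.
  rewrite /fker -powRN -powR_mulrn ?(ltW y0)// -powRD ?(gt_eqF y0) ?implybT//.
  by congr (_ `^ _); ring.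
apply: Rint_le_ub; first by rewrite mulr_ge0 ?powR_ge0 ?ltW.
- apply: le_trans (hc r D r0 mD Dr); rewrite le_eqVlt; apply/orP; left; apply/eqP.
  by apply: eq_integral => y; rewrite inE => Dy; rewrite fE.
- by move=> y _; rewrite mulr_ge0 ?sqr_ge0 ?fker_ge0.
Qed.

End kernel.

(** * The operator at a point *)

Section operator_at_a_point.
Context {R : realType} {n : nat}.
Local Notation V := 'rV[R]_n.+1.
Local Notation mu := (@lebesgue R n).
Local Notation mV := (caratheodory_type (@lebesgue_outer R n)).
Variable s : R.
Hypothesis s01 : 0 < s < 1.
Implicit Types (D A : set V) (f g phi : V -> R) (x a : V).

Definition shell (A : set V) x (rho r : R) : set V := (A `&` eball x r) `\` eball x rho.

(** Away from the pole a bounded difference times the kernel has a finite integral,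
    so that the truncated operator can be handled in [R]. *)
Definition trunc_Ls A g x (rho : R) : R :=
  \int[mu]_(y in A `\` eball x rho) ((g x - g y) * fker s (x - y)).

Definition quadratic x (c : R) a (b : R) (y : V) : R :=
  c + dotv a (y - x) + b * enorm (y - x) ^+ 2.

Lemma quadratic_C2 (D : set V) x c a b : open D -> C2_on D (quadratic x c a b).
Proof.
move=> oD; have e : quadratic x c a b =1
   (fun y => (c - dotv a x + dotv a y) + b * enorm (y - x) ^+ 2).
  by move=> y; rewrite /quadratic dotvDr dotvNr; ring.
apply: (eq_C2_on oD (fun y _ => esym (e y))).
apply: (C2_add oD); last exact: (C2_mul oD (C2_cst D b) (C2_dist2 x oD)).
exact: (C2_add oD (C2_cst D (c - dotv a x)) (C2_dotv a oD)).
Qed.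

Lemma quadratic_continuous x c a b : continuous (quadratic x c a b).
Proof. by have [cq _] := quadratic_C2 x c a b (@openT V); move=> y; exact: cq. Qed.

Variables (Om Sigma : set V).
Hypotheses (oOm : open Om) (bOm : bounded_set Om) (oS : open Sigma)
  (symS : Sigma = [set - z | z in Sigma]).

(** Seen from [x], the set [A] coincides with [Sigma] in the ball of radius [r].
    Integrals over [A] near [x] become integrals over [Sigma], for which the
    centre [x] no longer matters. *)
Definition sector_at A x (r : R) : Prop :=
  [/\ lebesgue_measurable A, A `<=` Om, Om x, 0 < r &
      reflected x A `&` eball 0 r = Sigma `&` eball 0 r].

Lemma sector_at_le A x r r' : 0 < r' -> r' <= r -> sector_at A x r -> sector_at A x r'.
Proof.
move=> r'0 r'r [mA AO Ox r0 e]; split => //.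
have sub : eball (0 : V) r' `<=` eball 0 r by move=> y; rewrite /eball/= => /lt_le_trans; apply.
rewrite eqEsubset; split=> y [Hy yr']; split => //.
  by have [] : (Sigma `&` eball 0 r) y by rewrite -e; split => //; exact: sub.
by have [] : (reflected x A `&` eball 0 r) y by rewrite e; split => //; exact: sub.
Qed.

Lemma Sigma_opp z : Sigma (- z) <-> Sigma z.
Proof.
split=> Sz; rewrite symS; last by exists z.
by exists (- z); rewrite ?opprK.
Qed.

Lemma shell_measurable A x rho r : lebesgue_measurable A -> lebesgue_measurable (shell A x rho r).
Proof.
move=> mA; apply: measurableD; last exact/open_lebesgue_measurable/open_eball.
by apply: measurableI => //; exact/open_lebesgue_measurable/open_eball.
Qed.

Lemma outer_measurable A x rho : lebesgue_measurable A -> lebesgue_measurable (A `\` eball x rho).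
Proof. by move=> mA; apply: measurableD => //; exact/open_lebesgue_measurable/open_eball. Qed.

Lemma eball_reflect x z (r : R) : eball x r (x - z) <-> eball 0 r z.
Proof. by rewrite /eball/= subr0 addrAC subrr add0r enormN. Qed.

Lemma shell_reflect A x rho r : sector_at A x r ->
  [set z | shell A x rho r (x - z)] = shell Sigma 0 rho r.
Proof.
move=> [_ _ _ _ e]; rewrite eqEsubset; split=> z.
  move=> [[Az /eball_reflect zr] Nz].
  have [Sz _] : (Sigma `&` eball 0 r) z by rewrite -e.
  by split; [split|move=> zrho; apply: Nz; apply/eball_reflect].
move=> [[Sz zr] Nz].
have [Az _] : (reflected x A `&` eball 0 r) z by rewrite e.
by split; [split=> //; exact/eball_reflect|move=> /eball_reflect].
Qed.

Lemma bounded_fin D : D `<=` Om -> (mu D < +oo)%E.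
Proof. exact: bounded_set_finite. Qed.

Lemma ball_fin D r : D `<=` eball 0 r -> (mu D < +oo)%E.
Proof.
move=> Dr; apply: (@le_lt_trans _ _ (mu (eball 0 `|r|))).
  apply: le_lebesgue_outer => y /Dr; rewrite /eball/= => h.
  exact: lt_le_trans h (ler_norm r).
exact: le_lt_trans (lebesgue_eball 0 (normr_ge0 r)) (ltry _).
Qed.

Lemma kernel_summable D x f (rho M : R) : lebesgue_measurable D -> (mu D < +oo)%E -> 0 < rho ->
  measurable_fun (D : set mV) (f : mV -> R) -> (forall y, D y -> `|f y| <= M) ->
  (forall y, D y -> rho <= enorm (x - y)) ->
  summable_on D (fun y => f y * fker s (x - y)).
Proof.
move=> mD fD rho0 mf fM Drho.
apply: (@bounded_summable _ _ _ _ (M * (rho `^ (n.+1%:R + 2 * s))^-1) mD fD).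
  by apply: measurable_funM; [exact: mf|exact: fker_measurable].
move=> y Dy; rewrite normrM (ger0_norm (fker_ge0 _ _)).
by apply: ler_pM => //; [exact: fker_ge0|exact: fM|exact: (fker_le s01 rho0 (Drho y Dy))].
Qed.

Lemma Rint_shell A x f (rho r M : R) : sector_at A x r -> 0 < rho ->
  measurable_fun (setT : set mV) (f : mV -> R) -> (forall y, shell A x rho r y -> `|f y| <= M) ->
  \int[mu]_(y in shell A x rho r) f y = \int[mu]_(z in shell Sigma 0 rho r) f (x - z).
Proof.
move=> sA rho0 mf fM; have [mA AO _ _ _] := sA.
have mD := @shell_measurable A x rho r mA.
rewrite (@Rintegral_reflect _ _ x) ?shell_reflect// -(shell_reflect rho sA).
have mfx : measurable_fun (setT : set mV) (fun z : mV => f (x - (z : V))).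
  have mT : measurable_fun (setT : set mV) (fun z : mV => (x - (z : V) : mV)).
    by move=> _ B mB; rewrite setTI; exact: lebesgue_measurable_reflect.
  exact: (measurableT_comp mf mT).
apply: (@bounded_summable _ _ _ _ M).
- exact: lebesgue_measurable_reflect.
- rewrite /lebesgue lebesgue_outer_reflect; apply: bounded_fin => y [[Ay _] _]; exact: AO.
- exact: (@measurable_funTS _ _ mV).
- by move=> z Dz; exact: fM.
Qed.

Definition second_moment (rho r : R) : R :=
  \int[mu]_(z in shell Sigma 0 rho r) (enorm z ^+ 2 * fker s z).

Lemma measurable_Sigma : lebesgue_measurable Sigma.
Proof. exact: open_lebesgue_measurable. Qed.

Lemma shellS_summable f (rho r M : R) : 0 < rho ->
  measurable_fun (setT : set mV) (f : mV -> R) ->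
  (forall z, shell Sigma 0 rho r z -> `|f z| <= M) ->
  summable_on (shell Sigma 0 rho r) (fun z => f z * fker s z).
Proof.
move=> rho0 mf fM; have mD := @shell_measurable _ 0 rho r measurable_Sigma.
have sf : summable_on (shell Sigma 0 rho r) (fun z => f z * fker s (0 - z)).
  apply: (kernel_summable mD _ rho0 _ fM).
  - by apply: (@ball_fin _ r) => z [] [].
  - by apply: (@measurable_funTS _ _ mV); exact: mf.
  - by move=> z [_ /negP]; rewrite /eball/= -leNgt subr0 sub0r enormN.
by move: sf; apply: eq_integrable => // z _ /=; rewrite sub0r fkerN.
Qed.

Lemma sqr_shell_le (rho r : R) z : shell Sigma 0 rho r z -> `|enorm z ^+ 2| <= r ^+ 2.
Proof.
move=> [[_ zr] _]; move: zr; rewrite /eball/= subr0 => zr.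
rewrite ger0_norm ?sqr_ge0// ler_pXn2r ?nnegrE ?enorm_ge0 ?ltW//.
exact: le_lt_trans (enorm_ge0 z) zr.
Qed.

Lemma sqr_measurable : measurable_fun (setT : set mV) (fun z : mV => enorm (z : V) ^+ 2).
Proof.
have [cq _] := C2_dist2 0 (@openT V).
apply: continuous_lebesgue_measurable => z; have := cq z Logic.I.
by rewrite /prop_for /continuous_at subr0; under eq_fun do rewrite subr0.
Qed.

Lemma second_moment_summable rho r : 0 < rho ->
  summable_on (shell Sigma 0 rho r) (fun z => enorm z ^+ 2 * fker s z).
Proof. by move=> rho0; apply: (shellS_summable rho0 sqr_measurable); exact: sqr_shell_le. Qed.

Lemma second_moment_ge0 rho r : 0 <= second_moment rho r.
Proof. by apply: Rint_ge0 => z _; rewrite mulr_ge0 ?sqr_ge0 ?fker_ge0. Qed.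

Lemma dotv_continuous a : continuous (dotv a).
Proof. by have [ca _] := C2_dotv a (@openT V); move=> y; exact: ca. Qed.

Lemma abs_dotv_le a z : `|dotv a z| <= enorm a * enorm z.
Proof.
rewrite ler_norml dotv_le andbT lerNl -dotvNr.
by rewrite (le_trans (dotv_le a (- z)))// enormN.
Qed.

Lemma dotv_summable a rho r : 0 < rho ->
  summable_on (shell Sigma 0 rho r) (fun z => dotv a z * fker s z).
Proof.
move=> rho0; apply: (shellS_summable (M := enorm a * r) rho0).
  exact/continuous_lebesgue_measurable/dotv_continuous.
move=> z [[_ zr] _]; rewrite (le_trans (abs_dotv_le a z))// ler_wpM2l ?enorm_ge0//.
by rewrite ltW//; move: zr; rewrite /eball/= subr0.
Qed.

(** [Sigma] is symmetric and the integrand is odd: this is where the hypothesis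
    [Sigma = - Sigma] enters. *)
Lemma first_moment_even (k : V -> R) a rho r : (forall z, k (- z) = k z) ->
  measurable_fun (setT : set mV) (k : mV -> R) ->
  summable_on (shell Sigma 0 rho r) (fun z => dotv a z * k z) ->
  \int[mu]_(z in shell Sigma 0 rho r) (dotv a z * k z) = 0.
Proof.
move=> kN mk sf; pose D := shell Sigma 0 rho r.
have mD : lebesgue_measurable D by exact/shell_measurable/measurable_Sigma.
have Dsym : [set z | D (0 - z)] = D.
  rewrite eqEsubset; split=> z; rewrite /D /shell /eball/= !subr0 sub0r enormN.
    by move=> [[/Sigma_opp Sz ?] ?].
  by move=> [[Sz ?] ?]; do 2!split => //; apply/Sigma_opp.
have fN z : dotv a (0 - z) * k (0 - z) = - (dotv a z * k z).
  by rewrite sub0r dotvNr kN mulNr.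
have : \int[mu]_(z in D) (dotv a z * k z) = - \int[mu]_(z in D) (dotv a z * k z).
  have mf : measurable_fun (setT : set mV) (fun z : mV => dotv a (z : V) * k (z : V)).
    apply: measurable_funM; last exact: mk.
    exact/continuous_lebesgue_measurable/dotv_continuous.
  rewrite -(RintN mD sf) (@Rintegral_reflect _ _ 0 D _ mD mf) Dsym.
    by apply: eq_Rintegral => z _; rewrite fN.
  by have := summableN mD sf; apply: eq_integrable => // z _ /=; rewrite fN.
by move=> e; lra.
Qed.

Lemma first_moment_eq0 a rho r : 0 < rho ->
  \int[mu]_(z in shell Sigma 0 rho r) (dotv a z * fker s z) = 0.
Proof.
move=> rho0; apply: first_moment_even; [exact: fkerN|exact: fker0_measurable|].
exact: dotv_summable.
Qed.

Lemma quadratic_shell A x c a b (rho r : R) : sector_at A x r -> 0 < rho ->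
  \int[mu]_(y in shell A x rho r) ((c - quadratic x c a b y) * fker s (x - y)) =
  - (b * second_moment rho r).
Proof.
move=> sA rho0; pose D := shell Sigma 0 rho r.
have mD : lebesgue_measurable D by exact/shell_measurable/measurable_Sigma.
have qE (z : V) : (c - quadratic x c a b (x - z)) * fker s (x - (x - z)) =
    dotv a z * fker s z + (- b) * (enorm z ^+ 2 * fker s z).
  rewrite /quadratic; have -> : x - z - x = - z by rewrite addrAC subrr sub0r.
  rewrite subKr dotvNr enormN; ring.
have qb z : D z -> `|(dotv a z + - b * enorm z ^+ 2)| <= enorm a * r + `|b| * r ^+ 2.
  move=> Dz; apply: (le_trans (ler_normD _ _)); apply: lerD.
    rewrite (le_trans (abs_dotv_le a z))// ler_wpM2l ?enorm_ge0//.
    by case: Dz => -[_ zr] _; rewrite ltW//; move: zr; rewrite /eball/= subr0.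
  by rewrite normrM normrN ler_wpM2l//; exact: sqr_shell_le Dz.
rewrite (@Rint_shell _ _ _ rho r ((enorm a * r + `|b| * r ^+ 2) * (rho `^ (n.+1%:R + 2 * s))^-1) sA rho0); first last.
- move=> y Dy; have Dz : D (x - y).
    by rewrite /D -(shell_reflect rho sA) /= subKr.
  have -> : y = x - (x - y) by rewrite subKr.
  rewrite qE [X in `|_ + X|]mulrA -mulrDl normrM (ger0_norm (fker_ge0 _ _)).
  apply: ler_pM => //; [exact: fker_ge0|exact: qb|].
  apply: (fker_le s01 rho0); case: Dz => _ /negP.
  by rewrite /eball/= -leNgt subr0.
- apply: measurable_funM; last exact: fker_measurable.
  apply: measurable_funB; first exact: measurable_cst.
  exact/continuous_lebesgue_measurable/quadratic_continuous.
under eq_Rintegral do rewrite qE.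
have s1 := dotv_summable a r rho0.
have s2 := second_moment_summable r rho0.
rewrite (RintD mD s1 (summableZ (- b) mD s2)) (RintZ (- b) mD s2) first_moment_eq0//.
by rewrite add0r mulNr.
Qed.

Lemma second_moment_le : exists2 c : R, 0 < c & forall rho r, 0 < rho -> 0 < r ->
  second_moment rho r <= c * r `^ (2 - 2 * s).
Proof.
have [c c0 hc] := @fker_head R n s s01; exists c => // rho r rho0 r0; apply: hc => //.
  exact/shell_measurable/measurable_Sigma.
move=> z [[_ zr] /negP]; rewrite /eball/= -leNgt => rz; move: zr rz.
by rewrite /eball/= !subr0 => -> /(lt_le_trans rho0) ->.
Qed.

Lemma second_moment_mono rho rho' r : 0 < rho -> rho <= rho' ->
  second_moment rho' r <= second_moment rho r.
Proof.
move=> rho0 rr'; pose D := shell Sigma 0 rho' r; pose D' := shell Sigma 0 rho r.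
have mD : lebesgue_measurable D by exact/shell_measurable/measurable_Sigma.
have mD' : lebesgue_measurable D' by exact/shell_measurable/measurable_Sigma.
have DD' : D `<=` D'.
  move=> z [Sz Nz]; split => // zr; apply: Nz; move: zr; rewrite /eball/= => zr.
  exact: lt_le_trans zr rr'.
have sD' := second_moment_summable r rho0.
have DE : D' = D `|` (D' `\` D) by rewrite setDUK.
have mDD : lebesgue_measurable (D' `\` D) by exact: measurableD.
rewrite /second_moment -/D -/D' DE RintU -?DE//; last by move=> z Dz [].
by rewrite lerDl; apply: Rint_ge0 => z _; rewrite mulr_ge0 ?sqr_ge0 ?fker_ge0.
Qed.

End operator_at_a_point.

(** * Principal values and test functions *)

Section test_functions.
Context {R : realType} {n : nat}.
Local Notation V := 'rV[R]_n.+1.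
Local Notation mu := (@lebesgue R n).
Local Notation mV := (caratheodory_type (@lebesgue_outer R n)).
Variable s : R.
Hypothesis s01 : 0 < s < 1.
Implicit Types (D A : set V) (f g phi : V -> R) (x a : V).
Variables (Om Sigma : set V).
Hypotheses (oOm : open Om) (bOm : bounded_set Om) (oS : open Sigma)
  (symS : Sigma = [set - z | z in Sigma]).
Local Notation sector := (sector_at Om Sigma).
Local Notation moment := (second_moment s Sigma).

Lemma outer_ge x (rho : R) A y : (A `\` eball x rho) y -> rho <= enorm (x - y).
Proof. by move=> [_ /negP]; rewrite /eball/= -leNgt enorm_sub. Qed.

Lemma trunc_summable A x phi (rho M : R) : lebesgue_measurable A -> A `<=` Om -> Om x -> 0 < rho ->
  measurable_fun (A `\` eball x rho : set mV) (phi : mV -> R) ->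
  (forall y, Om y -> `|phi y| <= M) ->
  summable_on (A `\` eball x rho) (fun y => (phi x - phi y) * fker s (x - y)).
Proof.
move=> mA AO Ox rho0 mphi phiM; have mD := @outer_measurable _ _ A x rho mA.
have fD : (mu (A `\` eball x rho) < +oo)%E by apply: (bounded_fin bOm) => y [/AO].
apply: (kernel_summable s01 (M := M + M) mD fD rho0).
- by apply: measurable_funB; [exact: measurable_cst|exact: mphi].
- move=> y [/AO Oy _]; rewrite (le_trans (ler_normB _ _))// lerD//; exact: phiM.
- by move=> y Dy; exact: outer_ge Dy.
Qed.

Lemma outer_split A x (rho r : R) : rho <= r ->
  A `\` eball x rho = (A `\` eball x r) `|` shell A x rho r.
Proof.
move=> rr; have sub y : eball x rho y -> eball x r y.
  by rewrite /eball/= => /lt_le_trans; apply.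
rewrite eqEsubset; split=> y; last first.
  by move=> [[Ay Ny]|[[Ay yr] Ny]]; split => // /sub.
move=> [Ay Ny]; have [yr|Nr] := pselect (eball x r y); [right|left] => //.
Qed.

Lemma trunc_split A x phi (rho r M : R) : lebesgue_measurable A -> A `<=` Om -> Om x ->
  0 < rho -> rho <= r -> measurable_fun (A : set mV) (phi : mV -> R) ->
  (forall y, Om y -> `|phi y| <= M) ->
  trunc_Ls s A phi x rho = trunc_Ls s A phi x r +
    \int[mu]_(y in shell A x rho r) ((phi x - phi y) * fker s (x - y)).
Proof.
move=> mA AO Ox rho0 rr mphi phiM; rewrite /trunc_Ls (outer_split A x rr).
have mphi' : measurable_fun (A `\` eball x rho : set mV) (phi : mV -> R).
  by apply: (@measurable_funS _ _ mV _ A) => // y [].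
apply: RintU; [exact: outer_measurable|exact: shell_measurable| |].
- rewrite -(outer_split A x rr); exact: trunc_summable phiM.
- by move=> y [_ Ny] [[]].
Qed.

Lemma trunc_Ls_fin A x phi (rho M : R) : lebesgue_measurable A -> A `<=` Om -> Om x ->
  0 < rho -> measurable_fun (A : set mV) (phi : mV -> R) ->
  (forall y, Om y -> `|phi y| <= M) -> truncated_Ls s A phi x rho = (trunc_Ls s A phi x rho)%:E.
Proof.
move=> mA AO Ox rho0 mphi phiM; apply: summable_fin; first exact: outer_measurable.
apply: trunc_summable phiM => //.
by apply: (@measurable_funS _ _ mV _ A) => // y [].
Qed.

(** The moment increases as the inner radius decreases, so that the supremum is
    the limit at [0]. *)
Definition pv_moment (r : R) : R := sup [set moment rho r | rho in [set` `]0, r[]].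

Lemma moment_cvg (r : R) : 0 < r -> moment rho r @[rho --> 0^'+] --> pv_moment r.
Proof.
move=> r0; have [c c0 hc] := second_moment_le s01 oS.
apply: nonincreasing_at_right_cvgr; first by rewrite bnd_simp.
  move=> a b; rewrite !in_itv/= => /andP[a0 _] /andP[b0 _] ab.
  exact: second_moment_mono.
by exists (c * r `^ (2 - 2 * s)) => z [rho /=]; rewrite in_itv/= => /andP[rho0 _] <-; exact: hc.
Qed.

Lemma pv_moment_ge0 (r : R) : 0 < r -> 0 <= pv_moment r.
Proof.
move=> r0; rewrite -(cvg_lim _ (moment_cvg r0))//.
apply: limr_ge; first by apply/cvg_ex; exists (pv_moment r); exact: moment_cvg.
by apply: nearW => rho; exact: second_moment_ge0.
Qed.

Lemma pv_moment_le (r B : R) : 0 < r -> (forall rho, 0 < rho -> moment rho r <= B) ->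
  pv_moment r <= B.
Proof.
move=> r0 hB; apply: ge_sup.
  by exists (moment (r / 2) r), (r / 2) => //=; rewrite in_itv/=; apply/andP; split; lra.
by move=> z [rho /=]; rewrite in_itv/= => /andP[rho0 _] <-; exact: hB.
Qed.

(** Near [x] the linear part cancels by symmetry and the quadratic part is
    integrable against the kernel, since [2 - 2 s > 0]: the principal value exists,
    and the limit in the definition of the operator is genuine. *)
Lemma Ls_quadratic A x phi a (b r M : R) : sector A x r ->
  measurable_fun (A : set mV) (phi : mV -> R) -> (forall y, Om y -> `|phi y| <= M) ->
  (forall y, A y -> eball x r y -> phi y = quadratic x (phi x) a b y) ->
  Ls s A phi x = (trunc_Ls s A phi x r - b * pv_moment r)%:E.
Proof.
move=> sA mphi phiM phiq; have [mA AO Ox r0 _] := sA.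
have cv : trunc_Ls s A phi x r - b * moment rho r @[rho --> 0^'+] -->
    trunc_Ls s A phi x r - b * pv_moment r.
  by apply: cvgB; [exact: cvg_cst|apply: cvgM; [exact: cvg_cst|exact: moment_cvg]].
apply: cvg_lim => //.
have cvE : (trunc_Ls s A phi x r - b * moment rho r)%:E @[rho --> 0^'+] -->
    (trunc_Ls s A phi x r - b * pv_moment r)%:E.
  by apply: cvg_EFin; [exact: nearW|exact: cv].
apply: cvg_trans cvE; apply: near_eq_cvg; near=> rho.
have rho0 : 0 < rho by near: rho; exact: nbhs_right_gt.
have rhor : rho < r by near: rho; exact: nbhs_right_lt.
rewrite (trunc_Ls_fin mA AO Ox rho0 mphi phiM) (trunc_split mA AO Ox rho0 (ltW rhor) mphi phiM).
congr (_ + _)%:E; rewrite -(quadratic_shell s01 bOm oS symS (phi x) a b sA rho0).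
by apply: eq_Rintegral => y; rewrite inE => -[[Ay yr] _]; rewrite -phiq.
Unshelve. all: by end_near. Qed.

Lemma trunc_LsN A x phi (rho M : R) : lebesgue_measurable A -> A `<=` Om -> Om x ->
  0 < rho -> measurable_fun (A : set mV) (phi : mV -> R) ->
  (forall y, Om y -> `|phi y| <= M) ->
  trunc_Ls s A (fun y => - phi y) x rho = - trunc_Ls s A phi x rho.
Proof.
move=> mA AO Ox rho0 mphi phiM; rewrite /trunc_Ls -RintN.
- by apply: eq_Rintegral => y _; ring.
- exact: outer_measurable.
- apply: trunc_summable phiM => //.
  by apply: (@measurable_funS _ _ mV _ A) => // y [].
Qed.

Lemma Ls_opp A x phi a (b r M : R) : sector A x r ->
  measurable_fun (A : set mV) (phi : mV -> R) -> (forall y, Om y -> `|phi y| <= M) ->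
  (forall y, A y -> eball x r y -> phi y = quadratic x (phi x) a b y) ->
  Ls s A (fun y => - phi y) x = (- Ls s A phi x)%E.
Proof.
move=> sA mphi phiM phiq; have [mA AO Ox r0 _] := sA.
rewrite (Ls_quadratic sA mphi phiM phiq) (@Ls_quadratic A x (fun y => - phi y) (- a) (- b) r M sA).
- by rewrite (trunc_LsN mA AO Ox r0 mphi phiM) -EFinN; congr EFin; ring.
- by apply: measurable_funN.
- by move=> y Oy; rewrite normrN; exact: phiM.
- by move=> y Ay yr; rewrite phiq// /quadratic dotvNl; ring.
Qed.

(** A continuous [g] is not a test function, but this is a good substitute: the
    paraboloid where the kernel is singular, and [g] up to [e] elsewhere. *)
Definition approximant x g a (b delta e : R) phi : Prop :=
  [/\ forall y, Om y -> {for y, continuous phi},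
      forall y, Om y -> eball x (delta / 2) y -> phi y = quadratic x (g x) a b y,
      forall y, Om y -> g y <= phi y <= quadratic x (g x) a b y + e &
      forall y, Om y -> ~ eball x delta y -> phi y <= g y + e].

Lemma quadratic_bounded x c a (b : R) : exists M : R, forall y, Om y -> `|quadratic x c a b y| <= M.
Proof.
have [[y0 Oy0]|O0] := pselect (Om !=set0); last first.
  by exists 0 => y Oy; exfalso; apply: O0; exists y.
have cK := compact_closure bOm.
have nq : continuous (fun y : V => `|quadratic x c a b y|).
  move=> y; apply: (@continuous_comp _ _ _ (quadratic x c a b) (fun t : R => `|t|)).
    exact: quadratic_continuous.
  exact: norm_continuous.
have [z _ zmax] := compact_EVT_max (ex_intro _ y0 (sub_closure Oy0)) cK
  (continuous_subspaceT nq).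
exists `|quadratic x c a b z| => y Oy; apply: zmax; rewrite inE; exact: sub_closure.
Qed.

Lemma approximant_bounded x g a (b delta e M : R) phi : approximant x g a b delta e phi ->
  (forall y, Om y -> `|g y| <= M) -> exists M' : R, forall y, Om y -> `|phi y| <= M'.
Proof.
move=> [_ _ gphi _] gM; have [Q hQ] := quadratic_bounded x (g x) a b.
exists (Num.max M (Q + e)) => y Oy; have /andP[h1 h2] := gphi y Oy.
have := gM y Oy; have := hQ y Oy; rewrite !ler_norml => /andP[q1 q2] /andP[g1 g2].
have m1 : M <= Num.max M (Q + e) by rewrite le_max lexx.
have m2 : Q + e <= Num.max M (Q + e) by rewrite le_max lexx orbT.
by apply/andP; split; lra.
Qed.

Lemma approximant_measurable x g a (b delta e : R) phi A : approximant x g a b delta e phi ->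
  A `<=` Om -> measurable_fun (A : set mV) (phi : mV -> R).
Proof. by move=> [cphi _ _ _] AO; exact: continuous_on_measurable oOm AO cphi. Qed.

Lemma approximant_center x g a (b delta e : R) phi : approximant x g a b delta e phi ->
  Om x -> 0 < delta -> phi x = g x.
Proof.
move=> [_ phiq _ _] Ox d0; rewrite phiq//.
  by rewrite /quadratic subrr enorm0 expr0n mulr0 addr0 /dotv big1 ?addr0// => i _; rewrite mxE mulr0.
by rewrite /eball/= subrr enorm0 divr_gt0.
Qed.

(** Comparison of the operator on the test function with the truncated integral of
    [g]: off the ball they differ by [e], and inside it only the second order
    coefficient [b] counts. *)
Lemma approximant_Ls x g a (b delta e M : R) phi A : approximant x g a b delta e phi ->
  sector A x delta -> measurable_fun (setT : set mV) (g : mV -> R) ->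
  (forall y, Om y -> `|g y| <= M) -> 0 < e ->
  exists L : R, [/\ Ls s A phi x = L%:E, Ls s A (fun y => - phi y) x = (- L)%:E &
    trunc_Ls s A g x delta - b * (moment (delta / 2) delta + pv_moment (delta / 2))
      - e * \int[mu]_(y in A `\` eball x (delta / 2)) fker s (x - y) <= L].
Proof.
move=> phiA sA mg gM e0; have [mA AO Ox d0 _] := sA.
have d20 : 0 < delta / 2 by rewrite divr_gt0.
have d2d : delta / 2 <= delta by lra.
have [M' phiM] := approximant_bounded phiA gM.
have mphi := approximant_measurable phiA AO.
have phix := approximant_center phiA Ox d0.
have [cphi phiq gphi phig] := phiA.
have sA2 := sector_at_le d20 d2d sA.
have phiq' y : A y -> eball x (delta / 2) y -> phi y = quadratic x (phi x) a b y.
  by move=> /AO Oy yd; rewrite phix; exact: phiq.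
have LE := Ls_quadratic sA2 mphi phiM phiq'.
have LN := Ls_opp sA2 mphi phiM phiq'.
exists (trunc_Ls s A phi x (delta / 2) - b * pv_moment (delta / 2)); split => //.
  by rewrite LN LE.
rewrite (trunc_split mA AO Ox d20 d2d mphi phiM).
have mD := @outer_measurable _ _ A x delta mA.
have mD2 := @outer_measurable _ _ A x (delta / 2) mA.
have mS := @shell_measurable _ _ A x (delta / 2) delta mA.
have msub (D : set V) : lebesgue_measurable D -> D `<=` A -> measurable_fun (D : set mV) (phi : mV -> R).
  by move=> _ DA; apply: (@measurable_funS _ _ mV _ A) => //.
have Dsub : A `\` eball x delta `<=` A by move=> y [].
have Ssub : shell A x (delta / 2) delta `<=` A by move=> y [[]].
have mgD (D : set V) : measurable_fun (D : set mV) (g : mV -> R).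
  by apply: (@measurable_funTS _ _ mV); exact: mg.
have sk2 : summable_on (A `\` eball x (delta / 2)) (fun y => 1 * fker s (x - y)).
  apply: (kernel_summable s01 (M := 1) mD2 _ d20).
  - by apply: (bounded_fin bOm) => y [/AO].
  - exact: measurable_cst.
  - by move=> y _; rewrite normr1.
  - by move=> y Dy; exact: outer_ge Dy.
have sk2' : summable_on (A `\` eball x (delta / 2)) (fun y => fker s (x - y)).
  by apply: eq_integrable sk2 => // y _ /=; rewrite mul1r.
have DE := outer_split A x d2d.
have skD : summable_on (A `\` eball x delta) (fun y => fker s (x - y)).
  by apply: (summableS mD2 mD) sk2' => y Dy; rewrite DE; left.
have skS : summable_on (shell A x (delta / 2) delta) (fun y => fker s (x - y)).
  by apply: (summableS mD2 mS) sk2' => y Dy; rewrite DE; right.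
have kE : \int[mu]_(y in A `\` eball x (delta / 2)) fker s (x - y) =
    \int[mu]_(y in A `\` eball x delta) fker s (x - y) +
    \int[mu]_(y in shell A x (delta / 2) delta) fker s (x - y).
  rewrite DE; apply: RintU => //; first by rewrite -DE.
  by move=> y [_ Ny] [[]].
have sphi2 := trunc_summable mA AO Ox d20 (msub _ mD2 (@subDsetl _ _ _)) phiM.
have sphiS : summable_on (shell A x (delta / 2) delta) (fun y => (phi x - phi y) * fker s (x - y)).
  by apply: (summableS mD2 mS) sphi2 => y Dy; rewrite DE; right.
have sphiD := trunc_summable mA AO Ox d0 (msub _ mD Dsub) phiM.
have sg := trunc_summable mA AO Ox d0 (mgD _) gM.
have I1 : trunc_Ls s A g x delta - e * \int[mu]_(y in A `\` eball x delta) fker s (x - y)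
    <= trunc_Ls s A phi x delta.
  rewrite /trunc_Ls -RintZ// -RintB//; last exact: summableZ.
  apply: le_Rint => //; first by apply: summableB => //; exact: summableZ.
  move=> y [Ay Ny]; rewrite -mulrBl ler_wpM2r ?fker_ge0// phix.
  by have := phig y (AO y Ay) Ny; lra.
have [Q hQ] := quadratic_bounded x (g x) a b.
have sq : summable_on (shell A x (delta / 2) delta)
    (fun y => (g x - quadratic x (g x) a b y) * fker s (x - y)).
  apply: (kernel_summable s01 (M := `|g x| + Q) mS _ d20).
  - by apply: (bounded_fin bOm) => y /Ssub/AO.
  - apply: measurable_funB; first exact: measurable_cst.
    apply: (@measurable_funTS _ _ mV).
    exact/continuous_lebesgue_measurable/quadratic_continuous.
  - move=> y /Ssub/AO Oy; rewrite (le_trans (ler_normB _ _))// lerD2l; exact: hQ.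
  - by move=> y [_ /negP]; rewrite /eball/= -leNgt enorm_sub.
have I2 : - (b * moment (delta / 2) delta) - e * \int[mu]_(y in shell A x (delta / 2) delta) fker s (x - y)
    <= \int[mu]_(y in shell A x (delta / 2) delta) ((phi x - phi y) * fker s (x - y)).
  rewrite -(quadratic_shell s01 bOm oS symS (g x) a b sA d20) -RintZ// -RintB//; last exact: summableZ.
  apply: le_Rint => //; first by apply: summableB => //; exact: summableZ.
  move=> y /Ssub Ay; rewrite -mulrBl ler_wpM2r ?fker_ge0// phix.
  by have /andP[_] := gphi y (AO y Ay); lra.
rewrite kE; move: I1 I2; set X1 := trunc_Ls _ _ _ _ _; set X2 := trunc_Ls _ _ _ _ _.
by lra.
Qed.

(** If every admissible test function gives the value at most [c], so does the
    function itself, up to an error that vanishes with the radius: first let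
    the test function tend to [g] off the ball, then shrink the ball. *)
Lemma jet_limit A x g a (b r M c : R) : sector A x r ->
  measurable_fun (setT : set mV) (g : mV -> R) -> (forall y, Om y -> `|g y| <= M) ->
  (forall delta e, 0 < delta -> delta <= r -> 0 < e ->
     exists phi, approximant x g a b delta e phi /\ (Ls s A phi x <= c%:E)%E) ->
  forall e, 0 < e -> exists2 d0, 0 < d0 & forall delta, 0 < delta -> delta < d0 ->
    trunc_Ls s A g x delta <= c + e.
Proof.
move=> sA mg gM Happ e e0; have [mA AO Ox r0 _] := sA.
have [cm cm0 hcm] := second_moment_le s01 oS.
have b20 : 0 < 2 - 2 * s by case/andP: s01 => s0 s1; lra.
pose K := 2 * `|b| * cm + 1.
have K0 : 0 < K by rewrite ltr_pwDr// !mulr_ge0// ltW.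
(* the radius at which the second moments have shrunk to [e / K] *)
pose d1 := (e / K) `^ ((2 - 2 * s)^-1).
have d10 : 0 < d1 by rewrite powR_gt0// divr_gt0.
exists (Num.min r d1); first by rewrite lt_min r0.
move=> delta d0; rewrite lt_min => /andP[dr dd1].
have d20 : 0 < delta / 2 by rewrite divr_gt0.
have sAd := sector_at_le d0 (ltW dr) sA.
have m1 : moment (delta / 2) delta <= cm * delta `^ (2 - 2 * s) by exact: hcm.
have m2 : pv_moment (delta / 2) <= cm * delta `^ (2 - 2 * s).
  apply: pv_moment_le => // rho rho0; apply: le_trans (hcm _ _ rho0 d20) _.
  rewrite ler_wpM2l ?(ltW cm0)//; apply: ge0_ler_powR; rewrite ?nnegrE; lra.
have small : K * delta `^ (2 - 2 * s) <= e.
  rewrite -ler_pdivlMl// [leRHS]mulrC.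
  have -> : e / K = d1 `^ (2 - 2 * s).
    by rewrite /d1 -powRrM mulVf ?gt_eqF// powRr1// ltW// divr_gt0.
  by apply: ge0_ler_powR; rewrite ?nnegrE ltW.
have main eps : 0 < eps -> trunc_Ls s A g x delta <=
    c + e + eps * \int[mu]_(y in A `\` eball x (delta / 2)) fker s (x - y).
  move=> eps0; have [phi [phiA phic]] := Happ delta eps d0 (ltW dr) eps0.
  have [L [LE _ hL]] := approximant_Ls phiA sAd mg gM eps0.
  move: phic; rewrite LE lee_fin => Lc.
  have h0 : b * (moment (delta / 2) delta + pv_moment (delta / 2)) <= e.
    apply: le_trans small; apply: (@le_trans _ _ (`|b| * (2 * (cm * delta `^ (2 - 2 * s))))).
      apply: (@le_trans _ _ (`|b| * (moment (delta / 2) delta + pv_moment (delta / 2)))).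
        by rewrite ler_wpM2r ?ler_norm// addr_ge0 ?second_moment_ge0 ?pv_moment_ge0.
      rewrite ler_wpM2l//; lra.
    have := powR_ge0 delta (2 - 2 * s); rewrite /K; set X := delta `^ _ => X0.
    rewrite [leLHS](_ : _ = 2 * `|b| * cm * X); last by ring.
    by rewrite ler_wpM2r// lerDl.
  move: hL; set X1 := trunc_Ls _ _ _ _ _; set X2 := _ * Rintegral _ _ _; lra.
set I := \int[mu]_(y in A `\` eball x (delta / 2)) fker s (x - y) in main.
have I0 : 0 <= I by apply: Rint_ge0 => y _; exact: fker_ge0.
apply/ler_addgt0Pr => eps eps0.
have I10 : 0 < I + 1 by rewrite ltr_pwDr.
apply: (le_trans (main (eps / (I + 1)) _)); first by rewrite divr_gt0.
rewrite lerD2l -mulrA ler_piMr ?(ltW eps0)// mulrC ler_pdivrMr// mul1r lerDl//.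
Qed.

(** A partition of unity glues the paraboloid to locally constant upper bounds of
    [g], which are within [e] of [g] when its pieces are small. *)
Lemma partition_approximant x g a (b delta e rr : R) (l : seq V) (W0 : V -> R) (W : V -> V -> R)
    (G : V -> R) : 0 < delta -> 0 < e -> C2_on Om W0 -> (forall p, C2_on Om (W p)) ->
  {in l, forall p, closure Om p} ->
  (forall y, Om y -> [/\ 0 <= W0 y, forall p, 0 <= W p y,
        W0 y + \sum_(p <- l) W p y = 1, W0 y != 0 -> enorm (y - x) < delta &
        (forall p, W p y != 0 -> enorm (y - p) < rr) /\
        (enorm (y - x) < delta / 2 -> {in l, forall p, W p y = 0})]) ->
  (forall y, Om y -> g y <= quadratic x (g x) a b y) ->
  (forall y p, Om y -> closure Om p -> enorm (y - p) < rr -> g y <= G p <= g y + e) ->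
  approximant x g a b delta e
    (fun y => W0 y * quadratic x (g x) a b y + \sum_(p <- l) W p y * G p).
Proof.
move=> d0 e0 C0 CW lO HW gP HG.
have GE y : Om y -> \sum_(p <- l) W p y * G p <= (\sum_(p <- l) W p y) * (g y + e) /\
    (\sum_(p <- l) W p y) * g y <= \sum_(p <- l) W p y * G p.
  move=> Oy; have [_ Wp _ _ [Wr _]] := HW y Oy.
  rewrite !mulr_suml; split; rewrite big_seq [leRHS]big_seq; apply: ler_sum => p pl;
    (have [->|/Wr yp] := eqVneq (W p y) 0; first by rewrite !mul0r);
    by rewrite ler_wpM2l//; have /andP[] := HG y p Oy (lO p pl) yp.
split.
- move=> y Oy; have [c0 _] := C0; have [cq _] := quadratic_C2 x (g x) a b oOm.
  have cs : C2_on Om (fun y => \sum_(p <- l) W p y * G p).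
    by apply: (C2_sum _ oOm) => p; exact: (C2_mul oOm (CW p) (C2_cst Om (G p))).
  have [cs0 _] := cs.
  exact: (cvgD (cvgM (c0 y Oy) (cq y Oy)) (cs0 y Oy)).
- move=> y Oy yd; have [_ _ W1 _ [_ Wz]] := HW y Oy.
  have Wz' := Wz yd; move: W1; rewrite (@eq_big_seq _ _ _ _ l _ (fun=> 0) Wz') big1// addr0 => ->.
  rewrite mul1r (@eq_big_seq _ _ _ _ l _ (fun=> 0)) ?big1 ?addr0// => p pl.
  by rewrite Wz' // mul0r.
- move=> y Oy; have [W00 Wp W1 _ _] := HW y Oy; have [G1 G2] := GE y Oy.
  have S0 : 0 <= \sum_(p <- l) W p y by apply: sumr_ge0.
  have gPy := gP y Oy.
  have SE : \sum_(p <- l) W p y = 1 - W0 y by rewrite -W1 addrAC subrr add0r.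
  move: G1 G2; rewrite SE; set S := \sum_(p <- l) _; set P := quadratic _ _ _ _ _ => G1 G2.
  have h1 : W0 y * g y <= W0 y * P by rewrite ler_wpM2l.
  have h2 : (1 - W0 y) * g y <= (1 - W0 y) * P by rewrite ler_wpM2l// -SE.
  have h3 : 0 <= W0 y * e by rewrite mulr_ge0// ltW.
  by apply/andP; split; nra.
- move=> y Oy Nyd; have [W00 Wp W1 Wd _] := HW y Oy; have [G1 G2] := GE y Oy.
  have W0z : W0 y = 0 by apply/eqP/negPn/negP => /Wd yd; apply: Nyd.
  by move: W1 G1; rewrite W0z mul0r !add0r => -> ; rewrite mul1r.
Qed.

End test_functions.

(** * Viscosity inequalities in integrated form *)

Section modulus.
Context {R : realType} {n : nat}.
Local Notation V := 'rV[R]_n.+1.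

Lemma nbhs_pairP (t0 : R) (p0 : V) (A : set (R * V)) : nbhs (t0, p0) A ->
  exists2 r, 0 < r & forall t y, `|t - t0| < r -> enorm (y - p0) < r -> A (t, y).
Proof.
move=> [[A1 A2] /= [/nbhs_ballP[r1 /= r10 h1] /nbhs_eballP[r2 r20 h2]] hA].
exists (Num.min r1 r2) => [|t y]; first by rewrite lt_min r10.
rewrite !lt_min => /andP[tr _] /andP[_ yr]; apply: hA; split; last exact: h2.
by apply: h1; rewrite /ball/= distrC.
Qed.

Lemma continuous_modulus (G : R * V -> R) t0 p0 (e : R) : {for (t0, p0), continuous G} -> 0 < e ->
  exists2 r, 0 < r & forall t y, `|t - t0| < r -> enorm (y - p0) < r ->
    `|G (t, y) - G (t0, p0)| < e.
Proof.
move=> cG e0; move/cvgrPdist_lt: cG => /(_ _ e0) /nbhs_pairP[r r0 hr].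
by exists r => // t y tr yr; rewrite distrC; exact: hr.
Qed.

Lemma uniform_modulus (G : R * V -> R) (K : set V) t0 (e : R) : continuous G -> compact K -> 0 < e ->
  exists2 r, 0 < r & forall t p y, K p -> `|t - t0| < r -> enorm (y - p) < r ->
    `|G (t, y) - G (t0, p)| < e.
Proof.
move=> cG /compact_near_coveringP cK e0.
pose P (i : R * V) (p : V) := `|G (i.1, p + i.2) - G (t0, p)| < e.
have : \forall i \near nbhs (t0, 0 : V), K `<=` P i.
  apply: (cK _ (nbhs (t0, 0 : V)) P) => p0 _.
  have e20 : 0 < e / 2 by rewrite divr_gt0.
  have [r r0 hr] := continuous_modulus (cG (t0, p0)) e20.
  have r20 : 0 < r / 2 by rewrite divr_gt0.
  exists (eball p0 (r / 2), (fun i : R * V => `|i.1 - t0| < r /\ enorm i.2 < r / 2)).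
    split; first exact: nbhs_eball.
    exists ([set t : R | `|t - t0| < r], eball 0 (r / 2)).
      split; last exact: nbhs_eball.
      by apply/nbhs_ballP; exists r => // t; rewrite /ball/= distrC.
    by move=> [t h] [/= tr]; rewrite /eball/= subr0.
  move=> [p [t h]] [/=]; rewrite {1}/eball/= /P/= => pr [tr hr2].
  have h1 := hr t (p + h) tr; have h2 := hr t0 p; rewrite subrr normr0 in h2.
  have {}h1 : `|G (t, p + h) - G (t0, p0)| < e / 2.
    apply: h1; have -> : p + h - p0 = (p - p0) + h by rewrite addrAC.
    by rewrite (le_lt_trans (ler_enormD _ _))//; lra.
  have {}h2 : `|G (t0, p) - G (t0, p0)| < e / 2 by apply: h2 => //; lra.
  move: h1 h2; rewrite !ltr_norml => /andP[a1 a2] /andP[b1 b2].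
  by apply/andP; split; lra.
move=> /nbhs_pairP[r r0 hr]; exists r => // t p y Kp tr yr.
have := hr t (y - p) tr; rewrite subr0 => /(_ yr p Kp).
by rewrite /P/=; have -> : p + (y - p) = y by rewrite addrC subrK.
Qed.

Lemma uniform_modulus_space (g : V -> R) (K : set V) (e : R) : continuous g -> compact K -> 0 < e ->
  exists2 r, 0 < r & forall p y, K p -> enorm (y - p) < r -> `|g y - g p| < e.
Proof.
move=> cg cK e0; have cG : continuous (fun q : R * V => g q.2).
  by move=> [a b]; exact: (cvg_comp _ _ (@cvg_snd _ _ (nbhs a) (nbhs b) _) (cg b)).
have [r r0 hr] := uniform_modulus 0 cG cK e0; exists r => // p y Kp yr.
by apply: (hr 0 p y Kp) => //; rewrite subrr normr0.
Qed.

End modulus.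

Section viscosity_jets.
Context {R : realType} {n : nat}.
Local Notation V := 'rV[R]_n.+1.
Local Notation mu := (@lebesgue R n).
Local Notation mV := (caratheodory_type (@lebesgue_outer R n)).
Variable s : R.
Hypothesis s01 : 0 < s < 1.
Variables (Om Sigma : set V).
Hypotheses (oOm : open Om) (bOm : bounded_set Om) (oS : open Sigma)
  (symS : Sigma = [set - z | z in Sigma]).
Local Notation sector := (sector_at Om Sigma).

(** The viscosity inequality without its test functions: an upper bound for the
    upper limit of the truncated integrals of [g] itself. *)
Definition Ls_le (A : set V) (g : V -> R) (x : V) (c : R) : Prop :=
  forall e, 0 < e -> exists2 d0, 0 < d0 & forall delta, 0 < delta -> delta < d0 ->
    trunc_Ls s A g x delta <= c + e.

Lemma C2_partition_sum (l : seq V) (W : V -> V -> R) (G : V -> R) : (forall p, C2_on Om (W p)) ->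
  C2_on Om (fun y => \sum_(p <- l) W p y * G p).
Proof.
by move=> CW; apply: (C2_sum _ oOm) => p; exact: (C2_mul oOm (CW p) (C2_cst Om (G p))).
Qed.

Lemma exists_approximant (g : V -> R) x a (b delta e : R) : continuous g -> Om x -> 0 < delta -> 0 < e ->
  (forall y, Om y -> g y <= quadratic x (g x) a b y) ->
  exists2 phi, C2_on Om phi & approximant Om x g a b delta e phi.
Proof.
move=> cg Ox d0 e0 gP; have cK := compact_closure bOm.
have e20 : 0 < e / 2 by rewrite divr_gt0.
have [r r0 hr] := uniform_modulus_space cg cK e20.
have rr0 : 0 < Num.min r (delta / 2) by rewrite lt_min r0 divr_gt0.
have rrd : Num.min r (delta / 2) <= delta / 2 by rewrite ge_min lexx orbT.
have [l [W0 [W [C0 CW lO HW]]]] := smooth_partition x oOm cK d0 rr0 rrd.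
exists (fun y => W0 y * quadratic x (g x) a b y + \sum_(p <- l) W p y * (g p + e / 2)).
  apply: (C2_add oOm); last exact: (C2_partition_sum l (fun p => g p + e / 2) CW).
  exact: (C2_mul oOm C0 (quadratic_C2 x (g x) a b oOm)).
apply: (partition_approximant oOm (G := fun p => g p + e / 2) d0 e0 C0 CW lO HW gP).
move=> y p Oy Kp; rewrite lt_min => /andP[yr _].
have := hr p y Kp yr; rewrite ltr_norml => /andP[h1 h2]; apply/andP; split; lra.
Qed.

(** A function touched from above by a paraboloid satisfies the inequality with
    its own values in the integral: this replaces test functions everywhere below. *)
Lemma elliptic_sub_jet A h lam f u g x a (b r M : R) :
  elliptic_subsolution s Om A h lam f u -> continuous g -> {in Om, u =1 g} ->
  (forall y, Om y -> `|g y| <= M) -> sector (A x) x r ->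
  (forall y, Om y -> g y <= quadratic x (g x) a b y) ->
  Ls_le (A x) g x (lam * g x + f x - h x * g x).
Proof.
move=> [_ usub] cg ug gM sA gP; have [mA AO Ox r0 _] := sA.
have mg := continuous_lebesgue_measurable cg.
apply: (jet_limit s01 oOm bOm oS symS sA mg gM) => delta e d0 dr e0.
have [phi C2phi phiA] := exists_approximant cg Ox d0 e0 gP.
exists phi; split; first exact: phiA.
have [L [LE _ _]] := approximant_Ls s01 oOm bOm oS symS phiA (sector_at_le d0 dr sA) mg gM e0.
have phix := approximant_center phiA Ox d0.
have ux : u x = phi x by rewrite phix ug ?inE.
have := usub x phi Ox C2phi ux; rewrite LE -EFinD phix lee_fin => H.
have {}H : h x * g x + L <= lam * g x + f x.
  apply: H => y Oy; rewrite ug ?inE//; have [_ _ gphi _] := phiA.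
  by have /andP[] := gphi y Oy.
by rewrite lee_fin; lra.
Qed.

Lemma elliptic_super_jet A h lam f u g x a (b r M : R) :
  elliptic_supersolution s Om A h lam f u -> continuous g -> {in Om, u =1 g} ->
  (forall y, Om y -> `|g y| <= M) -> sector (A x) x r ->
  (forall y, Om y -> - g y <= quadratic x (- g x) a b y) ->
  Ls_le (A x) (fun y => - g y) x (h x * g x - lam * g x - f x).
Proof.
move=> [_ usup] cg ug gM sA gP; have [mA AO Ox r0 _] := sA.
have cg' : continuous (fun y => - g y) by move=> y; exact: (cvgN (cg y)).
have mg := continuous_lebesgue_measurable cg'.
have gM' y : Om y -> `|- g y| <= M by move=> Oy; rewrite normrN; exact: gM.
apply: (jet_limit s01 oOm bOm oS symS sA mg gM') => delta e d0 dr e0.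
have [phi C2phi phiA] := exists_approximant cg' Ox d0 e0 gP.
exists phi; split; first exact: phiA.
have [L [LE LN _]] := approximant_Ls s01 oOm bOm oS symS phiA (sector_at_le d0 dr sA) mg gM' e0.
have phix := approximant_center phiA Ox d0.
have ux : u x = - phi x by rewrite phix opprK ug ?inE.
have := usup x (fun y => - phi y) Ox (C2_opp oOm C2phi) ux; rewrite LN LE -EFinD phix opprK lee_fin => H.
have {}H : lam * g x + f x <= h x * g x - L.
  apply: H => y Oy; rewrite ug ?inE// lerNl; have [_ _ gphi _] := phiA.
  by have /andP[] := gphi y Oy.
by rewrite lee_fin; lra.
Qed.

Lemma cylinder_in t y : 0 < t -> Om y -> cylinder Om (t, y).
Proof. by move=> t0 Oy; split => //=; rewrite in_itv/= t0. Qed.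

Lemma open_cylinder : open (cylinder Om).
Proof.
rewrite openE => -[t x] [/= t0 Ox]; exists (`]0, +oo[%classic, Om) => //.
split; apply: open_nbhs_nbhs; split => //; exact: interval_open.
Qed.

(** The time-dependent version: in time, a steep parabola dominates the
    oscillation of a bounded function. *)
Lemma parabolic_approximant (U : R * V -> R) (phi : R * V -> R) t0 x a (b delta e M : R) :
  continuous U -> (forall q, cylinder Om q -> `|U q| <= M) -> cylinder Om (t0, x) ->
  0 < delta -> 0 < e -> C2_on (cylinder Om) phi ->
  (forall q, cylinder Om q -> U q <= phi q) ->
  (forall y, Om y -> phi (t0, y) = quadratic x (U (t0, x)) a b y) ->
  exists Phi : R * V -> R, [/\ C2_on (cylinder Om) Phi,
    forall q, cylinder Om q -> U q <= Phi q, forall t, Phi (t, x) = phi (t, x) &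
    approximant Om x (fun y => U (t0, y)) a b delta e (fun y => Phi (t0, y))].
Proof.
move=> cU UM ct0 d0 e0 C2phi Uphi phiq; have [t00 Ox] := ct0.
have oC := open_cylinder; have cK := compact_closure bOm.
have e20 : 0 < e / 2 by rewrite divr_gt0.
have [r r0 hr] := uniform_modulus t0 cU cK e20.
have rr0 : 0 < Num.min r (delta / 2) by rewrite lt_min r0 divr_gt0.
have rrd : Num.min r (delta / 2) <= delta / 2 by rewrite ge_min lexx orbT.
have [l [W0 [W [C0 CW lO HW]]]] := smooth_partition x oOm cK d0 rr0 rrd.
have M0 : 0 <= M by apply: le_trans (UM _ ct0).
(* so steep that the parabola exceeds the oscillation [2 M] once [|t - t0| >= r] *)
pose N := 2 * M / r ^+ 2.
have N0 : 0 <= N by apply: divr_ge0; [exact: mulr_ge0|exact: sqr_ge0].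
pose G t p := U (t0, p) + e / 2 + N * (t - t0) ^+ 2.
pose Phi (q : R * V) := W0 q.2 * phi q + \sum_(p <- l) W p q.2 * G q.1 p.
have UMc p : closure Om p -> `|U (t0, p)| <= M.
  move=> cp; apply/ler_addgt0Pr => e1 e10.
  have [r1 r10 hr1] := continuous_modulus (cU (t0, p)) e10.
  have [y [Oy py]] := cp _ (nbhs_eball p r10).
  have := hr1 t0 y; rewrite subrr normr0 => /(_ r10 py).
  have := UM (t0, y) (conj t00 Oy); rewrite ltr_norml !ler_norml.
  by move=> /andP[h1 h2] /andP[h3 h4]; apply/andP; split; lra.
have GU t y p : 0 < t -> Om y -> closure Om p -> enorm (y - p) < Num.min r (delta / 2) ->
    U (t, y) <= G t p.
  rewrite lt_min => t1 Oy Kp /andP[yr _]; rewrite /G.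
  have sq : 0 <= (t - t0) ^+ 2 by rewrite sqr_ge0.
  have [tr|rt] := ltP `|t - t0| r.
    have := hr t p y Kp tr yr; rewrite ltr_norml => /andP[h1 h2].
    have := mulr_ge0 N0 sq; lra.
  have : 2 * M <= N * (t - t0) ^+ 2.
    rewrite /N mulrAC ler_pdivlMr ?exprn_gt0// ler_wpM2l ?mulr_ge0//.
    by rewrite -[leRHS]real_normK ?num_real// ler_pXn2r// nnegrE ltW.
  have := UM (t, y) (cylinder_in t1 Oy); have := UMc p Kp; rewrite !ler_norml.
  by move=> /andP[h1 h2] /andP[h3 h4]; lra.
exists Phi; split.
- apply: (C2_add oC); first exact: (C2_mul oC (C2_snd C0) C2phi).
  apply: (C2_sum _ oC) => p; apply: (C2_mul oC (C2_snd (CW p))).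
  have Ct : C2_on (cylinder Om) (fun q => q.1 - t0).
    exact: (C2_add oC (C2_fst _) (C2_cst _ (- t0))).
  exact: (C2_add oC (C2_cst _ (U (t0, p) + e / 2)) (C2_mul oC (C2_cst _ N) (C2_mul oC Ct Ct))).
- move=> [t y] [/= tpos Oy]; have [W00 Wp W1 _ [Wr _]] := HW y Oy.
  have t1 : 0 < t by move: tpos; rewrite in_itv/= andbT.
  have h1 : W0 y * U (t, y) <= W0 y * phi (t, y) by rewrite ler_wpM2l// Uphi.
  have h2 : \sum_(p <- l) W p y * U (t, y) <= \sum_(p <- l) W p y * G t p.
    rewrite big_seq [leRHS]big_seq; apply: ler_sum => p pl.
    have [->|/Wr yp] := eqVneq (W p y) 0; first by rewrite !mul0r.
    by rewrite ler_wpM2l// GU//; exact: lO.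
  rewrite /Phi/= -[leLHS]mul1r -W1 mulrDl mulr_suml; exact: lerD.
- move=> t; have [W00 Wp W1 _ [_ Wz]] := HW x Ox.
  have Wx : {in l, forall p, W p x = 0}.
    by apply: Wz; rewrite subrr enorm0 divr_gt0.
  rewrite /Phi/= [X in _ + X](@eq_big_seq _ _ _ _ l _ (fun=> 0)) ?big1 ?addr0; last 2 first.
  - by move=> p _.
  - by move=> p pl; rewrite Wx// mul0r.
  by move: W1; rewrite (@eq_big_seq _ _ _ _ l _ (fun=> 0) Wx) big1// addr0 => ->; rewrite mul1r.
- have Pq : approximant Om x (fun y => U (t0, y)) a b delta e
      (fun y => W0 y * quadratic x (U (t0, x)) a b y + \sum_(p <- l) W p y * (U (t0, p) + e / 2)).
    apply: (partition_approximant oOm (G := fun p => U (t0, p) + e / 2) d0 e0 C0 CW lO HW).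
      by move=> y Oy; rewrite -phiq//; exact: Uphi.
    move=> y p Oy Kp; rewrite lt_min => /andP[yr _].
    have := hr t0 p y Kp; rewrite subrr normr0 => /(_ r0 yr).
    rewrite ltr_norml => /andP[h1 h2]; apply/andP; split; lra.
  have PE y : Om y -> Phi (t0, y) = W0 y * quadratic x (U (t0, x)) a b y +
      \sum_(p <- l) W p y * (U (t0, p) + e / 2).
    move=> Oy; rewrite /Phi/= phiq//; congr (_ + _); apply: eq_bigr => p _.
    by rewrite /G subrr expr0n mulr0 addr0.
  have [c1 c2 c3 c4] := Pq; split.
  + move=> y Oy; apply: (eq_on_continuous oOm _ Oy (c1 y Oy)) => z.
    by rewrite inE => Oz; rewrite PE.
  + by move=> y Oy yd; rewrite PE//; exact: c2.
  + by move=> y Oy; rewrite PE//; exact: c3.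
  + by move=> y Oy yd; rewrite PE//; exact: c4.
Qed.

Lemma slice_continuous (U : R * V -> R) t0 : continuous U -> continuous (fun y => U (t0, y)).
Proof.
move=> cU y; have Fy : Filter (nbhs y) by exact: nbhs_filter.
apply/cvgrPdist_lt => e e0.
have [r r0 hr] := continuous_modulus (cU (t0, y)) e0.
apply: filterS (nbhs_eball y r0) => z yz; rewrite distrC; apply: hr => //.
by rewrite subrr normr0.
Qed.

Lemma parabolic_sub_jet At ht ft u (U phi : R * V -> R) t0 x a (b r M : R) :
  parabolic_subsolution s Om At ht ft u -> continuous U -> {in cylinder Om, u =1 U} ->
  (forall q, cylinder Om q -> `|U q| <= M) -> cylinder Om (t0, x) ->
  sector (At (t0, x)) x r -> C2_on (cylinder Om) phi ->
  (forall q, cylinder Om q -> U q <= phi q) ->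
  (forall y, Om y -> phi (t0, y) = quadratic x (U (t0, x)) a b y) ->
  Ls_le (At (t0, x)) (fun y => U (t0, y)) x
    (ft (t0, x) - derive1 (fun t => phi (t, x)) t0 - ht (t0, x) * U (t0, x)).
Proof.
move=> [_ usub] cU uU UM c0 sA C2phi Uphi phiq; have [mA AO Ox r0 _] := sA.
have cg := slice_continuous (t0 := t0) cU; have mg := continuous_lebesgue_measurable cg.
have [t00 _] := c0.
have gM y : Om y -> `|U (t0, y)| <= M by move=> Oy; apply: UM.
apply: (jet_limit s01 oOm bOm oS symS sA mg gM) => delta e d0 dr e0.
have [Phi [C2P UP Px PA]] := parabolic_approximant cU UM c0 d0 e0 C2phi Uphi phiq.
exists (fun y => Phi (t0, y)); split; first exact: PA.
have [L [LE _ _]] := approximant_Ls s01 oOm bOm oS symS PA (sector_at_le d0 dr sA) mg gM e0.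
have phix := approximant_center PA Ox d0.
have ux : u (t0, x) = Phi (t0, x) by rewrite phix uU ?inE.
have := usub t0 x Phi c0 C2P ux; rewrite LE -EFinD phix lee_fin.
have -> : (fun t => Phi (t, x)) = (fun t => phi (t, x)) by apply/funext.
move=> H; rewrite lee_fin.
suff : derive1 (fun t => phi (t, x)) t0 + ht (t0, x) * U (t0, x) + L <= ft (t0, x) by lra.
by apply: H => q cq; rewrite uU ?inE//; exact: UP.
Qed.

Lemma parabolic_super_jet At ht ft u (U phi : R * V -> R) t0 x a (b r M : R) :
  parabolic_supersolution s Om At ht ft u -> continuous U -> {in cylinder Om, u =1 U} ->
  (forall q, cylinder Om q -> `|U q| <= M) -> cylinder Om (t0, x) ->
  sector (At (t0, x)) x r -> C2_on (cylinder Om) phi ->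
  (forall q, cylinder Om q -> - U q <= phi q) ->
  (forall y, Om y -> phi (t0, y) = quadratic x (- U (t0, x)) a b y) ->
  Ls_le (At (t0, x)) (fun y => - U (t0, y)) x
    (derive1 (fun t => - phi (t, x)) t0 + ht (t0, x) * U (t0, x) - ft (t0, x)).
Proof.
move=> [_ usup] cU uU UM c0 sA C2phi Uphi phiq; have [mA AO Ox r0 _] := sA.
have cU' : continuous (fun q => - U q) by move=> q; exact: (cvgN (cU q)).
have UM' q : cylinder Om q -> `|- U q| <= M by move=> cq; rewrite normrN; exact: UM.
have cg := slice_continuous (t0 := t0) cU'; have mg := continuous_lebesgue_measurable cg.
have [t00 _] := c0.
have gM y : Om y -> `|- U (t0, y)| <= M by move=> Oy; apply: UM'.
apply: (jet_limit s01 oOm bOm oS symS sA mg gM) => delta e d0 dr e0.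
have [Phi [C2P UP Px PA]] := parabolic_approximant cU' UM' c0 d0 e0 C2phi Uphi phiq.
exists (fun y => Phi (t0, y)); split; first exact: PA.
have [L [LE LN _]] := approximant_Ls s01 oOm bOm oS symS PA (sector_at_le d0 dr sA) mg gM e0.
have phix := approximant_center PA Ox d0.
have ux : u (t0, x) = - Phi (t0, x) by rewrite phix opprK uU ?inE.
have := usup t0 x (fun q => - Phi q) c0 (C2_opp open_cylinder C2P) ux.
rewrite LN LE -EFinD phix opprK lee_fin.
have -> : (fun t => - Phi (t, x)) = (fun t => - phi (t, x)) by apply/funext => t; rewrite Px.
move=> H; rewrite lee_fin.
suff : ft (t0, x) <= derive1 (fun t => - phi (t, x)) t0 + ht (t0, x) * U (t0, x) - L by lra.
by apply: H => q cq; rewrite uU ?inE// lerNl; exact: UP.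
Qed.

End viscosity_jets.

(** * Powers of the distance *)

Section power_inequalities.
Context {R : realType}.
Implicit Types (a b t X : R).

Lemma powR_bernoulli X (th : R) : 0 <= X -> 0 < th -> th <= 1 -> X `^ th <= 1 + th * (X - 1).
Proof.
move=> X0 th0; rewrite le_eqVlt => /predU1P[->|th1]; first by rewrite powRr1//; lra.
have q0 : 0 < (1 - th)^-1 by rewrite invr_gt0 subr_gt0.
have p0 : 0 < th^-1 by rewrite invr_gt0.
have pq : th^-1^-1 + (1 - th)^-1^-1 = 1 by rewrite !invrK addrC subrK.
have := conjugate_powR (powR_ge0 X th) ler01 p0 q0 pq.
by rewrite -powRrM mulfV ?gt_eqF// powRr1// powR1 !invrK; lra.
Qed.

Lemma powR_subadd a b (th : R) : 0 <= a -> 0 <= b -> 0 < th -> th <= 1 ->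
  (a + b) `^ th <= a `^ th + b `^ th.
Proof.
move=> a0 b0 th0 th1; have [ab|] := ltP 0 (a + b); last first.
  move=> ab; have -> : a + b = 0 by apply/le_anti; rewrite ab addr_ge0.
  by rewrite powR0 ?gt_eqF// addr_ge0 ?powR_ge0.
have key c : 0 <= c -> c <= a + b -> (c / (a + b)) * (a + b) `^ th <= c `^ th.
  move=> c0 cab; have [->|cn0] := eqVneq c 0; first by rewrite !mul0r powR_ge0.
  have cp : 0 < c by rewrite lt_neqAle eq_sym cn0.
  have w1 : 0 < c / (a + b) <= 1.
    by apply/andP; split; [rewrite divr_gt0|rewrite ler_pdivrMr// mul1r].
  have := ger1_powR w1 th1; set w := c / (a + b) => wth.
  have -> : c `^ th = w `^ th * (a + b) `^ th.
    rewrite -powRM ?ltW//; last by case/andP: w1.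
    by rewrite /w divfK// gt_eqF.
  by rewrite ler_wpM2r// powR_ge0.
have ka : (a / (a + b)) * (a + b) `^ th <= a `^ th by apply: key => //; lra.
have kb : (b / (a + b)) * (a + b) `^ th <= b `^ th by apply: key => //; lra.
have -> : (a + b) `^ th = (a / (a + b)) * (a + b) `^ th + (b / (a + b)) * (a + b) `^ th.
  by rewrite -mulrDl -mulrDl divff ?mul1r// gt_eqF.
exact: lerD.
Qed.

Lemma powR_dist a b (th : R) : 0 <= a -> 0 <= b -> 0 < th -> th <= 1 ->
  `|a `^ th - b `^ th| <= `|a - b| `^ th.
Proof.
move=> a0 b0 th0 th1; wlog ab : a b a0 b0 / b <= a.
  move=> H; have [/H|/ltW/H] := leP b a; first exact.
  by rewrite distrC (distrC a); exact.
rewrite (ger0_norm (_ : 0 <= a - b)) ?subr_ge0// ger0_norm; last first.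
  by rewrite subr_ge0; apply: ge0_ler_powR => //; rewrite ltW.
rewrite lerBlDr; have := @powR_subadd (a - b) b th; rewrite subrK; apply => //.
by rewrite subr_ge0.
Qed.

End power_inequalities.

Section barrier.
Context {R : realType} {n : nat}.
Local Notation V := 'rV[R]_n.+1.
Variables (Om : set V).
Hypotheses (Om0 : Om !=set0) (oOm : open Om) (bOm : bounded_set Om).
Implicit Types (x y p : V).
Local Notation d := (bdist Om).

Lemma bdist_pow_continuous (eta : R) : 0 < eta -> eta <= 1 -> continuous (fun y => d y `^ eta).
Proof.
move=> eta0 eta1 x; have Fx : Filter (nbhs x) by exact: nbhs_filter.
apply/cvgrPdist_lt => e e0; have r0 : 0 < e `^ eta^-1 by rewrite powR_gt0.
have /cvgrPdist_lt /(_ _ r0) := @bdist_continuous _ _ Om Om0 oOm bOm x.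
apply: filterS => y xy.
apply: (le_lt_trans (powR_dist (bdist_ge0 Om0 oOm bOm x) (bdist_ge0 Om0 oOm bOm y) eta0 eta1)).
have -> : e = (e `^ eta^-1) `^ eta by rewrite -powRrM mulVf ?gt_eqF// powRr1// ltW.
by apply: gt0_ltr_powR => //; rewrite nnegrE ?powR_ge0.
Qed.

(** The power of the distance is touched from above by a paraboloid: it lies
    below the power of the distance to a nearest boundary point, which is a
    concave function of the squared distance. *)
Lemma bdist_pow_quadratic (eta : R) x p : 0 < eta -> eta <= 1 -> Om x ->
  frontier Om p -> enorm (x - p) = d x -> forall y,
  d y `^ eta <= quadratic x (d x `^ eta) ((eta * d x `^ (eta - 2)) *: (x - p))
                  (eta / 2 * d x `^ (eta - 2)) y.
Proof.
move=> eta0 eta1 Ox fp xp y; have dx0 := bdist_gt0 Om0 oOm bOm Ox.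
have dyp : d y `^ eta <= enorm (y - p) `^ eta.
  apply: ge0_ler_powR; rewrite ?nnegrE ?enorm_ge0 ?(ltW eta0)//.
    exact: bdist_ge0.
  exact: bdist_lb.
have e20 : 0 < eta / 2 by lra.
have e21 : eta / 2 <= 1 by lra.
apply: (le_trans dyp); pose T := (enorm (y - p) / d x) ^+ 2.
have T0 : 0 <= T by rewrite sqr_ge0.
have eT : enorm (y - p) `^ eta = d x `^ eta * T `^ (eta / 2).
  rewrite /T -powR_mulrn ?divr_ge0 ?enorm_ge0 ?(ltW dx0)// -powRrM.
  rewrite (_ : 2%:R * (eta / 2) = eta); last by field.
  by rewrite -powRM ?(ltW dx0) ?divr_ge0 ?enorm_ge0 ?(ltW dx0)// mulrC divfK ?gt_eqF.
have hT := powR_bernoulli T0 e20 e21.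
rewrite eT; apply: (@le_trans _ _ (d x `^ eta * (1 + eta / 2 * (T - 1)))).
  by rewrite ler_wpM2l ?powR_ge0.
have dE : d x `^ eta = d x `^ (eta - 2) * d x ^+ 2.
  rewrite -powR_mulrn ?(ltW dx0)// -powRD; last by rewrite (gt_eqF dx0) implybT.
  by congr (_ `^ _); ring.
have yE : enorm (y - p) ^+ 2 = d x ^+ 2 + 2 * dotv (x - p) (y - x) + enorm (y - x) ^+ 2.
  have -> : y - p = (x - p) + (y - x) by rewrite [RHS]addrC addrA subrK.
  by rewrite enorm_sqrD xp.
have TE : d x ^+ 2 * T = d x ^+ 2 + 2 * dotv (x - p) (y - x) + enorm (y - x) ^+ 2.
  by rewrite -yE /T exprMn exprVn mulrCA mulfV ?mulr1// expf_neq0// gt_eqF.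
rewrite /quadratic dotvZl {1}dE le_eqVlt; apply/orP; left; apply/eqP.
have -> : d x `^ (eta - 2) * d x ^+ 2 * (1 + eta / 2 * (T - 1)) =
  d x `^ (eta - 2) * d x ^+ 2 + eta / 2 * d x `^ (eta - 2) * (d x ^+ 2 * T - d x ^+ 2) by ring.
by rewrite TE dE; field.
Qed.

(** The factor [eta] makes the far part of the operator small on the barrier; it
    comes from Bernoulli's inequality with exponent [eta / s]. *)
Lemma bdist_pow_growth (eta s : R) x y : 0 < eta -> eta <= s -> s <= 1 -> Om x ->
  d y `^ eta <= d x `^ eta + eta / s * d x `^ (eta - s) * enorm (x - y) `^ s.
Proof.
move=> eta0 etas s1 Ox; have s0 : 0 < s by exact: lt_le_trans eta0 etas.
have dx0 := bdist_gt0 Om0 oOm bOm Ox; pose t := enorm (x - y) / d x.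
have t0 : 0 <= t by rewrite divr_ge0 ?enorm_ge0 ?ltW.
have dy : d y <= d x * (1 + t).
  rewrite mulrDr mulr1 /t mulrCA mulfV ?gt_eqF// mulr1 enorm_sub.
  exact: (bdist_lipschitz Om0 oOm bOm y x).
have h1 : d y `^ eta <= (d x * (1 + t)) `^ eta.
  by apply: ge0_ler_powR; rewrite ?nnegrE ?(ltW eta0) ?(bdist_ge0 Om0 oOm bOm)// mulr_ge0 ?ltW// ltr_pwDl.
apply: (le_trans h1); rewrite powRM ?(ltW dx0)//; last by rewrite addr_ge0.
have h2 : (1 + t) `^ eta <= 1 + eta / s * t `^ s.
  have -> : (1 + t) `^ eta = ((1 + t) `^ s) `^ (eta / s).
    by rewrite -powRrM mulrCA mulfV ?gt_eqF// mulr1.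
  apply: (le_trans (powR_bernoulli (powR_ge0 _ _) (divr_gt0 eta0 s0) _)).
    by rewrite ler_pdivrMr// mul1r.
  rewrite lerD2l ler_wpM2l ?divr_ge0 ?(ltW eta0) ?(ltW s0)//.
  rewrite lerBlDl; have := powR_subadd ler01 t0 s0 s1; rewrite powR1; exact.
apply: (@le_trans _ _ (d x `^ eta * (1 + eta / s * t `^ s))).
  by rewrite ler_wpM2l ?powR_ge0.
rewrite mulrDr mulr1 lerD2l le_eqVlt; apply/orP; left; apply/eqP.
rewrite /t powRM ?enorm_ge0 ?invr_ge0 ?(ltW dx0)//.
rewrite powRB; last by rewrite (gt_eqF dx0) implybT.
have -> : (d x)^-1 `^ s = (d x `^ s)^-1.
  by rewrite -powR_inv1 ?(ltW dx0)// -powRrM mulN1r powRN.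
ring.
Qed.

End barrier.

(** * Near and far parts of the operator *)

Lemma drop_ge_subr (R : realDomainType) (a b q t : R) : b <= a - t + q -> t - q <= a - b.
Proof. by move=> h; lra. Qed.

Lemma drop_ge_opp (R : realDomainType) (a b q : R) : b <= a + q -> - q <= a - b.
Proof. by move=> h; lra. Qed.

Section near_and_far.
Context {R : realType} {n : nat}.
Local Notation V := 'rV[R]_n.+1.
Local Notation mu := (@lebesgue R n).
Local Notation mV := (caratheodory_type (@lebesgue_outer R n)).
Variable s : R.
Hypothesis s01 : 0 < s < 1.
Variables (Om Sigma : set V).
Hypotheses (Om0 : Om !=set0) (oOm : open Om) (bOm : bounded_set Om) (oS : open Sigma)
  (symS : Sigma = [set - z | z in Sigma]).
Local Notation sector := (sector_at Om Sigma).
Local Notation moment := (second_moment s Sigma).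
Local Notation d := (bdist Om).
Implicit Types (A D : set V) (f g : V -> R) (x y z : V) (r M : R).
Local Notation p := (n.+1%:R + 2 * s).

Let p0 : 0 < p.
Proof. by case/andP: s01 => s0 _; rewrite ltr_wpDl// mulr_gt0. Qed.

(** The kernel truncated at height [r ^ (- N - 2 s)]: bounded and continuous,
    it equals the original kernel outside the ball of radius [r], so that the
    remainder is nonnegative and lives on the ball, where all the sectors
    coincide. *)
Definition far_height r : R := (r `^ p)^-1.
Definition far_kernel r z : R := (Num.max r (enorm z) `^ p)^-1.

Lemma far_height_gt0 r : 0 < r -> 0 < far_height r.
Proof. by move=> r0; rewrite invr_gt0 powR_gt0. Qed.

Lemma far_kernel_in r z : enorm z <= r -> far_kernel r z = far_height r.
Proof. by move=> zr; rewrite /far_kernel (max_idPl zr). Qed.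

Lemma far_kernel_out r z : r <= enorm z -> far_kernel r z = fker s z.
Proof. by move=> rz; rewrite /far_kernel (max_idPr rz). Qed.

Lemma far_kernel_ge0 r z : 0 <= far_kernel r z.
Proof. by rewrite invr_ge0 powR_ge0. Qed.

Lemma far_kernel_le r z : 0 < r -> far_kernel r z <= far_height r.
Proof.
move=> r0; rewrite lef_pV2 ?posrE ?powR_gt0// ?lt_max ?r0//.
by apply: ge0_ler_powR; rewrite ?nnegrE ?le_max ?lexx ?(ltW r0)// ltW.
Qed.

Lemma far_height_le_fker r z : 0 < enorm z -> enorm z <= r -> far_height r <= fker s z.
Proof.
move=> z0 zr; rewrite lef_pV2 ?posrE ?powR_gt0//; last exact: lt_le_trans zr.
by apply: ge0_ler_powR; rewrite ?nnegrE ?enorm_ge0 ?(le_trans (enorm_ge0 z) zr)// ltW.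
Qed.

Lemma powR_pos_continuous (q t : R) : 0 < t -> {for t, continuous (fun t : R => t `^ q)}.
Proof.
move=> t0; apply/differentiable_continuous/derivable1_diffP.
by apply: derivable_powR; rewrite in_itv/= t0.
Qed.

Lemma far_kernel_continuous r : 0 < r -> continuous (far_kernel r).
Proof.
move=> r0 z; have m0 : 0 < Num.max r (enorm z) by rewrite lt_max r0.
have cm : {for z, continuous (fun z : V => Num.max r (enorm z))}.
  apply: (@continuous_max _ _ (cst r) (@enorm R n) z); first exact: cst_continuous.
  exact: enorm_continuous.
have cp := @continuous_comp _ _ _ (fun z : V => Num.max r (enorm z)) (fun t : R => t `^ p) z cm
  (powR_pos_continuous (q := p) m0).
apply: (cvgV _ cp); by rewrite gt_eqF// powR_gt0.
Qed.

Lemma far_kernel_measurable r x D : 0 < r ->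
  measurable_fun (D : set mV) (fun y : mV => far_kernel r (x - (y : V))).
Proof.
move=> r0; apply: (@measurable_funTS _ _ mV); apply: continuous_lebesgue_measurable => y.
apply: (@continuous_comp _ _ _ (fun y : V => x - y) (far_kernel r)); last exact: far_kernel_continuous.
by have := @continuousB _ _ _ (cst x) id y; apply => //; exact: cst_continuous.
Qed.

(** The splitting of the operator into a bounded integral over the whole set and a
    singular one near the pole, where the set is [Sigma] for every point. *)
Definition far A g x r : R := \int[mu]_(y in A) ((g x - g y) * far_kernel r (x - y)).

Definition near g x r (delta : R) : R :=
  \int[mu]_(z in shell Sigma 0 delta r) ((g x - g (x - z)) * (fker s z - far_height r)).

Lemma far_kernel_summable D x r f M : lebesgue_measurable D -> D `<=` Om -> 0 < r ->
  measurable_fun (D : set mV) (f : mV -> R) -> (forall y, D y -> `|f y| <= M) ->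
  summable_on D (fun y => f y * far_kernel r (x - y)).
Proof.
move=> mD DO r0 mf fM; apply: (@bounded_summable _ _ _ _ (M * far_height r) mD).
- exact: (bounded_fin bOm).
- by apply: measurable_funM; [exact: mf|exact: far_kernel_measurable].
- move=> y Dy; rewrite normrM (ger0_norm (far_kernel_ge0 _ _)).
  by apply: ler_pM => //; [exact: far_kernel_ge0|exact: fM|exact: far_kernel_le].
Qed.

Lemma far_summable D g x r M : lebesgue_measurable D -> D `<=` Om -> Om x -> 0 < r ->
  measurable_fun (setT : set mV) (g : mV -> R) -> (forall y, Om y -> `|g y| <= M) ->
  summable_on D (fun y => (g x - g y) * far_kernel r (x - y)).
Proof.
move=> mD DO Ox r0 mg gM; apply: (@far_kernel_summable D x r (fun y => g x - g y) (M + M) mD DO r0).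
  by apply: measurable_funB; [exact: measurable_cst|apply: (@measurable_funTS _ _ mV); exact: mg].
by move=> y /DO Oy; rewrite (le_trans (ler_normB _ _))// lerD//; exact: gM.
Qed.

Lemma shell_gt0 (delta r : R) z : 0 < delta -> shell Sigma 0 delta r z -> 0 < enorm z < r.
Proof.
move=> d0 [[_ zr] /negP]; move: zr; rewrite /eball/= -leNgt !subr0 => -> dz.
by rewrite (lt_le_trans d0 dz).
Qed.

Lemma near_kernel_ge0 (delta r : R) z : 0 < delta -> shell Sigma 0 delta r z ->
  0 <= fker s z - far_height r.
Proof.
by move=> d0 /(shell_gt0 d0)/andP[z0 zr]; rewrite subr_ge0 far_height_le_fker// ltW.
Qed.

Lemma near_summable f (delta r M : R) : 0 < delta -> 0 < r ->
  measurable_fun (setT : set mV) (f : mV -> R) ->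
  (forall z, shell Sigma 0 delta r z -> `|f z| <= M) ->
  summable_on (shell Sigma 0 delta r) (fun z => f z * (fker s z - far_height r)).
Proof.
move=> d0 r0 mf fM; have mD := @shell_measurable _ _ Sigma 0 delta r (measurable_Sigma oS).
have s1 := shellS_summable s01 oS d0 mf fM.
have s2 : summable_on (shell Sigma 0 delta r) f.
  apply: (bounded_summable mD _ _ fM).
    by apply: (@ball_fin _ _ _ r) => z [] [].
  by apply: (@measurable_funTS _ _ mV); exact: mf.
have := summableB mD s1 (summableZ (far_height r) mD s2).
by apply: eq_integrable => // z _ /=; rewrite mulrBr; congr (_ - _)%:E; rewrite mulrC.
Qed.

Lemma sector_sub A x r z (delta : R) : sector A x r -> shell Sigma 0 delta r z -> Om (x - z).
Proof.
move=> sA Dz; have [_ AO _ _ _] := sA; apply: AO.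
by move: Dz; rewrite -(shell_reflect delta sA) => -[[]].
Qed.

Lemma reflect_measurable g x : measurable_fun (setT : set mV) (g : mV -> R) ->
  measurable_fun (setT : set mV) (fun z : mV => g (x - (z : V))).
Proof.
move=> mg; have mT : measurable_fun (setT : set mV) (fun z : mV => (x - (z : V) : mV)).
  by move=> _ B mB; rewrite setTI; exact: lebesgue_measurable_reflect.
exact: (measurableT_comp mg mT).
Qed.

Lemma near_diff_summable A g x r (delta M : R) : sector A x r -> 0 < delta ->
  measurable_fun (setT : set mV) (g : mV -> R) -> (forall y, Om y -> `|g y| <= M) ->
  summable_on (shell Sigma 0 delta r) (fun z => (g x - g (x - z)) * (fker s z - far_height r)).
Proof.
move=> sA d0 mg gM; have [_ _ Ox r0 _] := sA.
apply: (@near_summable (fun z => g x - g (x - z)) delta r (M + M) d0 r0).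
  by apply: measurable_funB; [exact: measurable_cst|exact: reflect_measurable mg].
move=> z /(sector_sub sA) Oz; rewrite (le_trans (ler_normB _ _))// lerD//; exact: gM.
Qed.

Lemma trunc_near_far A g x r (delta M : R) : sector A x r ->
  measurable_fun (setT : set mV) (g : mV -> R) -> (forall y, Om y -> `|g y| <= M) ->
  0 < delta -> delta <= r ->
  far A g x r + near g x r delta - 2 * M * far_height r * (2 * delta) ^+ n.+1 <=
    trunc_Ls s A g x delta.
Proof.
move=> sA mg gM d0 dr; have [mA AO Ox r0 _] := sA.
have M0 : 0 <= M by apply: le_trans (gM x Ox).
have mgD D : measurable_fun (D : set mV) (g : mV -> R).
  by apply: (@measurable_funTS _ _ mV); exact: mg.
have mO := @outer_measurable _ _ A x delta mA.
have mOr := @outer_measurable _ _ A x r mA.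
have mS := @shell_measurable _ _ A x delta r mA.
have OO : A `\` eball x delta `<=` Om by move=> y [/AO].
have sT := trunc_summable s01 bOm mA AO Ox d0 (mgD _) gM.
have sF := far_summable mO OO Ox r0 mg gM.
have tE : trunc_Ls s A g x delta =
    \int[mu]_(y in A `\` eball x delta) ((g x - g y) * far_kernel r (x - y)) + near g x r delta.
  have -> : trunc_Ls s A g x delta = \int[mu]_(y in A `\` eball x delta)
      ((g x - g y) * far_kernel r (x - y) + ((g x - g y) * fker s (x - y) - (g x - g y) * far_kernel r (x - y))).
    by apply: eq_Rintegral => y _; rewrite [RHS]addrC subrK.
  rewrite RintD//; last exact: summableB.
  congr (_ + _); rewrite (outer_split A x dr) RintU//; last 2 first.
  - by rewrite -(outer_split A x dr); exact: summableB.
  - by move=> y [_ Ny] [[]].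
  rewrite [X in X + _](_ : _ = 0) ?add0r; last first.
    transitivity (\int[mu]_(y in A `\` eball x r) 0); last by rewrite Rint_cst// mul0r.
    by apply: eq_Rintegral => y; rewrite inE => Dy; rewrite far_kernel_out ?subrr//; exact: outer_ge Dy.
  pose F y := (g x - g y) * (fker s (x - y) - far_height r).
  have FE y : shell A x delta r y -> (g x - g y) * fker s (x - y) - (g x - g y) * far_kernel r (x - y) = F y.
    move=> [[_ yr] _]; rewrite /F mulrBr far_kernel_in// enorm_sub ltW//.
  rewrite (@eq_Rintegral _ _ _ mu _ F); last by move=> y; rewrite inE => /FE.
  have mF : measurable_fun (setT : set mV) (F : mV -> R).
    apply: measurable_funM; first by apply: measurable_funB; [exact: measurable_cst|exact: mg].
    by apply: measurable_funB; [exact: fker_measurable|exact: measurable_cst].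
  have FM y : shell A x delta r y -> `|F y| <= (M + M) * ((delta `^ p)^-1 + far_height r).
    move=> Dy; have [[Ay _] /negP] := Dy; rewrite /eball/= -leNgt enorm_sub => dy.
    rewrite normrM; apply: ler_pM => //.
      by rewrite (le_trans (ler_normB _ _))// lerD//; apply: gM => //; exact: AO.
    rewrite (le_trans (ler_normB _ _))// lerD//.
      by rewrite (ger0_norm (fker_ge0 _ _)); exact: (fker_le s01 d0 dy).
    by rewrite ger0_norm// ltW// far_height_gt0.
  transitivity (\int[mu]_(z in shell Sigma 0 delta r) F (x - z)).
    exact: (Rint_shell bOm sA d0 mF FM).
  by apply: eq_Rintegral => z _; rewrite /F subKr.
have farE : far A g x r = \int[mu]_(y in A `\` eball x delta) ((g x - g y) * far_kernel r (x - y)) +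
    \int[mu]_(y in A `&` eball x delta) ((g x - g y) * far_kernel r (x - y)).
  have AE : A = (A `\` eball x delta) `|` (A `&` eball x delta) by rewrite setUC setUIDK.
  have mI : lebesgue_measurable (A `&` eball x delta).
    by apply: measurableI => //; exact/open_lebesgue_measurable/open_eball.
  rewrite /far [in LHS]AE RintU//; first by rewrite -AE; exact: far_summable mg gM.
  by move=> y [_ ?] [_ ?].
have small : \int[mu]_(y in A `&` eball x delta) ((g x - g y) * far_kernel r (x - y)) <=
    2 * M * far_height r * (2 * delta) ^+ n.+1.
  have mI : lebesgue_measurable (A `&` eball x delta).
    by apply: measurableI => //; exact/open_lebesgue_measurable/open_eball.
  have IO : A `&` eball x delta `<=` Om by move=> y [/AO].
  have c0 : 0 <= 2 * M * far_height r by rewrite !mulr_ge0// ltW// far_height_gt0.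
  apply: (@le_trans _ _ (\int[mu]_(y in A `&` eball x delta) (2 * M * far_height r))).
    apply: le_Rint => //; first exact: far_summable mg gM.
      apply: (@bounded_summable _ _ _ _ `|2 * M * far_height r| mI (bounded_fin bOm IO)) => //.
    move=> y [/AO Oy _]; apply: (@le_trans _ _ ((M + M) * far_kernel r (x - y))).
      rewrite ler_wpM2r ?far_kernel_ge0//; apply: (le_trans (ler_norm _)).
      by rewrite (le_trans (ler_normB _ _))// lerD//; exact: gM.
    have -> : M + M = 2 * M by rewrite mulr_natl mulr2n.
    apply: ler_wpM2l; first by rewrite mulr_ge0.
    exact: far_kernel_le.
  rewrite Rint_cst// ler_wpM2l//.
  have hb := lebesgue_eball x (ltW d0).
  have hI : (mu (A `&` eball x delta) <= ((2 * delta) ^+ n.+1)%:E)%E.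
    by apply: le_trans hb; apply: le_lebesgue_outer => y [].
  rewrite -[leRHS]/(fine ((2 * delta) ^+ n.+1)%:E) fine_le//.
  by rewrite ge0_fin_numE//; exact: le_lt_trans hI (ltry _).
by rewrite tE farE; lra.
Qed.

(** Truncation at radius [delta] and replacement of the kernel by the bounded one
    on the small ball cost only the volume of that ball, which tends to [0]. *)
Lemma near_far_le A g x r M (c : R) : sector A x r ->
  measurable_fun (setT : set mV) (g : mV -> R) -> (forall y, Om y -> `|g y| <= M) ->
  Ls_le s A g x c -> forall e, 0 < e -> exists2 d0, 0 < d0 &
    forall delta, 0 < delta -> delta < d0 -> far A g x r + near g x r delta <= c + e.
Proof.
move=> sA mg gM gc e e0; have [mA AO Ox r0 _] := sA.
have M0 : 0 <= M by apply: le_trans (gM x Ox).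
have e20 : 0 < e / 2 by rewrite divr_gt0.
have [d1 d10 hd1] := gc _ e20.
pose K := 2 * M * far_height r + 1.
have K0 : 0 < K by rewrite ltr_pwDr// !mulr_ge0// ltW// far_height_gt0.
have d20 : 0 < e / 2 / K / 2 by rewrite !divr_gt0.
exists (Num.min (Num.min d1 r) (Num.min (e / 2 / K / 2) (1 / 2))).
  by rewrite !lt_min d10 r0 d20; lra.
move=> delta d0; rewrite !lt_min => /andP[/andP[dd1 dr] /andP[de d1_]].
have h1 := hd1 delta d0 dd1.
have h2 := trunc_near_far sA mg gM d0 (ltW dr).
have pw : (2 * delta) ^+ n.+1 <= 2 * delta.
  rewrite exprS ler_piMr//; first by rewrite mulr_ge0// ltW.
  by apply: exprn_ile1; [rewrite mulr_ge0// ltW|lra].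
have h3 : 2 * M * far_height r * (2 * delta) ^+ n.+1 <= e / 2.
  apply: (@le_trans _ _ (K * (2 * delta))).
    apply: ler_pM => //; first by rewrite !mulr_ge0// ltW// far_height_gt0.
      by rewrite exprn_ge0// mulr_ge0// ltW.
    by rewrite lerDl.
  rewrite -ler_pdivlMl// mulrC; move: de; rewrite ltr_pdivlMr// mulrC => /ltW.
  by rewrite (mulrC (K^-1)).
lra.
Qed.

(** The barrier lies below a paraboloid, whose linear part integrates to [0] and
    whose quadratic part is of size [d ^ (eta - 2)]. *)
Lemma near_barrier A (eta r cm : R) x : 0 < eta -> eta <= 1 -> sector A x r ->
  (forall rho, 0 < rho -> moment rho r <= cm * r `^ (2 - 2 * s)) ->
  forall delta, 0 < delta ->
  - (eta / 2 * d x `^ (eta - 2) * (cm * r `^ (2 - 2 * s))) <=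
    near (fun y => d y `^ eta) x r delta.
Proof.
move=> eta0 eta1 sA hcm delta d0; have [mA AO Ox r0 _] := sA.
have [p1 fp1 xp1] := bdist_attained Om0 oOm bOm x.
have hq := bdist_pow_quadratic Om0 oOm bOm eta0 eta1 Ox fp1 xp1.
set a := _ *: _ in hq; set b := eta / 2 * _ in hq *.
have b0 : 0 <= b by rewrite mulr_ge0 ?powR_ge0// ltW// divr_gt0.
pose D := shell Sigma 0 delta r.
have mD : lebesgue_measurable D := @shell_measurable _ _ Sigma 0 delta r (measurable_Sigma oS).
have k0 z : D z -> 0 <= fker s z - far_height r by exact: near_kernel_ge0.
have s1 := dotv_summable s01 oS a r d0.
have s2 := second_moment_summable s01 oS r d0.
have ma := continuous_lebesgue_measurable (@dotv_continuous R n a).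
have aM z : D z -> `|dotv a z| <= enorm a * r.
  move=> /(shell_gt0 d0)/andP[_ zr]; rewrite (le_trans (abs_dotv_le a z))//.
  by rewrite ler_wpM2l ?enorm_ge0// ltW.
have sa := near_summable d0 r0 ma aM.
have sq := near_summable d0 r0 (@sqr_measurable R n) (@sqr_shell_le _ _ Sigma delta r).
have [dM _ hdM] : exists2 M, 0 <= M & forall y, Om y -> `|d y `^ eta| <= M.
  have [Db D0 hD] := bdist_bounded Om0 oOm bOm; exists (Db `^ eta); first exact: powR_ge0.
  move=> y Oy; rewrite ger0_norm ?powR_ge0//; apply: ge0_ler_powR; rewrite ?nnegrE ?(ltW eta0) ?(ltW D0)//.
    exact: bdist_ge0.
  exact: hD.
have md := continuous_lebesgue_measurable (bdist_pow_continuous Om0 oOm bOm eta0 eta1).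
have sn := near_diff_summable sA d0 md hdM.
have I1 : \int[mu]_(z in D) (dotv a z * (fker s z - far_height r)) = 0.
  apply: (first_moment_even oS symS _ _ sa).
  - by move=> z; rewrite fkerN.
  - by apply: measurable_funB; [exact: fker0_measurable|exact: measurable_cst].
have I2 : \int[mu]_(z in D) (enorm z ^+ 2 * (fker s z - far_height r)) <= moment delta r.
  apply: le_Rint => // z Dz; rewrite ler_wpM2l ?sqr_ge0// lerBlDr lerDl.
  by rewrite ltW// far_height_gt0.
have I3 : - (b * \int[mu]_(z in D) (enorm z ^+ 2 * (fker s z - far_height r))) <=
    near (fun y => d y `^ eta) x r delta.
  have -> : - (b * \int[mu]_(z in D) (enorm z ^+ 2 * (fker s z - far_height r))) =
     \int[mu]_(z in D) (dotv a z * (fker s z - far_height r) +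
        (- b) * (enorm z ^+ 2 * (fker s z - far_height r))).
    by rewrite RintD//; [rewrite RintZ// I1 add0r mulNr|exact: summableZ].
  apply: le_Rint => //; first by apply: summableD => //; exact: summableZ.
  move=> z Dz; rewrite [X in _ + X]mulrA -mulrDl ler_wpM2r ?k0//.
  have := hq (x - z); rewrite /quadratic.
  have -> : x - z - x = - z by rewrite addrAC subrr sub0r.
  rewrite dotvNr enormN mulNr.
  exact: drop_ge_subr.
apply: le_trans I3; rewrite lerN2 ler_wpM2l//; apply: le_trans I2 _; exact: hcm.
Qed.

Lemma Om_diameter : exists2 D0 : R, 0 < D0 & forall x y, Om x -> Om y -> enorm (x - y) <= D0.
Proof.
have [M [_ hM]] := bOm; have M1 : M < `|M| + 1 by rewrite ltr_pwDr// ler_norm.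
exists (n.+1%:R * ((`|M| + 1) + (`|M| + 1))).
  by rewrite mulr_gt0// addr_gt0// ltr_pwDr.
move=> x y Ox Oy; apply: (le_trans (enorm_le_normr _)); rewrite ler_wpM2l//.
by rewrite (le_trans (ler_normB _ _))// lerD//; exact: (hM _ M1).
Qed.

(** The growth of the barrier is at most [eta / s] times a power of exponent
    [s < 2 s], which the kernel integrates at infinity. *)
Lemma far_barrier : exists2 cf : R, 0 < cf & forall A (eta r : R) x, 0 < eta -> eta <= s ->
  lebesgue_measurable A -> A `<=` Om -> Om x -> 0 < r ->
  - (eta / s * d x `^ (eta - s) * (cf * r `^ (- s))) <= far A (fun y => d y `^ eta) x r.
Proof.
have [cg cg0 hcg] := @fker_growth_tail R n s s01.
have [s0 s1] := andP s01.
exists (2 ^+ n.+1 + cg); first by rewrite addr_gt0// exprn_gt0.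
move=> A eta r x eta0 etas mA AO Ox r0.
have eta1 : eta <= 1 by rewrite (le_trans etas)// ltW.
have [D0 D00 hD0] := Om_diameter.
pose f y := enorm (x - y) `^ s.
have mf D : measurable_fun (D : set mV) (f : mV -> R).
  have me : measurable_fun (setT : set mV) (fun y : mV => enorm (x - (y : V))).
    exact: (reflect_measurable x (continuous_lebesgue_measurable (@enorm_continuous R n))).
  apply: (@measurable_funTS _ _ mV); exact: (measurableT_comp (measurable_powR s) me).
have fM y : Om y -> `|f y| <= D0 `^ s.
  move=> Oy; rewrite ger0_norm ?powR_ge0//.
  by apply: ge0_ler_powR; rewrite ?nnegrE ?enorm_ge0 ?(ltW s0) ?(ltW D00)//; exact: hD0.
have sf D : lebesgue_measurable D -> D `<=` Om -> summable_on D (fun y => f y * far_kernel r (x - y)).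
  by move=> mD DO; apply: (@far_kernel_summable D x r f (D0 `^ s) mD DO r0 (mf D)) => y /DO; exact: fM.
have mAr := @outer_measurable _ _ A x r mA.
have mI : lebesgue_measurable (A `&` eball x r).
  by apply: measurableI => //; exact/open_lebesgue_measurable/open_eball.
have IO : A `&` eball x r `<=` Om by move=> y [/AO].
have ArO : A `\` eball x r `<=` Om by move=> y [/AO].
have hI : \int[mu]_(y in A) (f y * far_kernel r (x - y)) <= (2 ^+ n.+1 + cg) * r `^ (- s).
  have AE : A = (A `&` eball x r) `|` (A `\` eball x r) by rewrite setUIDK.
  have sAE : summable_on ((A `&` eball x r) `|` (A `\` eball x r)) (fun y => f y * far_kernel r (x - y)).
    by rewrite -AE; exact: sf.
  rewrite [in leLHS]AE (RintU mI mAr sAE); last by move=> y [_ ?] [_ ?].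
  rewrite mulrDl; apply: lerD.
    apply: (@le_trans _ _ (\int[mu]_(y in A `&` eball x r) (r `^ s * far_height r))).
      apply: le_Rint => //; first exact: sf.
        exact: (@bounded_summable _ _ _ _ `|r `^ s * far_height r| mI (bounded_fin bOm IO)).
      move=> y [_]; rewrite /eball/= enorm_sub => yr; apply: ler_pM; rewrite ?powR_ge0 ?far_kernel_ge0//.
        by apply: ge0_ler_powR; rewrite ?nnegrE ?enorm_ge0 ?(ltW s0) ?(ltW r0)// ltW.
      exact: far_kernel_le.
    have hb : (mu (A `&` eball x r) <= ((2 * r) ^+ n.+1)%:E)%E.
      by apply: le_trans (lebesgue_eball x (ltW r0)); apply: le_lebesgue_outer => y [].
    have hm : fine (mu (A `&` eball x r)) <= (2 * r) ^+ n.+1.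
      rewrite -[leRHS]/(fine ((2 * r) ^+ n.+1)%:E) fine_le//.
      by rewrite ge0_fin_numE//; exact: le_lt_trans hb (ltry _).
    rewrite Rint_cst//; apply: (@le_trans _ _ (r `^ s * far_height r * (2 * r) ^+ n.+1)).
      by rewrite ler_wpM2l// mulr_ge0 ?powR_ge0// ltW// far_height_gt0.
    rewrite exprMn mulrCA ler_wpM2l ?exprn_ge0// le_eqVlt; apply/orP; left; apply/eqP.
    rewrite /far_height -powRN -powR_mulrn ?(ltW r0)// -!powRD ?(gt_eqF r0) ?implybT//.
    by congr (_ `^ _); ring.
  have rE : [set z | (A `\` eball x r) (x - z)] `<=` [set z | r <= enorm z].
    move=> z [_ /negP]; rewrite /eball/= -leNgt.
    by have -> : x - z - x = - z; rewrite ?enormN// addrAC subrr sub0r.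
  have mR : lebesgue_measurable [set z | (A `\` eball x r) (x - z)] by exact: lebesgue_measurable_reflect.
  have := hcg r _ r0 mR rE.
  pose G y := f y * fker s (x - y).
  have sG : summable_on (A `\` eball x r) G.
    apply: (kernel_summable s01 (M := D0 `^ s) mAr (bounded_fin bOm ArO) r0 (mf _)).
      by move=> y /ArO; exact: fM.
    by move=> y Dy; exact: outer_ge Dy.
  have mG : measurable_fun (setT : set mV) (G : mV -> R).
    by apply: measurable_funM; [exact: mf|exact: fker_measurable].
  have sGr : summable_on [set z | (A `\` eball x r) (x - z)] (fun z => G (x - z)).
    have fz z : [set z | (A `\` eball x r) (x - z)] z -> `|G (x - z)| <= D0 `^ s * (r `^ p)^-1.
      move=> Dz; have rz := rE z Dz; rewrite /G subKr normrM (ger0_norm (fker_ge0 _ _)).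
      by apply: ler_pM => //; [exact: fker_ge0|apply: fM; exact: ArO|exact: (fker_le s01 r0 rz)].
    apply: (bounded_summable mR _ _ fz).
      rewrite /lebesgue lebesgue_outer_reflect; exact: (bounded_fin bOm ArO).
    by apply: (@measurable_funTS _ _ mV); exact: (reflect_measurable x mG).
  have -> : \int[mu]_(y in A `\` eball x r) (f y * far_kernel r (x - y)) =
      \int[mu]_(z in [set z | (A `\` eball x r) (x - z)]) (enorm z `^ s * fker s z).
    rewrite (@eq_Rintegral _ _ _ mu _ G); last first.
      by move=> y; rewrite inE => Dy; rewrite /G far_kernel_out//; exact: outer_ge Dy.
    rewrite (Rintegral_reflect mAr mG sGr); apply: eq_Rintegral => z _.
    by rewrite /G /f subKr.
  by [].
have eta2 : 0 <= eta / s * d x `^ (eta - s) by rewrite mulr_ge0 ?powR_ge0 ?divr_ge0// ltW.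
apply: (@le_trans _ _ (- (eta / s * d x `^ (eta - s) * \int[mu]_(y in A) (f y * far_kernel r (x - y))))).
  by rewrite lerN2 ler_wpM2l.
rewrite -RintZ//; last exact: sf.
rewrite -RintN//; last by apply: summableZ => //; exact: sf.
have md := continuous_lebesgue_measurable (bdist_pow_continuous Om0 oOm bOm eta0 eta1).
have [Db Db0 hDb] := bdist_bounded Om0 oOm bOm.
have dM y : Om y -> `|d y `^ eta| <= Db `^ eta.
  move=> Oy; rewrite ger0_norm ?powR_ge0//; apply: ge0_ler_powR; rewrite ?nnegrE ?(ltW eta0) ?(ltW Db0)//.
    exact: bdist_ge0.
  exact: hDb.
apply: le_Rint => //.
- by apply: summableN => //; apply: summableZ => //; exact: sf.
- exact: far_summable md dM.
move=> y Ay; rewrite mulrA -mulNr ler_wpM2r ?far_kernel_ge0//.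
have := bdist_pow_growth Om0 oOm bOm y eta0 etas (ltW s1) Ox.
exact: drop_ge_opp.
Qed.

End near_and_far.

(** * Penalization and continuity of the far part *)

Section penalization.
Context {R : realType} {X : topologicalType}.
Implicit Types (S : set X) (F P : X -> R) (p q : X) (k : R).

Definition penalized_max S F P : set X := [set p | S p /\
  exists2 k, 0 < k & forall p', S p' -> F p' - k * P p' <= F p - k * P p].

(** Penalization: as the weight of a nonnegative penalty tends to infinity, the
    maximum points accumulate at a maximum point of [F] on the zero set of the
    penalty. *)
Lemma penalized_max_cluster S F P q0 : compact S -> S q0 -> P q0 = 0 ->
  continuous F -> continuous P -> (forall q, 0 <= P q) ->
  exists q, [/\ S q, P q = 0, forall q', S q' -> P q' = 0 -> F q' <= F q &
    closure (penalized_max S F P) q].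
Proof.
move=> cS Sq0 Pq0 cF cP P0; have S0 : S !=set0 by exists q0.
have cFP (k : nat) : continuous (fun q => F q - k.+1%:R * P q).
  move=> q; apply: (@cvgB _ R^o _ _ _ F (fun q => k.+1%:R * P q)); first exact: cF.
  by apply: cvgMr; exact: cP.
have hk (k : nat) : exists p, S p /\
    forall p', S p' -> F p' - k.+1%:R * P p' <= F p - k.+1%:R * P p.
  have [p Sp hp] := compact_EVT_max S0 cS (continuous_subspaceT (cFP k)).
  by exists p; split; [rewrite inE in Sp|move=> p' Sp'; apply: hp; rewrite inE].
have [p_ hp_] := choice hk.
have [qm Sqm hqm] := compact_EVT_max S0 cS (continuous_subspaceT cF).
have FS : (p_ @ \oo) S by exists 0%N => // k _; exact: (hp_ k).1.
have [q [Sq cq]] := cS (p_ @ \oo) _ FS.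
have freq (W : set X) (N : nat) : nbhs q W -> exists2 m, (N <= m)%N & W (p_ m).
  move=> qW; have FN : (p_ @ \oo) [set p_ m | m in [set m | (N <= m)%N]].
    by exists N => // m Nm; exists m.
  by have [_ [[m Nm <-] Wm]] := cq _ _ FN qW; exists m.
exists q; split => //.
- apply/eqP; rewrite eq_le P0 andbT leNgt; apply/negP => Pq.
  have Pq2 : 0 < P q / 2 by rewrite divr_gt0.
  have W : nbhs q [set p | P q / 2 < P p].
    have /cvgrPdist_lt/(_ _ Pq2) := cP q; apply: filterS => p /=.
    by rewrite ltr_norml => /andP[_ h]; lra.
  have [N _ hN] : \forall N \near \oo, (F qm - F q0) / (P q / 2) < N%:R.
    exact: nbhs_infty_gtr.
  have [m Nm /= Pm] := freq _ N W.
  have h1 := (hp_ m).2 _ Sq0; have h2 := hqm (p_ m); rewrite inE in h2.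
  have {}h2 := h2 (hp_ m).1; have := hN m Nm; rewrite /= ltr_pdivrMr// => h3.
  have h4 : m%:R * (P q / 2) <= m.+1%:R * P (p_ m).
    by apply: ler_pM; rewrite ?(ltW Pq2) ?(ltW Pm)// ler_nat.
  by move: h1; rewrite Pq0 mulr0 subr0; lra.
- move=> q' Sq' Pq'; rewrite leNgt; apply/negP => Fq.
  have Fd : 0 < F q' - F q by rewrite subr_gt0.
  have W : nbhs q [set p | F p < F q'].
    have /cvgrPdist_lt/(_ _ Fd) := cF q; apply: filterS => p /=.
    by rewrite ltr_norml => /andP[h _]; lra.
  have [m _ /= Fm] := freq _ 0%N W.
  have := (hp_ m).2 _ Sq'; rewrite Pq' mulr0 subr0 => h1.
  have : 0 <= m.+1%:R * P (p_ m) by rewrite mulr_ge0.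
  by lra.
- move=> W qW; have [m _ Wm] := freq _ 0%N qW; exists (p_ m); split => //.
  by split; [exact: (hp_ m).1|exists m.+1%:R => //; exact: (hp_ m).2].
Unshelve. all: by end_near. Qed.

End penalization.

Section far_limits.
Context {R : realType} {n : nat}.
Local Notation V := 'rV[R]_n.+1.
Local Notation mu := (@lebesgue R n).
Local Notation mV := (caratheodory_type (@lebesgue_outer R n)).
Variable s : R.
Hypothesis s01 : 0 < s < 1.
Variables (Om : set V).
Hypotheses (oOm : open Om) (bOm : bounded_set Om).
Implicit Types (A B D : set V) (f g : V -> R) (x y z : V) (r M : R).
Local Notation far_height := (@far_height R n s).
Local Notation far_kernel := (@far_kernel R n s).
Local Notation far := (@far R n s).

Lemma Rint_abs_le D f M : lebesgue_measurable D -> D `<=` Om -> summable_on D f ->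
  (forall y, D y -> `|f y| <= M) -> `|\int[mu]_(y in D) f y| <= M * fine (mu D).
Proof.
move=> mD DO sf fM.
have sM (c : R) : summable_on D (fun=> c).
  exact: (@bounded_summable _ _ _ _ `|c| mD (bounded_fin bOm DO)).
rewrite ler_norml; apply/andP; split.
  rewrite -mulNr -Rint_cst//; apply: le_Rint => // y /fM.
  by rewrite ler_norml => /andP[].
rewrite -Rint_cst//; apply: le_Rint => // y /fM.
by rewrite ler_norml => /andP[].
Qed.

(** The truncated kernel is bounded, so only the volume of the symmetric difference
    counts. *)
Lemma far_symdiff A B g x r M : lebesgue_measurable A -> lebesgue_measurable B ->
  A `<=` Om -> B `<=` Om -> Om x -> 0 < r ->
  measurable_fun (setT : set mV) (g : mV -> R) -> (forall y, Om y -> `|g y| <= M) ->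
  `|far A g x r - far B g x r| <= 2 * M * far_height r * fine (mu (A `+` B)).
Proof.
move=> mA mB AO BO Ox r0 mg gM.
pose f y := (g x - g y) * far_kernel r (x - y).
have M0 : 0 <= M by apply: le_trans (gM x Ox).
have fM y : Om y -> `|f y| <= 2 * M * far_height r.
  move=> Oy; rewrite normrM (ger0_norm (far_kernel_ge0 _ _ _)).
  apply: ler_pM; rewrite ?far_kernel_ge0 ?far_kernel_le//.
  by rewrite (le_trans (ler_normB _ _))// mulr_natl mulr2n lerD// gM.
have sf D : lebesgue_measurable D -> D `<=` Om -> summable_on D f.
  by move=> mD DO; exact: (far_summable s01 bOm mD DO Ox r0 mg gM).
have mI : lebesgue_measurable (A `&` B) by exact: measurableI.
have m1 : lebesgue_measurable (A `\` B) by exact: measurableD.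
have m2 : lebesgue_measurable (B `\` A) by exact: measurableD.
have O1 : A `\` B `<=` Om by move=> y [/AO].
have O2 : B `\` A `<=` Om by move=> y [/BO].
have EA : \int[mu]_(y in A) f y = \int[mu]_(y in A `&` B) f y + \int[mu]_(y in A `\` B) f y.
  by rewrite -RintU// ?setUIDK//; [exact: sf|move=> y [_ ?] [_ ?]].
have EB : \int[mu]_(y in B) f y = \int[mu]_(y in A `&` B) f y + \int[mu]_(y in B `\` A) f y.
  rewrite -RintU//; first by rewrite setIC setUIDK.
    by rewrite setIC setUIDK; exact: sf.
  by move=> y [? _] [_ ?].
have -> : far A g x r - far B g x r = \int[mu]_(y in A `\` B) f y - \int[mu]_(y in B `\` A) f y.
  by rewrite -[far A g x r]/(\int[mu]_(y in A) f y) -[far B g x r]/(\int[mu]_(y in B) f y) EA EB; ring.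
have -> : fine (mu (A `+` B)) = fine (mu (A `\` B)) + fine (mu (B `\` A)).
  rewrite setY_def measureU//; last by rewrite -subset0 => y [[_ ?] [? _]].
  by rewrite fineD// ge0_fin_numE// (bounded_fin bOm).
rewrite mulrDr (le_trans (ler_normB _ _))// lerD//.
- apply: Rint_abs_le => //; first exact: sf.
  by move=> y /O1; exact: fM.
- apply: Rint_abs_le => //; first exact: sf.
  by move=> y /O2; exact: fM.
Qed.

(** The truncated kernel being bounded and continuous, the far part of the
    operator depends continuously on the point, the function and the set. *)
Lemma far_close (U : R * V -> R) t0 x0 B r M (e : R) : continuous U ->
  (forall t y, 0 < t -> Om y -> `|U (t, y)| <= M) -> 0 < t0 -> Om x0 ->
  lebesgue_measurable B -> B `<=` Om -> 0 < r -> 0 < e ->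
  exists2 rho, 0 < rho & forall t x A, 0 < t -> `|t - t0| < rho -> Om x -> enorm (x - x0) < rho ->
    lebesgue_measurable A -> A `<=` Om -> fine (mu (A `+` B)) < rho ->
    `|far A (fun y => U (t, y)) x r - far B (fun y => U (t0, y)) x0 r| < e.
Proof.
move=> cU UM t00 Ox0 mB BO r0 e0; have cK := compact_closure bOm.
have M0 : 0 <= M by apply: le_trans (UM _ _ t00 Ox0).
have k0 : 0 < far_height r by exact: far_height_gt0.
set kap := far_height r in k0 *.
have mO : lebesgue_measurable Om by exact: open_lebesgue_measurable.
pose m := fine (mu Om); have m0 : 0 <= m by rewrite fine_ge0.
have fO := bounded_fin bOm (@subset_refl _ Om).
pose N := 2 * M * kap + m * (2 * kap + 2 * M) + 1.
have N0 : 0 < N.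
  by rewrite ltr_pwDr// addr_ge0// !mulr_ge0// ?(ltW k0)// addr_ge0// !mulr_ge0// ltW.
have [e1 e10 eN] : exists2 e1, 0 < e1 & e = e1 * N.
  by exists (e / N); [rewrite divr_gt0|rewrite mulfVK// gt_eqF].
have [r1 r10 h1] := continuous_modulus (cU (t0, x0)) e10.
have [r2 r20 h2] := uniform_modulus t0 cU cK e10.
have cKx : compact [set x0 - y | y in closure Om].
  apply: continuous_compact => //; apply: continuous_subspaceT => y.
  by apply: continuousB; [exact: cst_continuous|exact: cvg_id].
have cf : continuous (far_kernel r) by move=> z; exact: far_kernel_continuous.
have [r3 r30 h3] := uniform_modulus_space cf cKx e10.
exists (Num.min (Num.min r1 r2) (Num.min r3 e1)); first by rewrite !lt_min r10 r20 r30 e10.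
move=> t x A t1; rewrite !lt_min => /andP[/andP[t_1 t_2] _] Ox /andP[/andP[x1 _] /andP[x3 _]] mA AO.
move=> /andP[_ /andP[_ mAB]].
have mU tt : measurable_fun (setT : set mV) ((fun y => U (tt, y)) : mV -> R).
  by apply: continuous_lebesgue_measurable; exact: slice_continuous.
have UMt tt : 0 < tt -> forall y, Om y -> `|U (tt, y)| <= M by move=> tt0 y; exact: UM.
have S1 := far_symdiff mA mB AO BO Ox0 r0 (mU t0) (UMt t0 t00).
have S2 : `|far A (fun y => U (t, y)) x r - far A (fun y => U (t0, y)) x0 r| <=
    (2 * e1 * kap + 2 * M * e1) * m.
  have sA1 := far_summable s01 bOm mA AO Ox r0 (mU t) (UMt t t1).
  have sA2 := far_summable s01 bOm mA AO Ox0 r0 (mU t0) (UMt t0 t00).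
  rewrite /far -(RintB mA sA1 sA2).
  have b0 : 0 <= 2 * e1 * kap + 2 * M * e1.
    have [e1' k0'] : 0 <= e1 /\ 0 <= kap by split; exact: ltW.
    by rewrite addr_ge0 ?mulr_ge0.
  apply: (@le_trans _ _ ((2 * e1 * kap + 2 * M * e1) * fine (mu A))); last first.
    rewrite ler_wpM2l// fine_le// ?ge0_fin_numE//; first exact: (bounded_fin bOm AO).
    exact: le_lebesgue_outer.
  apply: Rint_abs_le => //; first exact: summableB.
  move=> y /AO Oy.
  have -> : (U (t, x) - U (t, y)) * far_kernel r (x - y) -
      (U (t0, x0) - U (t0, y)) * far_kernel r (x0 - y) =
      ((U (t, x) - U (t0, x0)) + (U (t0, y) - U (t, y))) * far_kernel r (x - y) +
      (U (t0, x0) - U (t0, y)) * (far_kernel r (x - y) - far_kernel r (x0 - y)) by ring.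
  rewrite (le_trans (ler_normD _ _))// !normrM lerD//.
    rewrite (ger0_norm (far_kernel_ge0 _ _ _)); apply: ler_pM; rewrite ?far_kernel_ge0 ?far_kernel_le//.
    rewrite (le_trans (ler_normD _ _))// mulr_natl mulr2n lerD//; first exact/ltW/h1.
    rewrite distrC ltW//; apply: h2 => //; first exact: sub_closure.
    by rewrite subrr enorm0.
  apply: ler_pM => //; first by rewrite (le_trans (ler_normB _ _))// mulr_natl mulr2n lerD// UM.
  apply/ltW/h3; first by exists y => //; exact: sub_closure.
  by have -> : x - y - (x0 - y) = x - x0 by rewrite opprB addrA subrK.
rewrite (le_lt_trans (ler_distD (far A (fun y => U (t0, y)) x0 r) _ _))//.
have S3 : 2 * M * kap * fine (mu (A `+` B)) <= 2 * M * kap * e1.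
  by rewrite ler_wpM2l ?(ltW mAB)// !mulr_ge0// ltW.
have : `|far A (fun y => U (t, y)) x r - far A (fun y => U (t0, y)) x0 r| +
   `|far A (fun y => U (t0, y)) x0 r - far B (fun y => U (t0, y)) x0 r| <=
   e1 * (2 * M * kap + m * (2 * kap + 2 * M)).
  apply: le_trans (lerD S2 (le_trans S1 S3)) _.
  by rewrite le_eqVlt; apply/orP; left; apply/eqP; ring.
by move=> /le_lt_trans; apply; rewrite eN ltr_pM2l// ltr_pwDr.
Qed.

Lemma far_cvg {T : Type} {F : set_system T} {FF : Filter F} (U : R * V -> R) (t : T -> R) (x : T -> V)
    (A : T -> set V) (t0 : R) (x0 : V) B r M : continuous U ->
  (forall t y, 0 < t -> Om y -> `|U (t, y)| <= M) -> 0 < t0 -> Om x0 ->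
  lebesgue_measurable B -> B `<=` Om -> 0 < r ->
  t @ F --> t0 -> x @ F --> x0 -> mu (A q `+` B) @[q --> F] --> 0%E ->
  (\forall q \near F, 0 < t q -> Om (x q) -> lebesgue_measurable (A q) /\ A q `<=` Om) ->
  far (A q) (fun y => U (t q, y)) (x q) r @[q --> F] --> far B (fun y => U (t0, y)) x0 r.
Proof.
move=> cU UM t00 Ox0 mB BO r0 ct cx cA FA; apply/cvgrPdist_lt => e e0.
have [rho rho0 h] := far_close cU UM t00 Ox0 mB BO r0 e0.
have c1 : \forall q \near F, 0 < t q by apply: cvgr_gt ct _ t00.
have c2 : \forall q \near F, `|t0 - t q| < rho by move/cvgrPdist_lt: ct; apply.
have c3 : \forall q \near F, Om (x q) by apply: cx; exact: open_nbhs_nbhs.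
have c4 : \forall q \near F, enorm (x q - x0) < rho by exact: (cx _ (nbhs_eball x0 rho0)).
have c5 : \forall q \near F, (mu (A q `+` B) < rho%:E)%E.
  have W : nbhs (0 : \bar R)%E [set z | (z < rho%:E)%E].
    by apply: open_nbhs_nbhs; split; [exact: open_ereal_lt_ereal|rewrite /= lte_fin].
  exact: (cA _ W).
have c6 : \forall q \near F, lebesgue_measurable (A q) /\ A q `<=` Om.
  by apply: filterS3 FA c1 c3 => q hq tq xq; exact: hq.
near=> q; have [mAq AqO] : lebesgue_measurable (A q) /\ A q `<=` Om by near: q.
rewrite distrC; apply: h.
- by near: q.
- by rewrite distrC; near: q.
- by near: q.
- by near: q.
- exact: mAq.
- exact: AqO.
- have h5 : (mu (A q `+` B) < rho%:E)%E by near: q.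
  rewrite -lte_fin fineK// ge0_fin_numE//; exact: lt_trans h5 (ltry _).
Unshelve. all: by end_near. Qed.

End far_limits.

(** * Boundary decay of stationary solutions *)

Lemma continuous_lin {R : realType} {n : nat} (c : R) (f g : 'rV[R]_n.+1 -> R) :
  continuous f -> continuous g -> continuous (fun y => c * f y + g y).
Proof. by move=> cf cg y; exact: (cvgD (cvgMr (cf y)) (cg y)). Qed.

Section touching_arithmetic.
Context {R : realFieldType}.
Implicit Types a b c e p q t : R.

Lemma ler_sub_swap a b p q : a - p <= b - q -> q - p <= b - a.
Proof. by move=> h; lra. Qed.

Lemma touch_trans a b p q t c : q - p <= b - a -> p <= q + t + c -> a <= b + t + c.
Proof. by move=> h h'; lra. Qed.

Lemma absorb_half a b c e p : - (p / 2) <= a - b + e -> p <= b -> a <= c -> p / 2 <= c + e.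
Proof. by move=> h1 h2 h3; lra. Qed.

End touching_arithmetic.

Section elliptic_bound.
Context {R : realType} {n : nat}.
Local Notation V := 'rV[R]_n.+1.
Local Notation mu := (@lebesgue R n).
Local Notation mV := (caratheodory_type (@lebesgue_outer R n)).
Variable s : R.
Hypothesis s01 : 0 < s < 1.
Variables (Om Sigma : set V).
Hypotheses (Om0 : Om !=set0) (oOm : open Om) (bOm : bounded_set Om) (oS : open Sigma)
  (symS : Sigma = [set - z | z in Sigma]).
Local Notation sector := (sector_at Om Sigma).
Local Notation d := (bdist Om).
Local Notation far := (@far R n s).
Local Notation far_height := (@far_height R n s).
Local Notation near := (@near R n s Sigma).
Implicit Types (D : set V) (f g : V -> R) (x y z : V) (r M : R).

Definition tame g : Prop :=
  measurable_fun (setT : set mV) (g : mV -> R) /\ exists M, forall y, Om y -> `|g y| <= M.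

Lemma tame_continuous g : continuous g -> tame g.
Proof.
move=> cg; split; first exact: continuous_lebesgue_measurable.
have cK := compact_closure bOm.
have [M [_ hM]] := compact_bounded (continuous_compact (continuous_subspaceT cg) cK).
exists (`|M| + 1) => y Oy; apply: (hM (`|M| + 1)); first by rewrite ltr_pwDr// ler_norm.
by exists y => //; exact: sub_closure.
Qed.

Lemma tame_lin (c : R) f g : tame f -> tame g -> tame (fun y => c * f y + g y).
Proof.
move=> [mf [Mf hf]] [mg [Mg hg]]; split.
  by apply: measurable_funD; [apply: measurable_funM; [exact: measurable_cst|exact: mf]|exact: mg].
exists (`|c| * Mf + Mg) => y Oy; rewrite (le_trans (ler_normD _ _))// lerD ?hg// normrM.
by rewrite ler_wpM2l// hf.
Qed.

Lemma tame_dist (eta : R) : 0 < eta -> eta <= 1 -> tame (fun y => d y `^ eta).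
Proof. by move=> e0 e1; apply: tame_continuous; exact: bdist_pow_continuous. Qed.

Lemma tame_far_summable D g x r : tame g -> lebesgue_measurable D -> D `<=` Om -> Om x -> 0 < r ->
  summable_on D (fun y => (g x - g y) * far_kernel s r (x - y)).
Proof. by move=> [mg [M hM]] mD DO Ox r0; exact: (far_summable s01 bOm mD DO Ox r0 mg hM). Qed.

Lemma tame_near_summable D g x r delta : tame g -> sector D x r -> 0 < delta ->
  summable_on (shell Sigma 0 delta r) (fun z => (g x - g (x - z)) * (fker s z - far_height r)).
Proof. by move=> [mg [M hM]] sD d0; exact: (near_diff_summable s01 oS sD d0 mg hM). Qed.

Lemma far_lin D (c : R) f g x r : lebesgue_measurable D -> D `<=` Om -> Om x -> 0 < r ->
  tame f -> tame g ->
  far D (fun y => c * f y + g y) x r = c * far D f x r + far D g x r.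
Proof.
move=> mD DO Ox r0 tf tg; have sf := tame_far_summable tf mD DO Ox r0.
have sg := tame_far_summable tg mD DO Ox r0; have scf := summableZ c mD sf.
rewrite /far -(RintZ c mD sf) -(RintD mD scf sg).
by apply: eq_Rintegral => y _; ring.
Qed.

Lemma far_ge0 D g x r : D `<=` Om -> (forall y, Om y -> g y <= g x) -> 0 <= far D g x r.
Proof.
move=> DO gx; apply: Rint_ge0 => y /DO Oy; rewrite mulr_ge0 ?far_kernel_ge0// subr_ge0.
exact: gx.
Qed.

Lemma far_mono D f g x r (c : R) : lebesgue_measurable D -> D `<=` Om -> Om x -> 0 < r ->
  tame f -> tame g -> (forall y, Om y -> c * (f x - f y) <= g x - g y) ->
  c * far D f x r <= far D g x r.
Proof.
move=> mD DO Ox r0 tf tg fg; have sf := tame_far_summable tf mD DO Ox r0.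
have sg := tame_far_summable tg mD DO Ox r0.
rewrite /far -(RintZ c mD sf); apply: (le_Rint mD (summableZ c mD sf) sg) => y /DO Oy.
by rewrite mulrA ler_wpM2r ?far_kernel_ge0//; exact: fg.
Qed.

Lemma near_mono D f g x r (delta c : R) : tame f -> tame g -> sector D x r -> 0 < delta ->
  (forall y, Om y -> c * (f x - f y) <= g x - g y) ->
  c * near f x r delta <= near g x r delta.
Proof.
move=> tf tg sD d0 fg.
have mD : lebesgue_measurable (shell Sigma 0 delta r) by exact: shell_measurable (measurable_Sigma oS).
have sf := tame_near_summable tf sD d0; have sg := tame_near_summable tg sD d0.
rewrite /near -(RintZ c mD sf); apply: (le_Rint mD (summableZ c mD sf) sg) => z Dz.
rewrite mulrA ler_wpM2r//; first exact: near_kernel_ge0 Dz.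
by apply: fg; exact: sector_sub sD Dz.
Qed.

(** For a radius proportional to [d x], the near and far bounds for the barrier both
    scale as [eta d ^ (eta - 2 s)]. *)
Lemma barrier_sum (cm cf zeta eta D : R) : 0 < D -> 0 < zeta ->
  eta / 2 * D `^ (eta - 2) * (cm * (zeta * D) `^ (2 - 2 * s)) +
  eta / s * D `^ (eta - s) * (cf * (zeta * D) `^ (- s)) =
  eta * (cm / 2 * zeta `^ (2 - 2 * s) + cf / s * zeta `^ (- s)) * D `^ (eta - 2 * s).
Proof.
move=> D0 z0; rewrite !(powRM _ (ltW z0) (ltW D0)).
have E1 : D `^ (eta - 2 * s) = D `^ (eta - 2) * D `^ (2 - 2 * s).
  by rewrite -powRD ?(gt_eqF D0) ?implybT//; congr (_ `^ _); ring.
have E2 : D `^ (eta - 2 * s) = D `^ (eta - s) * D `^ (- s).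
  by rewrite -powRD ?(gt_eqF D0) ?implybT//; congr (_ `^ _); ring.
by rewrite mulrDr mulrDl {1}E1 E2; ring.
Qed.

Variables (A : V -> set V) (zeta cm cf : R).
Hypotheses (zeta0 : 0 < zeta) (cm0 : 0 < cm) (cf0 : 0 < cf).
Hypothesis Asector : forall x, Om x -> sector (A x) x (zeta * d x).
Hypothesis moment_le : forall rho r, 0 < rho -> 0 < r ->
  second_moment s Sigma rho r <= cm * r `^ (2 - 2 * s).
Hypothesis far_barrier_le : forall D (eta r : R) x, 0 < eta -> eta <= s ->
  lebesgue_measurable D -> D `<=` Om -> Om x -> 0 < r ->
  - (eta / s * d x `^ (eta - s) * (cf * r `^ (- s))) <= far D (fun y => d y `^ eta) x r.

Variables (h g F : V -> R) (alpha eta CF : R).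
Hypotheses (alpha0 : 0 < alpha) (h_ge : forall x, Om x -> alpha / d x `^ (2 * s) <= h x).
Hypotheses (eta0 : 0 < eta) (etas : eta <= s).
Hypothesis eta_small :
  eta * (cm / 2 * zeta `^ (2 - 2 * s) + cf / s * zeta `^ (- s)) <= alpha / 2.
Hypotheses (cg : continuous g) (gfr : forall x, frontier Om x -> g x = 0).
Hypothesis gjet : forall x a b, Om x ->
  (forall y, Om y -> g y <= quadratic x (g x) a b y) ->
  Ls_le s (A x) g x (F x - h x * g x).
Hypotheses (CF0 : 0 <= CF) (F_le : forall x, Om x -> F x <= CF * d x `^ (eta - 2 * s)).

(** The power [d ^ eta] of the distance to the boundary is a supersolution for
    small [eta]: its image under the operator is at least [- (alpha / 2)
    d ^ (eta - 2 s)], which the zero order term absorbs. At a positive maximum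
    point of [g - C d ^ eta] the function [g] is touched by the paraboloid that
    touches [C d ^ eta]. *)
Lemma elliptic_barrier_bound x : Om x -> g x <= (2 * CF / alpha + 1) * d x `^ eta.
Proof.
have [s0 s1] := andP s01; have eta1 : eta <= 1 by rewrite (le_trans etas)// ltW.
set C := 2 * CF / alpha + 1; have C0 : 0 < C.
  by rewrite ltr_pwDr// divr_ge0 ?mulr_ge0// ltW.
move=> Ox0; rewrite leNgt; apply/negP => gx0.
have cd := bdist_pow_continuous Om0 oOm bOm eta0 eta1.
pose G y := g y - C * d y `^ eta.
have cG : continuous G.
  have -> : G = (fun y => - C * d y `^ eta + g y) by apply/funext => y; rewrite mulNr addrC.
  exact: continuous_lin.
have K0 : closure Om !=set0 by exists x; exact: sub_closure.
have [xb] := compact_EVT_max K0 (compact_closure bOm) (continuous_subspaceT cG).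
rewrite inE => Kx hx.
have {}hx y : Om y -> G y <= G xb by move=> Oy; apply: hx; rewrite inE; exact: sub_closure.
have Gx : 0 < G xb by apply: lt_le_trans (hx x Ox0); rewrite subr_gt0.
have Oxb : Om xb.
  apply: contrapT => nO; have fx : frontier Om xb by rewrite frontierE.
  move: Gx; rewrite /G gfr// (bdist_frontier Om0 oOm bOm fx) powR0 ?gt_eqF//.
  by rewrite mulr0 subr0 ltxx.
have dx0 := bdist_gt0 Om0 oOm bOm Oxb.
have [p1 fp1 xp1] := bdist_attained Om0 oOm bOm xb.
have hq := bdist_pow_quadratic Om0 oOm bOm eta0 eta1 Oxb fp1 xp1.
have gdiff y : Om y -> C * (d xb `^ eta - d y `^ eta) <= g xb - g y.
  by move=> /hx hy; rewrite mulrBr; exact: ler_sub_swap.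
have gq y : Om y -> g y <= quadratic xb (g xb) (C *: ((eta * d xb `^ (eta - 2)) *: (xb - p1)))
    (C * (eta / 2 * d xb `^ (eta - 2))) y.
  move=> Oy; have h1 := gdiff y Oy; have := hq y.
  rewrite -(ler_pM2l C0) /quadratic => h2; rewrite dotvZl -mulrA.
  by rewrite !mulrDr in h2; rewrite mulrBr in h1; exact: touch_trans h1 h2.
have jx := gjet Oxb gq.
have sA := Asector Oxb; have [mA AO _ r0 _] := sA.
have tg := tame_continuous cg; have td := tame_dist eta0 eta1.
have [mg [M gM]] := tg.
pose Dp := d xb `^ (eta - 2 * s); have Dp0 : 0 < Dp by rewrite powR_gt0.
have key e : 0 < e -> - (C * (alpha / 2 * Dp)) <= F xb - h xb * g xb + e.
  move=> e0; have [d0 d00 hd] := near_far_le s01 bOm sA mg gM jx e0.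
  have d20 : 0 < d0 / 2 by rewrite divr_gt0.
  have d2 : d0 / 2 < d0 by rewrite ltr_pdivrMr// ltr_pMr// ltr1n.
  apply: le_trans (hd _ d20 d2).
  have N1 := near_mono td tg sA d20 gdiff.
  have N2 := near_barrier s01 Om0 oOm bOm oS symS eta0 eta1 sA
    (fun rho rho0 => moment_le rho0 r0) d20.
  have F1 : C * far (A xb) (fun y => d y `^ eta) xb (zeta * d xb) <= far (A xb) g xb (zeta * d xb).
    exact: (far_mono mA AO Oxb r0 td tg gdiff).
  have F2 := far_barrier_le eta0 etas mA AO Oxb r0.
  have B := barrier_sum cm cf eta dx0 zeta0.
  have B2 : eta / 2 * d xb `^ (eta - 2) * (cm * (zeta * d xb) `^ (2 - 2 * s)) +
     eta / s * d xb `^ (eta - s) * (cf * (zeta * d xb) `^ (- s)) <= alpha / 2 * Dp.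
    by rewrite B ler_wpM2r// ltW.
  apply: le_trans (lerD F1 N1); rewrite -mulrDr -mulrN ler_wpM2l ?(ltW C0)//.
  by apply: le_trans (lerD F2 N2); rewrite -opprD lerN2 addrC.
have hg : C * (alpha * Dp) <= h xb * g xb.
  have dpow : alpha * Dp = alpha / d xb `^ (2 * s) * d xb `^ eta.
    by rewrite -mulrA -powRN -powRD ?(gt_eqF dx0) ?implybT//; congr (_ * _ `^ _); rewrite addrC.
  rewrite dpow mulrCA; apply: ler_pM.
  - by rewrite divr_ge0 ?powR_ge0// ltW.
  - by rewrite mulr_ge0 ?powR_ge0// ltW.
  - exact: h_ge.
  - by move: Gx; rewrite /G subr_gt0 => /ltW.
have FD : F xb <= CF * Dp by exact: F_le.
have : C * (alpha * Dp) / 2 <= CF * Dp.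
  apply/ler_addgt0Pr => e e0; have := key e e0.
  have -> : C * (alpha / 2 * Dp) = C * (alpha * Dp) / 2 by ring.
  by move/absorb_half; apply.
apply/negP; rewrite -ltNge.
have -> : C * (alpha * Dp) / 2 = (CF + alpha / 2) * Dp.
  by rewrite /C; field; rewrite gt_eqF.
by rewrite ltr_pM2r// ltrDl divr_gt0.
Qed.

End elliptic_bound.

(** * Comparison by doubling of variables *)

Section penalization_arithmetic.
Context {R : realFieldType}.
Implicit Types T W a b c k p q l m e g w : R.

Lemma penalty_touch T W g a a' k p q l m :
  T - a' - W - g - k * (p + l + m + q) <= T - a - W - g - k * (p + q) ->
  - a' <= - a + k * l + k * m.
Proof. by move=> h; lra. Qed.

Lemma penalty_touch_weighted T W K g e a a' k p q l m :
  T - e * (K * a' + W) - g - k * (q + (p + l + m)) <= T - e * (K * a + W) - g - k * (q + p) ->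
  e * K * - a' <= e * K * - a + k * l + k * m.
Proof. by move=> h; lra. Qed.

Lemma penalty_touch_time T W W' a a' b g g' k q q' :
  a' - T - W' - g' - k * q' <= a - T - W - g - k * q ->
  W' <= b -> a' <= a - W - g - k * q + (b + (g' + k * q')).
Proof. by move=> h h'; lra. Qed.

Lemma shift_increments a a' b b' e K C p p' q q' g :
  a' - b' - e * (K * p' + C * q') - g <= a - b - e * (K * p + C * q) - g ->
  e * C * (q - q') <= a - a' + (- b - - b') + e * K * (- p - - p').
Proof. by move=> h; lra. Qed.

Lemma add_inequalities g a b c a' b' c' p q m e k l W :
  a + a' <= p + e -> b + b' <= q + e -> c + c' <= m + e -> 0 <= k -> 0 <= l ->
  l * W <= a' + b' + k * c' -> - g <= W ->
  a + b + k * c - l * g <= p + q + k * m + e * (2 + k).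
Proof.
move=> h1 h2 h3 k0 l0 h4 h5; have := ler_wpM2l k0 h3; have := ler_wpM2l l0 h5.
by rewrite !mulrDr => h6 h7; lra.
Qed.

Lemma ler_weighted_sum a b m : 0 <= a -> 0 <= b -> 0 <= m -> a + b * m <= (a + b) * (1 + m).
Proof.
move=> a0 b0 m0; rewrite mulrDr mulr1 -addrA lerD2l mulrDl.
by rewrite addrA lerDr addr_ge0// mulr_ge0.
Qed.

Lemma value_le0 a b c k W m g : a <= m -> - b <= k -> 0 <= W -> m + k <= g -> a - b - W - g <= 0.
Proof. by move=> h1 h2 h3 h4; lra. Qed.

Lemma comparison_regroup l k a b c e : 0 <= - l * a + (k * b + (1 * c + e)) ->
  l * a <= e + c + k * b.
Proof. by move=> h; lra. Qed.

Lemma combination_regroup e K C a b p p' q q' u u' :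
  u' - a - e * (K * q' + C * p') <= u - b - e * (K * q + C * p) ->
  - (e * C) * p' + (e * K * - q' + (1 * - a + u')) <= - (e * C) * p + (e * K * - q + (1 * - b + u)).
Proof. by move=> h; lra. Qed.

(** Here [e] is the exponential, [P] the comparison function divided by it,
    [B1] and [B2] are the near and far bounds for the barrier and [al] is what the
    zero order term absorbs. *)
Lemma limit_arithmetic (Ft FU Fv Fw Fd B1 B2 al q c kap lam lambar e K C P p u hx hx' vx wx fx fx' : R) :
  0 < e -> 0 < C ->
  Ft + Fv + e * K * Fw - e * C * B1 <=
    fx' - (kap - lam * (e * P)) - hx' * u + (hx * vx - fx) + e * K * (hx * wx - lambar * wx) ->
  FU - Ft <= q * e -> e * C * Fd <= FU + Fv + e * K * Fw -> - B2 <= Fd -> B1 + B2 <= al ->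
  fx' - fx + (hx - hx') * u <= c * e -> P = K * wx + C * p -> hx * (e * P) <= hx * (u - vx) ->
  2 * al <= hx * p -> c + q - C * al + lam * P - lambar * (K * wx) <= 0 -> kap <= 0.
Proof.
move=> e0 C0 h1 h2 h3 h4 h5 h6 PE h7 h8 h9; subst P; have l0 : 0 <= e * C by rewrite mulr_ge0// ltW.
have g1 := ler_wpM2l l0 h4; have g2 := ler_wpM2l l0 h5; have g3 := ler_wpM2l l0 h8.
have g4 := ler_wpM2l (ltW e0) h9; rewrite mulr0 in g4.
by lra.
Qed.

End penalization_arithmetic.

Lemma is_derive_exp_affine (R : realType) (c W k g lam t : R) :
  is_derive t 1 (fun t' : R => c + (expR (- lam * t') * W + (k * t' + g)))
    (k - lam * (expR (- (lam * t)) * W)).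
Proof.
have dl : is_derive t 1 (fun t' : R => - lam * t') (- lam).
  by apply: is_derive_eq; rewrite /GRing.scale/= mulr1.
have de : is_derive t 1 (fun t' : R => expR (- lam * t')) (expR (- lam * t) * - lam).
  exact: (is_derive1_comp (is_derive_expR (- lam * t)) dl).
apply: is_derive_eq; rewrite /GRing.scale/= mulNr.
by ring.
Qed.

Lemma continuous_oppf {R : realType} {n : nat} (g : 'rV[R]_n.+1 -> R) :
  continuous g -> continuous (fun y => - g y).
Proof. by move=> cg y; exact: (cvgN (cg y)). Qed.

Section maximum_point.
Context {R : realType} {n : nat}.
Local Notation V := 'rV[R]_n.+1.
Variable Om : set V.
Hypotheses (Om0 : Om !=set0) (oOm : open Om) (bOm : bounded_set Om).
Local Notation d := (bdist Om).
Implicit Types (x y z a b : V).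

Lemma penalty_quadratic x y y' :
  enorm (x - y') ^+ 2 = quadratic y (enorm (x - y) ^+ 2) (2 *: (y - x)) 1 y'.
Proof.
rewrite /quadratic mul1r dotvZl (enorm_sub x y') (enorm_sub x y).
have -> : y' - x = (y - x) + (y' - y) by rewrite [RHS]addrC addrA subrK.
by rewrite enorm_sqrD.
Qed.

Lemma quadratic_center x (c : R) a (b : R) : quadratic x c a b x = c.
Proof. by rewrite /quadratic subrr enorm0 expr0n/= mulr0 addr0 dotvC /dotv big1 ?addr0// => i _; rewrite mxE mul0r. Qed.

Variables (U : R * V -> R) (v w : V -> R) (lam K C eta kap k t : R) (x y z : V).
Hypotheses (eta0 : 0 < eta) (eta1 : eta <= 1) (C0 : 0 < C) (K0 : 0 < K).
Hypotheses (t0 : 0 < t) (Ox : Om x) (Oy : Om y) (Oz : Om z).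
Local Notation E t := (expR (- (lam * t))).

(** The difference of the two solutions and the comparison function, with
    separate spatial variables. *)
Definition doubled t x y z : R := U (t, x) - v y - E t * (K * w z + C * d x `^ eta) - kap * t.
Definition penalty x y z : R := enorm (x - y) ^+ 2 + enorm (x - z) ^+ 2.

Lemma penalty_shift q x1 y1 z1 : penalty (x1 - q) (y1 - q) (z1 - q) = penalty x1 y1 z1.
Proof.
have e a b : a - q - (b - q) = a - b by rewrite opprB addrA subrK.
by rewrite /penalty !e.
Qed.

Hypothesis doubled_max : forall t' x' y' z', 0 < t' -> Om x' -> Om y' -> Om z' ->
  doubled t' x' y' z' - k * penalty x' y' z' <= doubled t x y z - k * penalty x y z.

Lemma touching_v y' : Om y' -> - v y' <= quadratic y (- v y) (k *: (2 *: (y - x))) k y'.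
Proof.
move=> Oy'; have := doubled_max t0 Ox Oy' Oz; rewrite /doubled /penalty.
rewrite (penalty_quadratic x y y') /quadratic (dotvZl k) mul1r.
by move/penalty_touch.
Qed.

Lemma touching_w z' : Om z' ->
  - w z' <= quadratic z (- w z) ((k / (E t * K)) *: (2 *: (z - x))) (k / (E t * K)) z'.
Proof.
have EK : 0 < E t * K by rewrite mulr_gt0// expR_gt0.
move=> Oz'; have := doubled_max t0 Ox Oy Oz'; rewrite /doubled /penalty.
rewrite (penalty_quadratic x z z') /quadratic (dotvZl (_ / _)) mul1r.
move=> /penalty_touch_weighted h.
rewrite -(ler_pM2l EK); apply: le_trans h _.
have kk : E t * K * (k / (E t * K)) = k by rewrite mulrC divfK// gt_eqF.
by rewrite !mulrDr 2![_ * (_ / _ * _)]mulrA kk.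
Qed.

(** The touching function contains the barrier [d ^ eta] through a paraboloid above
    it, because [d ^ eta] is not differentiable. Its time derivative carries the
    rate [lam] of the exponential. *)
Lemma touching_U : exists (phi : R * V -> R) a (b : R), [/\ C2_on (cylinder Om) phi,
  forall q, cylinder Om q -> U q <= phi q,
  forall y', phi (t, y') = quadratic x (U (t, x)) a b y' &
  is_derive t 1 (fun t' : R => phi (t', x)) (kap - lam * (E t * (K * w z + C * d x `^ eta)))].
Proof.
have [p1 fp1 xp1] := bdist_attained Om0 oOm bOm x.
have hq := bdist_pow_quadratic Om0 oOm bOm eta0 eta1 Ox fp1 xp1.
set a := _ *: _ in hq; set b := eta / 2 * _ in hq.
pose B := quadratic x (d x `^ eta) a b.
pose P1 := quadratic x (enorm (y - x) ^+ 2) (2 *: (x - y)) 1.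
pose P2 := quadratic x (enorm (z - x) ^+ 2) (2 *: (x - z)) 1.
pose c := U (t, x) - E t * (K * w z + C * d x `^ eta) - kap * t - k * penalty x y z.
pose phi (q : R * V) := c +
  (expR ((- lam) * q.1) * (K * w z + C * B q.2) + (kap * q.1 + k * (P1 q.2 + P2 q.2))).
have oC := open_cylinder oOm.
have PE x' : P1 x' + P2 x' = penalty x' y z.
  by rewrite /penalty (enorm_sub x' y) (enorm_sub x' z) (penalty_quadratic y x x') (penalty_quadratic z x x').
have Bx : B x = d x `^ eta by exact: quadratic_center.
exists phi, ((E t * C) *: a + k *: (2 *: (x - y) + 2 *: (x - z))), (E t * C * b + k * 2); split.
- apply: (C2_add oC (C2_cst _ _)); apply: (C2_add oC).
    apply: (C2_mul oC); first by apply: (C2_exp oC); apply: (C2_mul oC (C2_cst _ _)); exact: C2_fst.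
    apply: (C2_add oC (C2_cst _ _)); apply: (C2_mul oC (C2_cst _ _)).
    exact: (C2_snd (quadratic_C2 x _ a b oOm)).
  apply: (C2_add oC); first by apply: (C2_mul oC (C2_cst _ _)); exact: C2_fst.
  apply: (C2_mul oC (C2_cst _ _)); apply: (C2_add oC).
    exact: (C2_snd (quadratic_C2 x _ _ _ oOm)).
  exact: (C2_snd (quadratic_C2 x _ _ _ oOm)).
- move=> [t' x'] [/= t'0 Ox']; rewrite in_itv/= andbT in t'0.
  have := doubled_max t'0 Ox' Oy Oz; rewrite /doubled /phi/= PE mulNr => /penalty_touch_time.
  apply; rewrite ler_wpM2l ?expR_ge0// lerD2l ler_wpM2l ?(ltW C0)//; exact: hq.
- move=> y'; rewrite /phi/= mulNr /c -PE /B /P1 /P2 !quadratic_center /quadratic.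
  rewrite (dotvDl ((E t * C) *: a)) (dotvZl k) (dotvDl (2 *: (x - y))) !dotvZl; ring.
- pose W := K * w z + C * d x `^ eta.
  have -> : (fun t' : R => phi (t', x)) =
      (fun t' => c + (expR ((- lam) * t') * W + (kap * t' + k * (P1 x + P2 x)))).
    by apply/funext => t'; rewrite /phi/= Bx.
  exact: is_derive_exp_affine.
Qed.

End maximum_point.

Lemma cvg_to_within {T : Type} {X : topologicalType} (F : set_system T) {FF : Filter F}
    (g : T -> X) (p : X) (D : set X) : g @ F --> p -> (\forall q \near F, D (g q)) ->
  g @ F --> within D (nbhs p).
Proof.
move=> gp gD W pW; have gW : \forall q \near F, D (g q) -> W (g q) by exact: (gp _ pW).
by apply: filterS2 gD gW => q Dq /(_ Dq).
Qed.

Lemma cvg_pair_nbhs {T : Type} {X Y : topologicalType} (F : set_system T) {FF : Filter F}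
    (f : T -> X) (g : T -> Y) (x : X) (y : Y) : f @ F --> x -> g @ F --> y ->
  (fun q => (f q, g q)) @ F --> (x, y).
Proof.
move=> fx gy W [[P Q] /= [xP yQ] PQ].
have FP : \forall q \near F, P (f q) by exact: (fx _ xP).
have FQ : \forall q \near F, Q (g q) by exact: (gy _ yQ).
have FW : \forall q \near F, W (f q, g q) by apply: filterS2 FP FQ => q Pq Qq; exact: PQ.
exact: FW.
Qed.

Lemma cvg_comp_pair {T : Type} {X Y Z : topologicalType} (F : set_system T) {FF : Filter F}
    (G : X * Y -> Z) (f : T -> X) (g : T -> Y) (x : X) (y : Y) :
  {for (x, y), continuous G} -> f @ F --> x -> g @ F --> y ->
  G (f q, g q) @[q --> F] --> G (x, y).
Proof. by move=> cG fx gy W /cG; exact: (cvg_pair_nbhs fx gy). Qed.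

Lemma coordinates_cvg {X Y Z W : topologicalType} (F : set_system (X * (Y * (Z * W)))) {FF : Filter F}
    (x : X) (y : Y) (z : Z) (w : W) : F --> (x, (y, (z, w))) ->
  [/\ (fun q : X * (Y * (Z * W)) => q.1) @ F --> x, (fun q : X * (Y * (Z * W)) => q.2.1) @ F --> y,
      (fun q : X * (Y * (Z * W)) => q.2.2.1) @ F --> z & (fun q : X * (Y * (Z * W)) => q.2.2.2) @ F --> w].
Proof.
move=> Fq; have c1 : (fun q : X * (Y * (Z * W)) => q.1) @ F --> x.
  by apply: cvg_trans (@cvg_fst _ _ (nbhs x) (nbhs (y, (z, w))) _); exact: cvg_app.
have c2 : (fun q : X * (Y * (Z * W)) => q.2) @ F --> (y, (z, w)).
  by apply: cvg_trans (@cvg_snd _ _ (nbhs x) (nbhs (y, (z, w))) _); exact: cvg_app.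
have c3 : (fun q : X * (Y * (Z * W)) => q.2.2) @ F --> (z, w).
  exact: (cvg_comp _ _ c2 (@cvg_snd _ _ (nbhs y) (nbhs (z, w)) _)).
split => //.
- exact: (cvg_comp _ _ c2 (@cvg_fst _ _ (nbhs y) (nbhs (z, w)) _)).
- exact: (cvg_comp _ _ c3 (@cvg_fst _ _ (nbhs z) (nbhs w) _)).
- exact: (cvg_comp _ _ c3 (@cvg_snd _ _ (nbhs z) (nbhs w) _)).
Qed.

Section comparison.
Context {R : realType} {n : nat}.
Local Notation V := 'rV[R]_n.+1.
Local Notation mu := (@lebesgue R n).
Local Notation mV := (caratheodory_type (@lebesgue_outer R n)).
Variable s : R.
Local Notation far_height := (@far_height R n s).
Hypothesis s01 : 0 < s < 1.
Variables (Om Sigma : set V).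
Hypotheses (Om0 : Om !=set0) (oOm : open Om) (bOm : bounded_set Om) (oS : open Sigma)
  (symS : Sigma = [set - z | z in Sigma]).
Local Notation sector := (sector_at Om Sigma).
Local Notation d := (bdist Om).
Local Notation far := (@far R n s).
Local Notation near := (@near R n s Sigma).
Implicit Types (D : set V) (x y z a b : V) (r t k : R).

Variables (A : V -> set V) (At : R * V -> set V) (h f : V -> R) (ht ft : R * V -> R).
Variables (U : R * V -> R) (v w : V -> R).
Variables (lam lambar zeta cm cf alpha eta M C K C1 C2 : R).

Hypotheses (cU : continuous U) (cv : continuous v) (cw : continuous w).
Hypothesis UM : forall t y, 0 < t -> Om y -> `|U (t, y)| <= M.
Hypothesis Ujet : forall t x phi a (b D : R), 0 < t -> Om x -> C2_on (cylinder Om) phi ->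
  (forall q, cylinder Om q -> U q <= phi q) ->
  (forall y, phi (t, y) = quadratic x (U (t, x)) a b y) ->
  is_derive t 1 (fun t' : R => phi (t', x)) D ->
  Ls_le s (At (t, x)) (fun y => U (t, y)) x (ft (t, x) - D - ht (t, x) * U (t, x)).
Hypothesis vjet : forall x a (b : R), Om x ->
  (forall y, Om y -> - v y <= quadratic x (- v x) a b y) ->
  Ls_le s (A x) (fun y => - v y) x (h x * v x - f x).
Hypothesis wjet : forall x a (b : R), Om x ->
  (forall y, Om y -> - w y <= quadratic x (- w x) a b y) ->
  Ls_le s (A x) (fun y => - w y) x (h x * w x - lambar * w x).

Hypotheses (zeta0 : 0 < zeta) (cm0 : 0 < cm) (cf0 : 0 < cf).
Hypothesis Asector : forall x, Om x -> sector (A x) x (2 * zeta * d x).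
Hypothesis Atsector : forall t x, 0 < t -> Om x -> sector (At (t, x)) x (2 * zeta * d x).
Hypothesis moment_le : forall rho r, 0 < rho -> 0 < r ->
  second_moment s Sigma rho r <= cm * r `^ (2 - 2 * s).
Hypothesis far_barrier_le : forall D (eta r : R) x, 0 < eta -> eta <= s ->
  lebesgue_measurable D -> D `<=` Om -> Om x -> 0 < r ->
  - (eta / s * d x `^ (eta - s) * (cf * r `^ (- s))) <= far D (fun y => d y `^ eta) x r.
Hypotheses (eta0 : 0 < eta) (etas : eta <= s) (C0 : 0 < C) (K0 : 0 < K).

Local Notation E t := (expR (- (lam * t))).

Let eta1 : eta <= 1.
Proof. by case/andP: s01 => s0 s1; rewrite (le_trans etas)// ltW. Qed.

(** At a maximum point of the penalized difference the three viscosity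
    inequalities are added. A common shift of the three points by a vector of
    [Sigma] leaves the penalty unchanged, so that the near parts, which live on
    the same sector, compare with that of [d ^ eta]. *)
Lemma max_point_inequality kap k t x y z r :
  0 < t -> Om x -> Om y -> Om z ->
  (forall t' x' y' z', 0 < t' -> Om x' -> Om y' -> Om z' ->
    doubled Om U v w lam K C eta kap t' x' y' z' - k * penalty x' y' z' <=
    doubled Om U v w lam K C eta kap t x y z - k * penalty x y z) ->
  0 < r -> r <= 2 * zeta * d x -> r <= 2 * zeta * d y -> r <= 2 * zeta * d z ->
  far (At (t, x)) (fun y => U (t, y)) x r + far (A y) (fun y => - v y) y r +
    E t * K * far (A z) (fun z => - w z) z r -
    E t * C * (eta / 2 * d x `^ (eta - 2) * (cm * r `^ (2 - 2 * s))) <=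
  ft (t, x) - (kap - lam * (E t * (K * w z + C * d x `^ eta))) - ht (t, x) * U (t, x) +
    (h y * v y - f y) + E t * K * (h z * w z - lambar * w z).
Proof.
move=> t0 Ox Oy Oz hmax r0 rx ry rz.
have EK0 : 0 < E t * K by rewrite mulr_gt0// expR_gt0.
have EC0 : 0 < E t * C by rewrite mulr_gt0// expR_gt0.
have [phi [a [b [C2phi Uphi phiq phid]]]] := touching_U Om0 oOm bOm eta0 eta1 C0 Ox Oy Oz hmax.
have jU := Ujet t0 Ox C2phi Uphi phiq phid.
have jv := vjet Oy (touching_v t0 Ox Oz hmax).
have jw := wjet Oz (touching_w K0 t0 Ox Oy hmax).
have sU := sector_at_le r0 rx (Atsector t0 Ox).
have sv := sector_at_le r0 ry (Asector Oy).
have sw := sector_at_le r0 rz (Asector Oz).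
have cUt := slice_continuous (t0 := t) cU.
have cvN := continuous_oppf cv; have cwN := continuous_oppf cw.
have tU := tame_continuous bOm cUt; have tv := tame_continuous bOm cvN.
have tw := tame_continuous bOm cwN; have td := tame_dist Om0 oOm bOm eta0 eta1.
have [mU [MU hU]] := tU; have [mv [Mv hv]] := tv; have [mw [Mw hw]] := tw.
apply/ler_addgt0Pr => e e0.
have N0 : 0 < 2 + E t * K by rewrite addr_gt0.
have e10 : 0 < e / (2 + E t * K) by rewrite divr_gt0.
have [d1 d10 h1] := near_far_le s01 bOm sU mU hU jU e10.
have [d2 d20 h2] := near_far_le s01 bOm sv mv hv jv e10.
have [d3 d30 h3] := near_far_le s01 bOm sw mw hw jw e10.
pose delta := Num.min d1 (Num.min d2 d3) / 2.
have m0 : 0 < Num.min d1 (Num.min d2 d3) by rewrite !lt_min d10 d20 d30.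
have de0 : 0 < delta by rewrite divr_gt0.
have : delta < Num.min d1 (Num.min d2 d3) by rewrite ltr_pdivrMr// ltr_pMr// ltr1n.
rewrite !lt_min => /andP[/(h1 _ de0){}h1 /andP[/(h2 _ de0){}h2 /(h3 _ de0){}h3]].
have sUn := tame_near_summable s01 oS tU sU de0; have svn := tame_near_summable s01 oS tv sv de0.
have swn := tame_near_summable s01 oS tw sw de0; have sdn := tame_near_summable s01 oS td sU de0.
have mD : lebesgue_measurable (shell Sigma 0 delta r) by exact: shell_measurable (measurable_Sigma oS).
have N1 : E t * C * near (fun y => d y `^ eta) x r delta <=
    near (fun y => U (t, y)) x r delta + near (fun y => - v y) y r delta +
    E t * K * near (fun z => - w z) z r delta.
  have sEw := summableZ (E t * K) mD swn; have sEd := summableZ (E t * C) mD sdn.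
  have sUv := summableD mD sUn svn; have sUvw := summableD mD sUv sEw.
  rewrite /near -(RintZ (E t * K) mD swn) -(RintZ (E t * C) mD sdn) -(RintD mD sUn svn).
  rewrite -(RintD mD sUv sEw); apply: (le_Rint mD sEd sUvw) => q Dq.
  rewrite !mulrA -!mulrDl ler_wpM2r//; first exact: near_kernel_ge0 Dq.
  have := hmax t (x - q) (y - q) (z - q) t0 (sector_sub sU Dq) (sector_sub sv Dq) (sector_sub sw Dq).
  rewrite penalty_shift lerD2r /doubled; exact: shift_increments.
have N2 := near_barrier s01 Om0 oOm bOm oS symS eta0 eta1 sU (fun rho rho0 => moment_le rho0 r0) de0.
have eE : e = e / (2 + E t * K) * (2 + E t * K) by rewrite mulfVK// gt_eqF.
rewrite eE; exact: (add_inequalities h1 h2 h3 (ltW EK0) (ltW EC0) N1 N2).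
Qed.

Hypothesis h_cont : forall x, Om x -> {for x, continuous h}.
Hypothesis f_cont : forall x, Om x -> {for x, continuous f}.
Hypothesis ht_cont : forall t x, 0 < t -> Om x -> {for (t, x), continuous ht}.
Hypothesis ft_cont : forall t x, 0 < t -> Om x -> {for (t, x), continuous ft}.
Hypothesis A_cont : forall x, Om x -> mu (A y `+` A x) @[y --> within Om (nbhs x)] --> 0%E.
Hypothesis At_cont : forall t x, 0 < t -> Om x ->
  mu (At p `+` At (t, x)) @[p --> within (cylinder Om) (nbhs (t, x))] --> 0%E.

Lemma far_cvg_stationary {T : Type} {F : set_system T} {FF : Filter F} (g : V -> R) (x : T -> V)
    (x0 : V) r : continuous g -> Om x0 -> 0 < r -> x @ F --> x0 ->
  far (A (x q)) g (x q) r @[q --> F] --> far (A x0) g x0 r.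
Proof.
move=> cg Ox0 r0 cx; have [_ [M' hM']] := tame_continuous bOm cg.
have cG : continuous (fun p : R * V => g p.2).
  by move=> [a b]; exact: (cvg_comp _ _ (@cvg_snd _ _ (nbhs a) (nbhs b) _) (cg b)).
have hM2 t y : 0 < t -> Om y -> `|g y| <= M' by move=> _; exact: hM'.
have [mA AO _ _ _] := Asector Ox0.
have xO : \forall q \near F, Om (x q) by apply: cx; exact: open_nbhs_nbhs.
apply: (@far_cvg _ _ s s01 Om oOm bOm _ F FF _ (fun=> 1) x (fun q => A (x q)) 1 x0 (A x0) r M' cG hM2) => //.
- exact: cvg_cst.
- by apply: (cvg_comp _ _ _ (A_cont Ox0)); exact: cvg_to_within.
- by apply: filterS xO => q Oq _ _; have [] := Asector Oq.
Qed.

Lemma far_cvg_evolving {T : Type} {F : set_system T} {FF : Filter F} (t : T -> R) (x : T -> V)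
    (t0 : R) (x0 : V) r : 0 < t0 -> Om x0 -> 0 < r -> t @ F --> t0 -> x @ F --> x0 ->
  far (At (t q, x q)) (fun y => U (t q, y)) (x q) r @[q --> F] -->
  far (At (t0, x0)) (fun y => U (t0, y)) x0 r.
Proof.
move=> t00 Ox0 r0 ct cx; have [mA AO _ _ _] := Atsector t00 Ox0.
have xO : \forall q \near F, Om (x q) by apply: cx; exact: open_nbhs_nbhs.
have t_0 : \forall q \near F, 0 < t q by apply: cvgr_gt ct _ t00.
apply: (@far_cvg _ _ s s01 Om oOm bOm _ F FF U t x (fun q => At (t q, x q)) t0 x0 _ r M cU UM) => //.
- apply: (cvg_comp _ _ _ (At_cont t00 Ox0)); apply: cvg_to_within; first exact: cvg_pair_nbhs.
  by apply: filterS2 xO t_0 => q Oq tq; exact: cylinder_in.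
- by apply: filterS2 xO t_0 => q Oq tq _ _; have [] := Atsector tq Oq.
Qed.

(** The inequality at the maximum points passes to the limit, where the three
    points coincide. *)
Lemma limit_inequality kap (Mx : set (R * (V * (V * V)))) t0 x0 :
  closure Mx (t0, (x0, (x0, x0))) -> 0 < t0 -> Om x0 ->
  (forall t x y z, Mx (t, (x, (y, z))) -> exists k,
    forall t' x' y' z', 0 < t' -> Om x' -> Om y' -> Om z' ->
      doubled Om U v w lam K C eta kap t' x' y' z' - k * penalty x' y' z' <=
      doubled Om U v w lam K C eta kap t x y z - k * penalty x y z) ->
  far (At (t0, x0)) (fun y => U (t0, y)) x0 (zeta * d x0) +
    far (A x0) (fun y => - v y) x0 (zeta * d x0) +
    E t0 * K * far (A x0) (fun z => - w z) x0 (zeta * d x0) -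
    E t0 * C * (eta / 2 * d x0 `^ (eta - 2) * (cm * (zeta * d x0) `^ (2 - 2 * s))) <=
  ft (t0, x0) - (kap - lam * (E t0 * (K * w x0 + C * d x0 `^ eta))) - ht (t0, x0) * U (t0, x0) +
    (h x0 * v x0 - f x0) + E t0 * K * (h x0 * w x0 - lambar * w x0).
Proof.
move=> cMx t00 Ox0 hMx; have dx0 := bdist_gt0 Om0 oOm bOm Ox0.
set q0 := (t0, (x0, (x0, x0))); pose Fil := within Mx (nbhs q0).
have PF : ProperFilter Fil by exact: within_nbhs_proper.
have FF : Filter Fil by exact: PF.
have [ct cx cy cz] : [/\ (fun q : R * (V * (V * V)) => q.1) @ Fil --> t0,
    (fun q : R * (V * (V * V)) => q.2.1) @ Fil --> x0,
    (fun q : R * (V * (V * V)) => q.2.2.1) @ Fil --> x0 &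
    (fun q : R * (V * (V * V)) => q.2.2.2) @ Fil --> x0].
  by apply: coordinates_cvg; exact: cvg_within.
have r0 : 0 < zeta * d x0 by rewrite mulr_gt0.
have cE : (fun q : R * (V * (V * V)) => E q.1) @ Fil --> E t0.
  have ce : {for t0, continuous (fun t : R => E t)}.
    apply: (@continuous_comp _ _ _ (fun t : R => - (lam * t)) (@expR R)); last exact: continuous_expR.
    by apply: cvgN; apply: cvgMr; exact: cvg_id.
  exact: (cvg_comp _ _ ct ce).
have cd (g : R * (V * (V * V)) -> V) : g @ Fil --> x0 -> d (g q) @[q --> Fil] --> d x0.
  by move=> cg; exact: (cvg_comp _ _ cg (bdist_continuous Om0 oOm bOm (x := x0))).
have cp (th : R) : d q.2.1 `^ th @[q --> Fil] --> d x0 `^ th.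
  exact: (cvg_comp _ _ (cd _ cx) (powR_pos_continuous (q := th) dx0)).
have cUx : U (q.1, q.2.1) @[q --> Fil] --> U (t0, x0).
  exact: (cvg_comp_pair (@cU (t0, x0)) ct cx).
have chtx : ht (q.1, q.2.1) @[q --> Fil] --> ht (t0, x0).
  exact: (cvg_comp_pair (@ht_cont t0 x0 t00 Ox0) ct cx).
have cftx : ft (q.1, q.2.1) @[q --> Fil] --> ft (t0, x0).
  exact: (cvg_comp_pair (@ft_cont t0 x0 t00 Ox0) ct cx).
have cvy : v q.2.2.1 @[q --> Fil] --> v x0 by exact: (cvg_comp _ _ cy (@cv x0)).
have chy : h q.2.2.1 @[q --> Fil] --> h x0 by exact: (cvg_comp _ _ cy (@h_cont x0 Ox0)).
have cfy : f q.2.2.1 @[q --> Fil] --> f x0 by exact: (cvg_comp _ _ cy (@f_cont x0 Ox0)).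
have cwz : w q.2.2.2 @[q --> Fil] --> w x0 by exact: (cvg_comp _ _ cz (@cw x0)).
have chz : h q.2.2.2 @[q --> Fil] --> h x0 by exact: (cvg_comp _ _ cz (@h_cont x0 Ox0)).
have farU := far_cvg_evolving (FF := FF) t00 Ox0 r0 ct cx.
have farv := far_cvg_stationary (FF := FF) (continuous_oppf cv) Ox0 r0 cy.
have farw := far_cvg_stationary (FF := FF) (continuous_oppf cw) Ox0 r0 cz.
have cB : eta / 2 * d q.2.1 `^ (eta - 2) * (cm * (zeta * d x0) `^ (2 - 2 * s)) @[q --> Fil] -->
    eta / 2 * d x0 `^ (eta - 2) * (cm * (zeta * d x0) `^ (2 - 2 * s)).
  exact: (cvgM (cvgMr (cp (eta - 2))) (cvg_cst _)).
have cPsi : K * w q.2.2.2 + C * d q.2.1 `^ eta @[q --> Fil] --> K * w x0 + C * d x0 `^ eta.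
  exact: (cvgD (cvgMr cwz) (cvgMr (cp eta))).
apply: ler_cvg_to; first exact: PF.
- exact: (cvgB (cvgD (cvgD farU farv) (cvgM (cvgM cE (cvg_cst K)) farw))
    (cvgM (cvgM cE (cvg_cst C)) cB)).
- exact: (cvgD (cvgD (cvgB (cvgB cftx (cvgB (cvg_cst kap) (cvgMr (cvgM cE cPsi)))) (cvgM chtx cUx))
    (cvgB (cvgM chy cvy) cfy)) (cvgM (cvgM cE (cvg_cst K)) (cvgB (cvgM chz cwz) (cvgMr cwz)))).
have nd (g : R * (V * (V * V)) -> V) : g @ Fil --> x0 ->
    \forall q \near Fil, Om (g q) /\ zeta * d x0 <= 2 * zeta * d (g q).
  move=> cg; have h1 : \forall q \near Fil, Om (g q) by apply: cg; exact: open_nbhs_nbhs.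
  have h2 : d x0 / 2 < d x0 by rewrite ltr_pdivrMr// ltr_pMr// ltr1n.
  have h3 : \forall q \near Fil, d x0 / 2 < d (g q) by apply: cvgr_gt (cd _ cg) _ h2.
  apply: filterS2 h1 h3 => q Oq dq; split => //.
  by rewrite (mulrC 2) -mulrA ler_pM2l// mulrC -ler_pdivrMr// ltW.
have nt : \forall q \near Fil, 0 < q.1 by apply: cvgr_gt ct _ t00.
have nM : \forall q \near Fil, Mx q by exact: withinT.
near=> q; have [Ox rx] : Om q.2.1 /\ zeta * d x0 <= 2 * zeta * d q.2.1 by near: q; exact: nd.
have [Oy ry] : Om q.2.2.1 /\ zeta * d x0 <= 2 * zeta * d q.2.2.1 by near: q; exact: nd.
have [Oz rz] : Om q.2.2.2 /\ zeta * d x0 <= 2 * zeta * d q.2.2.2 by near: q; exact: nd.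
have tq : 0 < q.1 by near: q.
have Mq : Mx (q.1, (q.2.1, (q.2.2.1, q.2.2.2))) by rewrite -!surjective_pairing; near: q.
have [k hk] := hMx _ _ _ _ Mq.
exact: (max_point_inequality tq Ox Oy Oz hk r0 rx ry rz).
Unshelve. all: by end_near. Qed.

Hypothesis alpha0 : 0 < alpha.
Hypothesis h_ge : forall x, Om x -> alpha / d x `^ (2 * s) <= h x.
Hypothesis data_conv : forall t x, 0 < t -> Om x ->
  `|ft (t, x) - f x| + `|ht (t, x) - h x| <= C1 * d x `^ (eta - 2 * s) * E t.
Hypothesis set_conv : forall t x, 0 < t -> Om x ->
  fine (mu (At (t, x) `+` A x)) <= C2 * d x `^ (n.+1%:R + eta) * E t.
Hypothesis eta_small :
  eta * (cm / 2 * zeta `^ (2 - 2 * s) + cf / s * zeta `^ (- s)) <= alpha / 2.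
Hypothesis constants : forall x, Om x ->
  C1 * (1 + M) * d x `^ (eta - 2 * s) +
  2 * M * (zeta `^ (n.+1%:R + 2 * s))^-1 * C2 * d x `^ (eta - 2 * s) -
  C * (alpha / 2 * d x `^ (eta - 2 * s)) + lam * (K * w x + C * d x `^ eta) -
  lambar * (K * w x) <= 0.

Lemma doubled_continuous kap : continuous (fun q : R * (V * (V * V)) =>
  doubled Om U v w lam K C eta kap q.1 q.2.1 q.2.2.1 q.2.2.2).
Proof.
move=> [t0 [x0 [y0 z0]]]; set q0 := (t0, _).
have [ct cx cy cz] := coordinates_cvg (@cvg_id _ (nbhs q0)).
have cE : E q.1 @[q --> nbhs q0] --> E t0.
  have ce : {for t0, continuous (fun t : R => E t)}.
    apply: (@continuous_comp _ _ _ (fun t : R => - (lam * t)) (@expR R)); last exact: continuous_expR.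
    by apply: cvgN; apply: cvgMr; exact: cvg_id.
  exact: (cvg_comp _ _ ct ce).
have cUx : U (q.1, q.2.1) @[q --> nbhs q0] --> U (t0, x0) by exact: (cvg_comp_pair (@cU (t0, x0)) ct cx).
have cvy : v q.2.2.1 @[q --> nbhs q0] --> v y0 by exact: (cvg_comp _ _ cy (@cv y0)).
have cwz : w q.2.2.2 @[q --> nbhs q0] --> w z0 by exact: (cvg_comp _ _ cz (@cw z0)).
have cdx : d q.2.1 `^ eta @[q --> nbhs q0] --> d x0 `^ eta.
  exact: (cvg_comp _ _ cx (bdist_pow_continuous Om0 oOm bOm eta0 eta1 (x := x0))).
exact: (cvgB (cvgB (cvgB cUx cvy) (cvgM cE (cvgD (cvgMr cwz) (cvgMr cdx)))) (cvgMr ct)).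
Qed.

Lemma penalty_continuous : continuous (fun q : R * (V * (V * V)) => penalty q.2.1 q.2.2.1 q.2.2.2).
Proof.
move=> [t0 [x0 [y0 z0]]]; set q0 := (t0, _).
have [_ cx cy cz] := coordinates_cvg (@cvg_id _ (nbhs q0)).
have cxy : enorm (q.2.1 - q.2.2.1) @[q --> nbhs q0] --> enorm (x0 - y0).
  exact: (cvg_comp _ _ (cvgB cx cy) (@enorm_continuous R n (x0 - y0))).
have cxz : enorm (q.2.1 - q.2.2.2) @[q --> nbhs q0] --> enorm (x0 - z0).
  exact: (cvg_comp _ _ (cvgB cx cz) (@enorm_continuous R n (x0 - z0))).
exact: (cvgD (cvgM cxy cxy) (cvgM cxz cxz)).
Qed.

(** At the limit point, a maximum point of the difference, the far part of
    [U - v - E (K w + C d ^ eta)] is nonnegative. The sets [At] and [A] are exchanged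
    at the cost of the volume of their symmetric difference. The zero order terms
    leave [- alpha C d ^ (eta - 2 s) E], half of which pays for the barrier, and the
    eigenvalue equation leaves [(lam - lambar) K w E]. *)
Lemma limit_point_contradiction kap t0 x0 : 0 < t0 -> Om x0 ->
  far (At (t0, x0)) (fun y => U (t0, y)) x0 (zeta * d x0) +
    far (A x0) (fun y => - v y) x0 (zeta * d x0) +
    E t0 * K * far (A x0) (fun z => - w z) x0 (zeta * d x0) -
    E t0 * C * (eta / 2 * d x0 `^ (eta - 2) * (cm * (zeta * d x0) `^ (2 - 2 * s))) <=
  ft (t0, x0) - (kap - lam * (E t0 * (K * w x0 + C * d x0 `^ eta))) - ht (t0, x0) * U (t0, x0) +
    (h x0 * v x0 - f x0) + E t0 * K * (h x0 * w x0 - lambar * w x0) ->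
  (forall y, Om y -> U (t0, y) - v y - E t0 * (K * w y + C * d y `^ eta) <=
    U (t0, x0) - v x0 - E t0 * (K * w x0 + C * d x0 `^ eta)) ->
  0 <= U (t0, x0) - v x0 - E t0 * (K * w x0 + C * d x0 `^ eta) -> kap <= 0.
Proof.
move=> t00 Ox0 lim gmax gpos; have dx0 := bdist_gt0 Om0 oOm bOm Ox0.
have r0 : 0 < zeta * d x0 by rewrite mulr_gt0.
have e0 : 0 < E t0 by exact: expR_gt0.
have [s0 _] := andP s01.
have [mA AO _ _ _] := Asector Ox0; have [mAt AtO _ _ _] := Atsector t00 Ox0.
have cUt := slice_continuous (t0 := t0) cU.
have tU := tame_continuous bOm cUt; have td := tame_dist Om0 oOm bOm eta0 eta1.
have tv := tame_continuous bOm (continuous_oppf cv).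
have tw := tame_continuous bOm (continuous_oppf cw).
have [mU _] := tU; have hU : forall y, Om y -> `|U (t0, y)| <= M by move=> y; exact: UM.
have M0 : 0 <= M by apply: le_trans (hU x0 Ox0).
pose D := d x0 `^ (eta - 2 * s).
apply: (@limit_arithmetic _ _ (far (A x0) (fun y => U (t0, y)) x0 (zeta * d x0)) _ _
  (far (A x0) (fun y => d y `^ eta) x0 (zeta * d x0)) _
  (eta / s * d x0 `^ (eta - s) * (cf * (zeta * d x0) `^ (- s))) (alpha / 2 * D)
  (2 * M * (zeta `^ (n.+1%:R + 2 * s))^-1 * C2 * D) (C1 * (1 + M) * D) _ _ _ _ _ _ _ _ _ _ _ _ _ _ _
  e0 C0 lim).
- have := far_symdiff s01 bOm mA mAt AO AtO Ox0 r0 mU hU.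
  rewrite ler_norml => /andP[_]; move/le_trans; apply.
  apply: (@le_trans _ _ (2 * M * far_height (zeta * d x0) * (C2 * d x0 `^ (n.+1%:R + eta) * E t0))).
    rewrite setYC; apply: ler_wpM2l; last exact: set_conv.
    by rewrite !mulr_ge0// ltW// far_height_gt0.
  have -> : far_height (zeta * d x0) = (zeta `^ (n.+1%:R + 2 * s))^-1 * d x0 `^ (- (n.+1%:R + 2 * s)).
    by rewrite /far_height powRM ?(ltW zeta0) ?(ltW dx0)// invfM powRN.
  have -> : D = d x0 `^ (- (n.+1%:R + 2 * s)) * d x0 `^ (n.+1%:R + eta).
    by rewrite -powRD ?(gt_eqF dx0) ?implybT// /D; congr (_ `^ _); ring.
  by rewrite le_eqVlt; apply/orP; left; apply/eqP; ring.
- have t1 := tame_lin 1 tv tU; have t2 := tame_lin (E t0 * K) tw t1.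
  have F1 := far_lin s01 bOm (- (E t0 * C)) mA AO Ox0 r0 td t2.
  have F2 := far_lin s01 bOm (E t0 * K) mA AO Ox0 r0 tw t1.
  have F3 := far_lin s01 bOm 1 mA AO Ox0 r0 tv tU.
  cbv beta in F1, F2, F3; rewrite F3 in F2; rewrite F2 in F1.
  apply: comparison_regroup; rewrite -F1; apply: (far_ge0 s _ AO).
  by move=> y Oy; apply: combination_regroup; exact: gmax.
- exact: far_barrier_le eta0 etas mA AO Ox0 r0.
- by rewrite barrier_sum// /D ler_wpM2r ?powR_ge0.
- apply: (@le_trans _ _ (`|ft (t0, x0) - f x0| + `|ht (t0, x0) - h x0| * M)).
    rewrite lerD ?ler_norm//; apply: le_trans (ler_norm _) _.
    by rewrite normrM distrC ler_wpM2l// hU.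
  have hc := data_conv t00 Ox0.
  apply: (@le_trans _ _ ((`|ft (t0, x0) - f x0| + `|ht (t0, x0) - h x0|) * (1 + M))).
    exact: ler_weighted_sum.
  apply: (@le_trans _ _ (C1 * d x0 `^ (eta - 2 * s) * E t0 * (1 + M))).
    by rewrite ler_wpM2r// addr_ge0.
  by rewrite le_eqVlt /D; apply/orP; left; apply/eqP; ring.
- by [].
- rewrite ler_wpM2l//; last by rewrite -subr_ge0.
  by apply: le_trans (h_ge Ox0); rewrite divr_ge0 ?powR_ge0// ltW.
- apply: (@le_trans _ _ (alpha / d x0 `^ (2 * s) * d x0 `^ eta)); last first.
    by rewrite ler_wpM2r ?powR_ge0// h_ge.
  have -> : alpha / d x0 `^ (2 * s) * d x0 `^ eta = alpha * D.
    by rewrite -mulrA -powRN -powRD ?(gt_eqF dx0) ?implybT//; congr (_ * _ `^ _); rewrite addrC.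
  by rewrite mulrA (mulrC 2) divfK.
- exact: constants Ox0.
Qed.

Hypothesis w0 : forall x, Om x -> 0 < w x.
Hypothesis U_frontier : forall t x, 0 <= t -> frontier Om x -> U (t, x) = 0.
Hypothesis v_frontier : forall x, frontier Om x -> v x = 0.
Hypothesis w_frontier : forall x, frontier Om x -> w x = 0.
Hypothesis U_initial : forall x, Om x -> U (0, x) - v x <= C * d x `^ eta.

(** A positive value of the difference minus [kap t] would be attained, at a positive
    time because of the initial condition and inside [Om] because all the functions
    vanish on the boundary. The term [kap t] confines the maximum to bounded times
    and makes the final inequality strict; then [kap] tends to [0]. *)
Lemma parabolic_comparison t x : 0 < t -> Om x -> U (t, x) - v x <= E t * (K * w x + C * d x `^ eta).
Proof.
move=> t1 Ox1.
suff main kap : 0 < kap -> doubled Om U v w lam K C eta kap t x x x <= 0.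
  apply/ler_addgt0Pr => e e0; have := main (e / t) (divr_gt0 e0 t1).
  by rewrite /doubled divfK ?gt_eqF// subr_le0 lerBlDl.
move=> kap0; rewrite leNgt; apply/negP => F1.
pose cl := closure Om; have cK : compact cl := compact_closure bOm.
have split_closure y : cl y -> Om y \/ frontier Om y.
  by move=> Ky; have [|nO] := pselect (Om y); [left|right; rewrite frontierE].
have [Mv [Mv0 hMv]] : exists Mv, 0 <= Mv /\ forall y, cl y -> `|v y| <= Mv.
  have [Mv [_ hM]] := compact_bounded (continuous_compact (continuous_subspaceT cv) cK).
  exists (`|Mv| + 1); split; first by rewrite addr_ge0.
  by move=> y Ky; apply: (hM (`|Mv| + 1)); [rewrite ltr_pwDr// ler_norm|exists y].
have M0 : 0 <= M by apply: le_trans (UM t1 Ox1).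
have wcl y : cl y -> 0 <= w y by move=> /split_closure[/w0/ltW//|/w_frontier->].
have Psi0 y z : cl z -> 0 <= K * w z + C * d y `^ eta.
  by move=> /wcl wz; rewrite addr_ge0// mulr_ge0 ?powR_ge0// ltW.
(* after this time the difference minus [kap t] is negative *)
pose T := Num.max t ((M + Mv) / kap).
pose S : set (R * (V * (V * V))) := `[0, T]%classic `*` (cl `*` (cl `*` cl)).
have cS : compact S by do !apply: compact_setX => //; exact: segment_compact.
have S1 : S (t, (x, (x, x))).
  by do !split => //=; rewrite ?in_itv/= ?(ltW t1) ?le_max ?lexx//; exact: sub_closure.
pose F (q : R * (V * (V * V))) := doubled Om U v w lam K C eta kap q.1 q.2.1 q.2.2.1 q.2.2.2.
pose P (q : R * (V * (V * V))) := penalty q.2.1 q.2.2.1 q.2.2.2.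
have P0 q : 0 <= P q by rewrite addr_ge0// sqr_ge0.
have Pdiag t' y : P (t', (y, (y, y))) = 0 by rewrite /P /penalty/= subrr enorm0 expr0n/= addr0.
have [[t0 [x0 [y0 z0]]] [Sq Pq Fq cq]] :=
  penalized_max_cluster cS S1 (Pdiag t x) (@doubled_continuous kap) penalty_continuous P0.
have [xy xz] : y0 = x0 /\ z0 = x0.
  have /eqP := Pq; rewrite /P /penalty/= paddr_eq0 ?sqr_ge0// !sqrf_eq0 => /andP[/eqP h1 /eqP h2].
  by split; apply/esym/eqP; rewrite -subr_eq0; apply/eqP; exact: enorm_eq0.
move: Sq Pq Fq cq; rewrite {}xy {}xz => Sq _ Fq cq.
have [/= t0T [x0cl _]] := Sq; move: t0T; rewrite in_itv/= => /andP[t0_ge0 _].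
have Fpos : 0 < doubled Om U v w lam K C eta kap t0 x0 x0 x0.
  by apply: lt_le_trans F1 _; exact: (Fq _ S1 (Pdiag t x)).
have Ox0 : Om x0.
  have [//|fx] := split_closure _ x0cl; move: Fpos.
  rewrite /doubled U_frontier// v_frontier// subrr sub0r -opprD oppr_gt0 ltNge.
  by rewrite addr_ge0// mulr_ge0 ?expR_ge0 ?Psi0// ltW.
have t00 : 0 < t0.
  rewrite lt_neqAle t0_ge0 andbT; apply/negP => /eqP t0E; move: Fpos; rewrite -t0E.
  rewrite /doubled !mulr0 oppr0 expR0 mul1r addr0 subr_gt0 ltNge.
  by rewrite (le_trans (U_initial Ox0))// lerDr mulr_ge0 ?wcl// ltW.
have := kap0; apply/negP; rewrite -leNgt.
apply: (limit_point_contradiction t00 Ox0 (limit_inequality cq t00 Ox0 _)).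
- move=> t' x' y' z' [Sp [k k0 hk]]; exists k => t2 x2 y2 z2 t20 Ox2 Oy2 Oz2.
  have [t2T|Tt2] := leP t2 T.
    apply: (hk (t2, (x2, (y2, z2)))).
    by do !split => //=; rewrite ?in_itv/= ?(ltW t20)//; exact: sub_closure.
  apply: (@le_trans _ _ 0).
    have pen0 : 0 <= k * penalty x2 y2 z2 by rewrite mulr_ge0 ?(ltW k0)//; exact: (P0 (t2, (x2, (y2, z2)))).
    have kt : M + Mv <= kap * t2.
      rewrite mulrC -ler_pdivrMr//; apply/ltW; apply: le_lt_trans Tt2.
      by rewrite le_max lexx orbT.
    have h1 : U (t2, x2) <= M by apply: le_trans (ler_norm _) (UM t20 Ox2).
    have h2 : - v y2 <= Mv.
      by apply: le_trans (ler_norm _) _; rewrite normrN; apply: hMv; exact: sub_closure.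
    have h3 : 0 <= E t2 * (K * w z2 + C * d x2 `^ eta).
      by rewrite mulr_ge0 ?expR_ge0// Psi0//; exact: sub_closure.
    rewrite subr_le0; apply: le_trans pen0; rewrite /doubled.
    exact: value_le0 h1 h2 h3 kt.
  apply: le_trans (hk _ S1); rewrite /= -/(P (t, (x, (x, x)))) Pdiag mulr0 subr0; exact: ltW.
- move=> y Oy; have Sy : S (t0, (y, (y, y))).
    by do !split => //=; (try exact: sub_closure); have [] := Sq.
  have := Fq _ Sy (Pdiag t0 y); rewrite /= /doubled.
  by rewrite lerD2r.
- by apply: ltW; apply: lt_le_trans Fpos _; rewrite /doubled gerBl mulr_ge0// ltW.
Qed.

End comparison.

(** * Extensions, constants and conclusion *)

Section extension.
Context {R : realType}.

Lemma open_within_continuous {X : topologicalType} (D : set X) (g : X -> R) x : open D ->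
  {within D, continuous g} -> D x -> {for x, continuous g}.
Proof. by move=> oD; rewrite continuous_open_subspace// => cg Dx; apply: cg; rewrite inE. Qed.

Lemma bounded_extension {X : pseudoMetricType R} (D : set X) (g : X -> R) (M : R) : closed D ->
  {within D, continuous g} -> (forall x, D x -> `|g x| <= M) ->
  exists G : X -> R, continuous G /\ forall x, D x -> g x = G x.
Proof.
move=> cD cg gM; have M1 : 0 < `|M| + 1 by rewrite ltr_pwDr.
have gM1 x : D x -> `|g x| <= `|M| + 1.
  by move=> /gM/le_trans; apply; rewrite (le_trans (ler_norm M))// lerDl.
have nX : normal_space X := @pseudometric_normal R X.
have [G [gG cG _]] := @continuous_bounded_extension X R nX D cD g _ M1 cg gM1.
by exists G; split => // x Dx; apply: gG; rewrite inE.
Qed.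

Lemma powR_weaken (x D a b : R) : 0 < x -> x <= D -> b <= a -> x `^ a <= D `^ (a - b) * x `^ b.
Proof.
move=> x0 xD ba; have -> : x `^ a = x `^ (a - b) * x `^ b.
  by rewrite -powRD ?(gt_eqF x0) ?implybT// subrK.
rewrite ler_wpM2r ?powR_ge0//; apply: ge0_ler_powR; rewrite ?nnegrE ?(ltW x0) ?subr_ge0//.
exact: le_trans (ltW x0) xD.
Qed.

End extension.

Section assembly.
Context {R : realType} {n : nat}.
Local Notation V := 'rV[R]_n.+1.
Local Notation mu := (@lebesgue R n).
Variable Om : set V.
Hypotheses (Om0 : Om !=set0) (oOm : open Om) (bOm : bounded_set Om).
Local Notation d := (bdist Om).

Lemma closure_extension (g : V -> R) : {within closure Om, continuous g} ->
  exists G : V -> R, continuous G /\ forall x, closure Om x -> g x = G x.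
Proof.
move=> cg; have cK := compact_closure bOm.
have [M [_ hM]] := compact_bounded (continuous_compact cg cK).
apply: (@bounded_extension _ _ _ g (`|M| + 1) (@closed_closure _ Om) cg) => x Kx.
by apply: (hM (`|M| + 1)); [rewrite ltr_pwDr// ler_norm|exists x].
Qed.

Lemma initial_frontier (u : R * V -> R) x : {within `[0%R, +oo[ `*` closure Om, continuous u} ->
  (forall t, 0 < t -> u (t, x) = 0) -> closure Om x -> u (0, x) = 0.
Proof.
move=> /subspace_continuousP cu u0 Kx; apply/eqP; rewrite -normr_le0.
apply/ler_addgt0Pr => e e0; rewrite add0r.
have S0 : (`[0%R, +oo[ `*` closure Om) ((0 : R), x) by split => //=; rewrite in_itv/= lexx.
have /cvgrPdist_lt /(_ _ e0) := cu _ S0; rewrite /within/= => /nbhs_pairP[r r0 hr].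
have := hr (r / 2) x; rewrite subr0 ger0_norm ?divr_ge0 ?(ltW r0)//.
have r2 : r / 2 < r by rewrite ltr_pdivrMr// ltr_pMr// ltr1n.
rewrite subrr enorm0 => /(_ r2 r0) h.
have {}h : `|u (0, x) - u (r / 2, x)| < e.
  by apply: h; split => //; rewrite in_itv/= divr_ge0// ltW.
by move: h; rewrite (u0 (r / 2)) ?divr_gt0// subr0 => /ltW.
Qed.

Lemma cylinder_extension (u : R * V -> R) (M : R) :
  {within `[0%R, +oo[ `*` closure Om, continuous u} ->
  (forall t x, 0 <= t -> closure Om x -> `|u (t, x)| <= M) ->
  exists U : R * V -> R, continuous U /\ forall t x, 0 <= t -> closure Om x -> u (t, x) = U (t, x).
Proof.
move=> cu uM.
have cS : closed (`[0%R, +oo[ `*` closure Om : set (R * V)).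
  have -> : `[0%R, +oo[ `*` closure Om = fst @^-1` `[0%R, +oo[ `&` snd @^-1` closure Om :> set (R * V).
    by [].
  apply: closedI; apply: closed_comp.
  - by move=> [a b] _; exact: (@cvg_fst _ _ (nbhs a) (nbhs b)).
  - exact: interval_closed.
  - by move=> [a b] _; exact: (@cvg_snd _ _ (nbhs a) (nbhs b)).
  - exact: closed_closure.
have [|U [cU uU]] := @bounded_extension _ _ _ u M cS cu.
  by move=> [t x] [/=]; rewrite in_itv/= andbT => t0 Kx; exact: uM.
by exists U; split => // t x t0 Kx; apply: uU; split => //=; rewrite in_itv/= t0.
Qed.

(** The condition on [d] keeps the points in a compact subset of [Om]. *)
Lemma interior_lower_bound (w : V -> R) (k p q : R) : continuous w -> (forall x, Om x -> 0 < w x) ->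
  0 < q -> 0 < p -> exists2 m, 0 < m & forall x, Om x -> q < k * d x `^ p -> m <= w x.
Proof.
move=> cw w0 q0 p0.
have [|k0] := leP k 0.
  move=> k0; exists 1 => // x _; rewrite ltNge (le_trans _ (ltW q0))//.
  by rewrite mulr_le0_ge0// powR_ge0.
pose e := (q / k) `^ p^-1; have e0 : 0 < e by apply: powR_gt0; exact: divr_gt0.
pose Q := closure Om `&` [set x | e <= d x].
have Qd x : Om x -> q < k * d x `^ p -> Q x.
  move=> Ox hx; split; first exact: sub_closure.
  rewrite /= leNgt; apply/negP => dx; move: hx; apply/negP; rewrite -leNgt mulrC -ler_pdivlMr//.
  have -> : q / k = e `^ p by rewrite /e -powRrM mulVf ?powRr1 ?gt_eqF// divr_ge0// ltW.
  by apply: ge0_ler_powR; rewrite ?nnegrE ?bdist_ge0// ltW.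
have QO x : Q x -> Om x.
  move=> [Kx /= ex]; apply: contrapT => nO; have fx : frontier Om x by rewrite frontierE.
  by move: ex; rewrite (bdist_frontier Om0 oOm bOm fx) leNgt e0.
have cQ : compact Q.
  apply: compact_closedI; first exact: compact_closure.
  have -> : [set x | e <= d x] = d @^-1` [set t | e <= t] by [].
  apply: closed_comp; last exact: closed_ge.
  by move=> x _; exact: bdist_continuous.
have [Q0|nQ] := pselect (Q !=set0); last by exists 1 => // x Ox /(Qd x Ox) Qx; case: nQ; exists x.
have [y] := compact_EVT_min Q0 cQ (continuous_subspaceT cw).
rewrite inE => Qy hy; exists (w y); first exact/w0/QO.
by move=> x Ox /(Qd x Ox) Qx; apply: hy; rewrite inE.
Qed.

End assembly.

Lemma continuous_at_oppf {R : realType} {X : topologicalType} (g : X -> R) (x : X) :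
  {for x, continuous g} -> {for x, continuous (fun y => - g y)}.
Proof. by move=> cg; exact: (cvgN cg). Qed.

Section sign_arithmetic.
Context {R : realFieldType}.
Implicit Types C X lam lambar K w p m : R.

Lemma boundary_sign (q1 q2 alpha : R) C X lam lambar K w p m : (q1 + q2) * X <= C * (alpha / 4) * X ->
  lam * C * p <= m -> m <= alpha / 4 * C * X -> 0 <= (lambar - lam) * (K * w) ->
  q1 * X + q2 * X - C * (alpha / 2 * X) + lam * (K * w + C * p) - lambar * (K * w) <= 0.
Proof. by move=> h1 h2 h3 h4; lra. Qed.

Lemma interior_sign (q1 q2 alpha : R) C X lam lambar K w p m : (q1 + q2) * X <= C * (alpha / 4) * X ->
  lam * C * p <= m -> m <= (lambar - lam) * (K * w) -> 0 <= C * (alpha / 4) * X ->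
  q1 * X + q2 * X - C * (alpha / 2 * X) + lam * (K * w + C * p) - lambar * (K * w) <= 0.
Proof. by move=> h1 h2 h3 h4; lra. Qed.

End sign_arithmetic.

Section constants.
Context {R : realType} {n : nat}.
Local Notation V := 'rV[R]_n.+1.
Variable Om : set V.
Hypotheses (Om0 : Om !=set0) (oOm : open Om) (bOm : bounded_set Om).
Local Notation d := (bdist Om).

(** Near the boundary the zero order term of the barrier dominates; in the
    interior the positive eigenfunction, multiplied by [lambar - lam], does. *)
Lemma comparison_constants (w : V -> R) (s eta alpha lam lambar q1 q2 B : R) :
  continuous w -> (forall x, Om x -> 0 < w x) -> 0 < s -> 0 < eta -> 0 < alpha -> lam < lambar ->
  0 <= q1 -> 0 <= q2 -> exists C K, [/\ 0 < C, 0 < K, B <= C &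
    forall x, Om x -> q1 * d x `^ (eta - 2 * s) + q2 * d x `^ (eta - 2 * s) -
      C * (alpha / 2 * d x `^ (eta - 2 * s)) + lam * (K * w x + C * d x `^ eta) -
      lambar * (K * w x) <= 0].
Proof.
move=> cw w0 s0 eta0 alpha0 ll q10 q20.
have s20 : 0 < 2 * s by rewrite mulr_gt0.
have a4 : 0 < alpha / 4 by rewrite divr_gt0.
have [m m0 hm] := interior_lower_bound Om0 oOm bOm `|lam| cw w0 a4 s20.
have [D D0 hD] := bdist_bounded Om0 oOm bOm.
pose C := `|B| + (q1 + q2) / (alpha / 4) + 1.
have C0 : 0 < C by rewrite ltr_pwDr// addr_ge0// divr_ge0 ?addr_ge0// ltW.
have qC : q1 + q2 <= C * (alpha / 4).
  rewrite -ler_pdivrMr// /C -addrA addrCA lerDl addr_ge0//.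
have lm0 : 0 < (lambar - lam) * m by rewrite mulr_gt0// subr_gt0.
(* [K (lambar - lam) m] dominates [lam C d ^ eta] where [w >= m] *)
pose K := `|lam| * C * D `^ eta / ((lambar - lam) * m) + 1.
have lC0 : 0 <= `|lam| * C * D `^ eta by rewrite mulr_ge0 ?powR_ge0// mulr_ge0// ltW.
have K0 : 0 < K by rewrite ltr_pwDr// divr_ge0// ltW.
exists C, K; split => //.
  by rewrite /C -addrA (le_trans (ler_norm B))// lerDl addr_ge0// divr_ge0 ?addr_ge0// ltW.
move=> x Ox; have dx0 := bdist_gt0 Om0 oOm bOm Ox.
set X := d x `^ (eta - 2 * s); have X0 : 0 < X by exact: powR_gt0.
have Ed : d x `^ eta = d x `^ (2 * s) * X.
  by rewrite -powRD ?(gt_eqF dx0) ?implybT//; congr (_ `^ _); ring.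
have qX := ler_wpM2r (ltW X0) qC.
have lamC : lam * C * d x `^ eta <= `|lam| * C * d x `^ eta.
  by rewrite ler_wpM2r ?powR_ge0// ler_wpM2r ?ler_norm// ltW.
have Kw0 : 0 <= (lambar - lam) * (K * w x).
  by rewrite mulr_ge0 ?subr_ge0 ?(ltW ll)// mulr_ge0 ?(ltW K0)// ltW// w0.
have [le4|gt4] := leP (`|lam| * d x `^ (2 * s)) (alpha / 4).
  have h : `|lam| * C * d x `^ eta <= alpha / 4 * C * X.
    have -> : `|lam| * C * d x `^ eta = `|lam| * d x `^ (2 * s) * (C * X) by rewrite Ed; ring.
    by rewrite -[leRHS]mulrA ler_wpM2r// mulr_ge0// ltW.
  exact: boundary_sign qX lamC h Kw0.
have h1 : `|lam| * C * d x `^ eta <= `|lam| * C * D `^ eta.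
  rewrite ler_wpM2l ?mulr_ge0 ?(ltW C0)//; apply: ge0_ler_powR; rewrite ?nnegrE ?(ltW eta0) ?(ltW dx0) ?(ltW D0)//.
  exact: hD.
have h2 : `|lam| * C * D `^ eta <= (lambar - lam) * (K * w x).
  apply: (@le_trans _ _ ((lambar - lam) * m * K)).
    by rewrite [leRHS]mulrC -ler_pdivrMr// lerDl.
  rewrite -mulrA (mulrC m) !mulrA ler_wpM2l ?hm// mulr_ge0 ?subr_ge0 ?(ltW ll)//; exact: ltW.
have h3 : 0 <= C * (alpha / 4) * X by rewrite mulr_ge0 ?mulr_ge0 ?(ltW C0) ?(ltW a4)// ltW.
exact: interior_sign qX lamC (le_trans h1 h2) h3.
Qed.

End constants.

Theorem theorem2p6 (R : realType) (n : nat) (s : R)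
  (Om : set 'rV[R]_n.+1) (Sigma : set 'rV[R]_n.+1)
  (A : 'rV[R]_n.+1 -> set 'rV[R]_n.+1)
  (At : R * 'rV[R]_n.+1 -> set 'rV[R]_n.+1)
  (h f u0 v : 'rV[R]_n.+1 -> R) (ht ft u : R * 'rV[R]_n.+1 -> R)
  (alpha beta eta1 C0 eta2 lam lambar C1 C2 : R)
  (s01 : 0 < s < 1)
  (Om_neq0 : Om !=set0) (Om_open : open Om) (Om_connected : connected Om)
  (Om_bounded : bounded_set Om)
  (alpha0 : 0 < alpha) (alpha_beta : alpha <= beta)
  (h_cont : {within Om, continuous h})
  (h_bounds : forall x, Om x ->
    alpha / bdist Om x `^ (2 * s) <= h x <= beta / bdist Om x `^ (2 * s))
  (f_cont : {within Om, continuous f})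
  (A_meas : forall x, Om x -> lebesgue_measurable (A x))
  (A_sub : forall x, Om x -> A x `<=` Om)
  (Sigma_open : open Sigma)
  (A_cont : forall x, Om x ->
    @lebesgue R n (A y `+` A x) @[y --> within Om (nbhs x)] --> 0%E)
  (A_cone : exists zeta : R, 0 < zeta < 2^-1 /\
    forall x, Om x -> forall r, r <= zeta * bdist Om x ->
      reflected x (A x) `&` eball 0 r = Sigma `&` eball 0 r)
  (Sigma_sym : Sigma = [set - z | z in Sigma])
  (Sigma_density : exists q : R, 0 < q < 1 /\ forall r, 0 < r ->
    (q%:E * @lebesgue R n (annulus r) <= @lebesgue R n (Sigma `&` annulus r))%E)
  (ht_cont : {within cylinder Om, continuous ht})
  (ht_bounds : forall t x, 0 < t -> Om x ->
    alpha / bdist Om x `^ (2 * s) <= ht (t, x)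
      <= beta / bdist Om x `^ (2 * s))
  (At_meas : forall t x, 0 < t -> Om x -> lebesgue_measurable (At (t, x)))
  (At_sub : forall t x, 0 < t -> Om x -> At (t, x) `<=` Om)
  (At_cont : forall t x, 0 < t -> Om x ->
    @lebesgue R n (At p `+` At (t, x))
      @[p --> within (cylinder Om) (nbhs (t, x))] --> 0%E)
  (At_cone : exists zeta : R, 0 < zeta < 2^-1 /\
    forall t x, 0 < t -> Om x -> forall r, r <= zeta * bdist Om x ->
      reflected x (At (t, x)) `&` eball 0 r = Sigma `&` eball 0 r)
  (ft_cont : {within cylinder Om, continuous ft})
  (u0_cont : {within Om, continuous u0})
  (eta1_bounds : 0 < eta1 < 2 * s) (C0_pos : 0 < C0)
  (ft_bound : forall t x, 0 < t -> Om x ->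
    `|ft (t, x)| * bdist Om x `^ (2 * s - eta1) <= C0)
  (u0_bound : forall x, Om x -> `|u0 x| * bdist Om x `^ (- eta1) <= C0)
  (lambar_eig : first_eigenvalue s Om A h lambar) (lam_lt : lam < lambar)
  (eta2_bounds : 0 < eta2 < 2 * s)
  (fh_conv : forall t x, 0 < t -> Om x ->
    (`|ft (t, x) - f x| + `|ht (t, x) - h x|)
      * bdist Om x `^ (2 * s - eta2) * expR (lam * t) <= C1)
  (A_conv : forall t x, 0 < t -> Om x ->
    (@lebesgue R n (At (t, x) `+` A x)
      * (bdist Om x `^ (- n.+1%:R - eta2) * expR (lam * t))%:E <= C2%:E)%E)
  (u_sol : initial_boundary_solution s Om At ht ft u0 u)
  (u_bounded : bounded_on (`[0, +oo[ `*` Om) u)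
  (v_sol : dirichlet_solution s Om A h 0 f v) :
  exists C eta : R, [/\ 0 < C, 0 < eta &
    forall t x, 0 < t -> Om x ->
      `|u (t, x) - v x| <= C * bdist Om x `^ eta * expR (- (lam * t))].
Proof.
have [s0 s1] := andP s01; have s20 : 0 < 2 * s by rewrite mulr_gt0.
have [e1_0 e1_2s] := andP eta1_bounds; have [e2_0 e2_2s] := andP eta2_bounds.
have [Db Db0 hDb] := bdist_bounded Om_neq0 Om_open Om_bounded.
have dgt0 x : Om x -> 0 < bdist Om x by exact: bdist_gt0.
have [cm cm0 hcm] := second_moment_le s01 Sigma_open.
have [cf cf0 hcf] := far_barrier s01 Om_neq0 Om_open Om_bounded.
have [za [/andP[za0 _] hza]] := A_cone; have [zt [/andP[zt0 _] hzt]] := At_cone.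
(* Half of the admissible opening: the sectors must still contain the ball of
   radius [zeta d x] of a limit point when they are centred at nearby points. *)
pose zeta := Num.min za zt / 2.
have zeta0 : 0 < zeta by rewrite divr_gt0// lt_min za0.
have z2 : 2 * zeta = Num.min za zt by rewrite /zeta mulrC divfK.
have sA2 x : Om x -> sector_at Om Sigma (A x) x (2 * zeta * bdist Om x).
  move=> Ox; have dx0 := dgt0 x Ox; split; [exact: A_meas|exact: A_sub|exact: Ox| |].
    by rewrite z2 mulr_gt0// lt_min za0.
  by apply: hza => //; rewrite z2 ler_wpM2r ?(ltW dx0)// ge_min lexx.
have sAt2 t x : 0 < t -> Om x -> sector_at Om Sigma (At (t, x)) x (2 * zeta * bdist Om x).
  move=> t0 Ox; have dx0 := dgt0 x Ox; split; [exact: At_meas|exact: At_sub|exact: Ox| |].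
    by rewrite z2 mulr_gt0// lt_min za0.
  by apply: hzt => //; rewrite z2 ler_wpM2r ?(ltW dx0)// ge_min lexx orbT.
have sA x : Om x -> sector_at Om Sigma (A x) x (zeta * bdist Om x).
  move=> Ox; have dx0 := dgt0 x Ox; apply: sector_at_le (sA2 x Ox); first by rewrite mulr_gt0.
  by rewrite ler_wpM2r ?(ltW dx0)// ler_peMl ?(ltW zeta0)// ler1n.
pose c7 := cm / 2 * zeta `^ (2 - 2 * s) + cf / s * zeta `^ (- s).
have c70 : 0 < c7 by rewrite addr_gt0// mulr_gt0 ?powR_gt0// divr_gt0.
(* small enough for the data, for the far part of the barrier and for its
   absorption by the zero order term *)
pose eta := Num.min (Num.min eta1 eta2) (Num.min s (alpha / 2 / c7)).
have eta0 : 0 < eta by rewrite !lt_min e1_0 e2_0 s0 !divr_gt0.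
have eta_1 : eta <= eta1 by rewrite /eta !ge_min lexx.
have eta_2 : eta <= eta2 by rewrite /eta !ge_min lexx orbT.
have eta_s : eta <= s by rewrite /eta !ge_min lexx !orbT.
have eta_small : eta * c7 <= alpha / 2.
  by rewrite -ler_pdivlMr// /eta !ge_min lexx !orbT.
have h_ge x : Om x -> alpha / bdist Om x `^ (2 * s) <= h x by move=> /h_bounds/andP[].
have [x1 Ox1] := Om_neq0.
have weaken a b x : b <= a -> Om x -> bdist Om x `^ a <= Db `^ (a - b) * bdist Om x `^ b.
  by move=> ba Ox; apply: powR_weaken => //; [exact: dgt0|exact: hDb].
have pow_move a x (y c : R) : Om x -> y * bdist Om x `^ a <= c -> y <= c * bdist Om x `^ (- a).
  by move=> Ox; rewrite powRN -ler_pdivlMr// powR_gt0// dgt0.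
(* The solutions matter on the closure of the domain only; everywhere continuous
   extensions make all the integrands measurable. *)
have [cu_ usub usup ufr uini] := u_sol.
have [vc vsub vsup vfr] := v_sol.
have [lambar0 [w0 [[wc wsub wsup wfr] wpos]]] := lambar_eig.
have [v' [cv' vv']] := closure_extension Om_bounded vc.
have [w [cw ww']] := closure_extension Om_bounded wc.
have in_closure x : Om x -> closure Om x by exact: sub_closure.
have fr_closure x : frontier Om x -> closure Om x by case.
have closure_split x : closure Om x -> Om x \/ frontier Om x.
  by move=> Kx; have [|nO] := pselect (Om x); [left|right; rewrite frontierE].
have u_frontier t x : 0 <= t -> frontier Om x -> u (t, x) = 0.
  rewrite le_eqVlt => /predU1P[<-|t0] fx; last exact: ufr.
  by apply: (initial_frontier cu_ _ (fr_closure x fx)) => t' t'0; exact: ufr.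
have [M0 hM0] := u_bounded; pose M := `|M0|.
have uM t x : 0 <= t -> closure Om x -> `|u (t, x)| <= M.
  move=> t0 /closure_split[Ox|fx]; last by rewrite u_frontier// normr0 /M.
  by rewrite (le_trans (hM0 (t, x) _)) ?ler_norm//; split => //=; rewrite in_itv/= t0.
have [U [cU uU]] := cylinder_extension cu_ uM.
have UM t x : 0 < t -> Om x -> `|U (t, x)| <= M.
  by move=> t0 Ox; rewrite -uU ?(ltW t0) ?uM ?(ltW t0)//; exact: in_closure.
have UMq q : cylinder Om q -> `|U q| <= M.
  by case: q => t x [/=]; rewrite in_itv/= andbT => t0 Ox; exact: UM.
have uUq : {in cylinder Om, u =1 U}.
  move=> [t x]; rewrite inE => -[/=]; rewrite in_itv/= andbT => t0 Ox.
  by apply: uU; [exact: ltW|exact: in_closure].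
have vv : {in Om, v =1 v'} by move=> x; rewrite inE => /in_closure/vv'.
have ww : {in Om, w0 =1 w} by move=> x; rewrite inE => /in_closure/ww'.
have [_ [Mv hMv]] := tame_continuous Om_bounded cv'.
have [_ [Mw hMw]] := tame_continuous Om_bounded cw.
have v'fr x : frontier Om x -> v' x = 0 by move=> fx; rewrite -vv' ?vfr//; exact: fr_closure.
have wfr' x : frontier Om x -> w x = 0 by move=> fx; rewrite -ww' ?wfr//; exact: fr_closure.
have wgt0 x : Om x -> 0 < w x by move=> Ox; rewrite -ww ?inE//; exact: wpos.
have vsubj x a (b : R) : Om x -> (forall y, Om y -> v' y <= quadratic x (v' x) a b y) ->
    Ls_le s (A x) v' x (f x - h x * v' x).
  move=> Ox hq; have := elliptic_sub_jet s01 Om_open Om_bounded Sigma_open Sigma_sym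
    vsub cv' vv hMv (sA x Ox) hq.
  by rewrite mul0r add0r.
have vsupj x a (b : R) : Om x -> (forall y, Om y -> - v' y <= quadratic x (- v' x) a b y) ->
    Ls_le s (A x) (fun y => - v' y) x (h x * v' x - f x).
  move=> Ox hq; have := elliptic_super_jet s01 Om_open Om_bounded Sigma_open Sigma_sym
    vsup cv' vv hMv (sA x Ox) hq.
  by rewrite mul0r subr0.
have wsubj x a (b : R) : Om x -> (forall y, Om y -> w y <= quadratic x (w x) a b y) ->
    Ls_le s (A x) w x (lambar * w x - h x * w x).
  move=> Ox hq; have := elliptic_sub_jet s01 Om_open Om_bounded Sigma_open Sigma_sym
    wsub cw ww hMw (sA x Ox) hq.
  by rewrite /cst addr0.
have wsupj x a (b : R) : Om x -> (forall y, Om y -> - w y <= quadratic x (- w x) a b y) ->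
    Ls_le s (A x) (fun y => - w y) x (h x * w x - lambar * w x).
  move=> Ox hq; have := elliptic_super_jet s01 Om_open Om_bounded Sigma_open Sigma_sym
    wsup cw ww hMw (sA x Ox) hq.
  by rewrite /cst subr0.
(* All the errors are brought to the common size [d ^ (eta - 2 s) E], at the cost
   of a power of a bound for [d]. *)
pose E t := expR (- (lam * t)).
have Emove t (y c : R) : y * expR (lam * t) <= c -> y <= c * E t.
  by rewrite /E expRN -ler_pdivlMr ?expR_gt0.
have C1_ge0 : 0 <= C1.
  by apply: le_trans (fh_conv 1 x1 ltr01 Ox1); rewrite !mulr_ge0 ?powR_ge0 ?expR_ge0.
have C2_ge0 : 0 <= C2.
  rewrite -lee_fin; apply: le_trans (A_conv 1 x1 ltr01 Ox1).
  by rewrite mule_ge0// lee_fin mulr_ge0 ?powR_ge0 ?expR_ge0.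
pose C1' := C1 * Db `^ (eta2 - eta); pose C2' := C2 * Db `^ (eta2 - eta).
have C1'0 : 0 <= C1' by rewrite mulr_ge0 ?powR_ge0.
have C2'0 : 0 <= C2' by rewrite mulr_ge0 ?powR_ge0.
have data_conv t x : 0 < t -> Om x ->
    `|ft (t, x) - f x| + `|ht (t, x) - h x| <= C1' * bdist Om x `^ (eta - 2 * s) * E t.
  move=> t0 Ox; have := fh_conv t x t0 Ox; rewrite -mulrA (mulrC (_ `^ _)) mulrA => /(pow_move _ _ _ _ Ox).
  move=> /Emove; move/le_trans; apply; rewrite ler_wpM2r ?expR_ge0//.
  rewrite opprB /C1' -mulrA ler_wpM2l//; have := @weaken (eta2 - 2 * s) (eta - 2 * s) x.
  by rewrite lerD2r opprB addrA subrK; apply.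
have set_conv t x : 0 < t -> Om x ->
    fine (@lebesgue R n (At (t, x) `+` A x)) <= C2' * bdist Om x `^ (n.+1%:R + eta) * E t.
  move=> t0 Ox; have := A_conv t x t0 Ox.
  have fin : @lebesgue R n (At (t, x) `+` A x) \is a fin_num.
    rewrite ge0_fin_numE//; apply: (bounded_fin Om_bounded) => y.
    by rewrite setY_def => -[[/(At_sub t x t0 Ox)]|[/(A_sub x Ox)]].
  rewrite -{1}(fineK fin) -EFinM lee_fin mulrA => /Emove /(pow_move _ _ _ _ Ox).
  rewrite mulrAC; move/le_trans; apply; rewrite ler_wpM2r ?expR_ge0//.
  rewrite /C2' -mulrA ler_wpM2l//; have := @weaken (n.+1%:R + eta2) (n.+1%:R + eta) x.
  have -> : - (- n.+1%:R - eta2) = n.+1%:R + eta2 by ring.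
  have -> : n.+1%:R + eta2 - (n.+1%:R + eta) = eta2 - eta by ring.
  by rewrite lerD2l; apply.
have f_bound : exists2 CF, 0 <= CF & forall x, Om x -> `|f x| <= CF * bdist Om x `^ (eta - 2 * s).
  pose CF := C0 * Db `^ (eta1 - eta) + C1' * E 1.
  exists CF; first by rewrite addr_ge0 ?mulr_ge0 ?powR_ge0 ?expR_ge0// ltW.
  move=> x Ox; have h1 := data_conv 1 x ltr01 Ox.
  have h2 := pow_move _ _ _ _ Ox (ft_bound 1 x ltr01 Ox).
  (* the bound on [ft] passes to [f] through the convergence at time 1 *)
  have h3 : `|f x| <= `|ft (1, x)| + (`|ft (1, x) - f x| + `|ht (1, x) - h x|).
    have := ler_normB (ft (1, x)) (ft (1, x) - f x); rewrite subKr => /le_trans; apply.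
    by rewrite lerD2l lerDl.
  apply: (le_trans h3); rewrite /CF mulrDl; apply: lerD; last by rewrite mulrAC.
  apply: (le_trans h2); rewrite -mulrA ler_wpM2l ?(ltW C0_pos)//.
  have := @weaken (eta1 - 2 * s) (eta - 2 * s) x.
  by rewrite lerD2r opprB opprB addrA subrK; apply.
have [CF CF0 hCF] := f_bound.
have barrier := elliptic_barrier_bound s01 Om_neq0 Om_open Om_bounded Sigma_open Sigma_sym
  zeta0 sA hcm hcf alpha0 h_ge eta0 eta_s eta_small.
have v_up x : Om x -> v' x <= (2 * CF / alpha + 1) * bdist Om x `^ eta.
  apply: (barrier _ f CF cv' v'fr vsubj CF0) => y Oy.
  by apply: le_trans (hCF y Oy); exact: ler_norm.
have v_low x : Om x -> - v' x <= (2 * CF / alpha + 1) * bdist Om x `^ eta.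
  apply: (barrier (fun y => - v' y) (fun y => - f y) CF (continuous_oppf cv')) => //.
  - by move=> y /v'fr->; rewrite oppr0.
  - by move=> y a b Oy hq; rewrite mulrN opprK addrC; exact: vsupj hq.
  - by move=> y Oy; apply: le_trans (hCF y Oy); rewrite -normrN; exact: ler_norm.
have [Cw [Cw0 w_up]] : exists Cw, 0 <= Cw /\ forall x, Om x -> w x <= Cw * bdist Om x `^ eta.
  pose CFw := lambar * `|Mw| * Db `^ (2 * s - eta).
  have CFw0 : 0 <= CFw by rewrite !mulr_ge0 ?powR_ge0// ltW.
  exists (2 * CFw / alpha + 1); split.
    by rewrite addr_ge0// divr_ge0// ?(ltW alpha0)// mulr_ge0.
  apply: (barrier w (fun y => lambar * w y) CFw cw wfr' wsubj CFw0) => y Oy.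
  rewrite -!mulrA ler_wpM2l ?(ltW lambar0)//.
  apply: (@le_trans _ _ `|Mw|).
    by rewrite (le_trans (ler_norm _))// (le_trans (hMw y Oy))// ler_norm.
  rewrite ler_peMr//; have := @weaken 0 (eta - 2 * s) y.
  rewrite powRr0 sub0r opprB; apply => //; rewrite subr_le0 (le_trans eta_s)//.
  by rewrite ler_peMl ?(ltW s0)// ler1n.
pose q1 := C1' * (1 + M); pose q2 := 2 * M * (zeta `^ (n.+1%:R + 2 * s))^-1 * C2'.
have M_ge0 : 0 <= M by exact: normr_ge0.
have q1_0 : 0 <= q1 by rewrite mulr_ge0// addr_ge0.
have q2_0 : 0 <= q2.
  apply: (mulr_ge0 _ C2'0); apply: mulr_ge0; first exact: mulr_ge0.
  by rewrite invr_ge0 powR_ge0.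
have [C [K [Cgt0 Kgt0 BC hCK]]] := comparison_constants Om_neq0 Om_open Om_bounded
  (C0 * Db `^ (eta1 - eta) + (2 * CF / alpha + 1)) cw wgt0 s0 eta0 alpha0 lam_lt q1_0 q2_0.
have initial x : Om x -> `|u0 x| + `|v' x| <= C * bdist Om x `^ eta.
  move=> Ox; apply: (@le_trans _ _ ((C0 * Db `^ (eta1 - eta) + (2 * CF / alpha + 1)) * bdist Om x `^ eta)).
    rewrite mulrDl lerD//.
      have := pow_move _ _ _ _ Ox (u0_bound x Ox); rewrite opprK => /le_trans; apply.
      by rewrite -mulrA ler_wpM2l ?(ltW C0_pos)// weaken.
    by rewrite ler_norml v_up// andbT lerNl v_low.
  by rewrite ler_wpM2r ?powR_ge0.
have ch x : Om x -> {for x, continuous h} by exact: open_within_continuous.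
have cf_ x : Om x -> {for x, continuous f} by exact: open_within_continuous.
have oC := open_cylinder Om_open.
have cht t x : 0 < t -> Om x -> {for (t, x), continuous ht}.
  by move=> t0 Ox; apply: (open_within_continuous oC ht_cont); exact: cylinder_in.
have cft t x : 0 < t -> Om x -> {for (t, x), continuous ft}.
  by move=> t0 Ox; apply: (open_within_continuous oC ft_cont); exact: cylinder_in.
have Usubj t x phi a (b D : R) : 0 < t -> Om x -> C2_on (cylinder Om) phi ->
    (forall q, cylinder Om q -> U q <= phi q) ->
    (forall y, phi (t, y) = quadratic x (U (t, x)) a b y) ->
    is_derive t 1 (fun t' : R => phi (t', x)) D ->
    Ls_le s (At (t, x)) (fun y => U (t, y)) x (ft (t, x) - D - ht (t, x) * U (t, x)).
  move=> t0 Ox C2phi Up pq dp.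
  have := parabolic_sub_jet s01 Om_open Om_bounded Sigma_open Sigma_sym
    usub cU uUq UMq (cylinder_in t0 Ox) (sAt2 t x t0 Ox) C2phi Up (fun y _ => pq y).
  by rewrite derive1E (@derive_val _ _ _ _ _ _ _ dp).
have Usupj t x phi a (b D : R) : 0 < t -> Om x -> C2_on (cylinder Om) phi ->
    (forall q, cylinder Om q -> - U q <= phi q) ->
    (forall y, phi (t, y) = quadratic x (- U (t, x)) a b y) ->
    is_derive t 1 (fun t' : R => phi (t', x)) D ->
    Ls_le s (At (t, x)) (fun y => - U (t, y)) x (- ft (t, x) - D - ht (t, x) * - U (t, x)).
  move=> t0 Ox C2phi Up pq dp.
  have := parabolic_super_jet s01 Om_open Om_bounded Sigma_open Sigma_sym
    usup cU uUq UMq (cylinder_in t0 Ox) (sAt2 t x t0 Ox) C2phi Up (fun y _ => pq y).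
  have dN : is_derive t 1 (fun t' : R => - phi (t', x)) (- D) by exact: is_deriveN.
  rewrite derive1E (@derive_val _ _ _ _ _ _ _ dN).
  by congr (Ls_le _ _ _ _ _); ring.
have U_frontier t x : 0 <= t -> frontier Om x -> U (t, x) = 0.
  by move=> t0 fx; rewrite -uU ?u_frontier//; exact: fr_closure.
have U_initial x : Om x -> U (0, x) = u0 x.
  by move=> Ox; rewrite -uU ?uini//; exact: in_closure.
have upper t x : 0 < t -> Om x -> U (t, x) - v' x <= E t * (K * w x + C * bdist Om x `^ eta).
  apply: (parabolic_comparison s01 Om_neq0 Om_open Om_bounded Sigma_open Sigma_sym
    cU cv' cw UM Usubj vsupj wsupj zeta0 sA2 sAt2 hcm hcf eta0 eta_s Cgt0 Kgt0 ch cf_ cht cft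
    A_cont At_cont alpha0 h_ge data_conv set_conv eta_small hCK wgt0 U_frontier v'fr wfr').
  move=> y Oy; rewrite U_initial//; apply: le_trans (initial y Oy); apply: lerD; first exact: ler_norm.
  by rewrite -normrN ler_norm.
have cUN : continuous (fun q => - U q) by move=> q; exact: (cvgN (cU q)).
have lower t x : 0 < t -> Om x -> - U (t, x) - - v' x <= E t * (K * w x + C * bdist Om x `^ eta).
  apply: (parabolic_comparison s01 Om_neq0 Om_open Om_bounded Sigma_open Sigma_sym
    (f := fun y => - f y) (ft := fun q => - ft q) (U := fun q => - U q) (v := fun y => - v' y)
    cUN (continuous_oppf cv') cw _ Usupj _ wsupj zeta0 sA2 sAt2 hcm hcf eta0 eta_s Cgt0 Kgt0 ch _ cht _
    A_cont At_cont alpha0 h_ge _ set_conv eta_small hCK wgt0).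
  - by move=> t' y t'0 Oy; rewrite normrN; exact: UM.
  - move=> y a b Oy hq.
    have -> : (fun z => - - v' z) = v' by apply/funext => z; rewrite opprK.
    rewrite mulrN opprK addrC; apply: (vsubj y a b Oy) => z Oz.
    by have := hq z Oz; rewrite !opprK.
  - by move=> y Oy; apply: continuous_at_oppf; exact: cf_.
  - by move=> t' y t'0 Oy; apply: continuous_at_oppf; exact: cft.
  - by move=> t' y t'0 Oy; rewrite -opprD normrN; exact: data_conv.
  - by move=> t' y t'0 fy; rewrite U_frontier// oppr0.
  - by move=> y fy; rewrite v'fr// oppr0.
  - exact: wfr'.
  - move=> y Oy; rewrite U_initial// opprK; apply: le_trans (initial y Oy).
    by apply: lerD; [rewrite -normrN|]; exact: ler_norm.
exists (K * Cw + C), eta; split => //.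
  by rewrite ltr_wpDl// mulr_ge0// ltW.
move=> t x t0 Ox; rewrite uUq ?inE; last exact: cylinder_in.
rewrite vv ?inE//; apply: (@le_trans _ _ (E t * (K * w x + C * bdist Om x `^ eta))).
  by rewrite ler_norml upper// andbT lerNl opprB addrC -[v' x]opprK lower.
rewrite mulrC ler_wpM2r ?expR_ge0// mulrDl lerD2r -mulrA ler_wpM2l ?(ltW Kgt0)//; exact: w_up.
Qed.
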